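(* There is an algorithm that, given a graph $G$ and an integer $k$, decides whether $G$ has a vertex cover of size at most $\mu(G)+k$ in time $O^*(4^k)$.
   Context: $\mu(G)$ denotes the size of a maximum matching of $G$. $O^*(\cdot)$ suppresses factors polynomial in the input size. *)

(* Defs.v *)
From mathcomp Require Import all_boot.
Set Implicit Arguments. Unset Strict Implicit. Unset Printing Implicit Defensive.

(* ---------- Graphs: a finite simple graph on vertex set 'I_n is given by a
   symmetric irreflexive relation e : rel 'I_n (hypotheses in the theorem). *)
Section Graphs.
Variables (n : nat) (e : rel 'I_n).

Definition is_edge (f : {set 'I_n}) : bool :=
  [exists u, exists v, e u v && (f == [set u; v])].

Definition is_matching (M : {set {set 'I_n}}) : bool :=
  [forall f in M, is_edge f] &&
  [forall f in M, forall f' in M, (f != f') ==> [disjoint f & f']].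

Definition mu : nat := \max_(M : {set {set 'I_n}} | is_matching M) #|M|.

Definition is_vertex_cover (S : {set 'I_n}) : bool :=
  [forall u, forall v, e u v ==> (u \in S) || (v \in S)].

Definition vc_above_mm (k : nat) : bool :=
  [exists S : {set 'I_n}, is_vertex_cover S && (#|S| <= mu + k)].
End Graphs.

(* ---------- Machine model: deterministic single-tape Turing machines with
   finitely many states and symbols, two-way infinite tape.
   States  : 'I_(tm_nstates.+3), 0 = start, 1 = accept, 2 = reject (halting).
   Symbols : 'I_(tm_nsyms.+4),   0 = blank, 1 = bit 0, 2 = bit 1, 3 = separator.
   tm_delta q a = (q', b, mv): write b, go to q', move right iff mv. *)
Record TM := mkTM {
  tm_nstates : nat;
  tm_nsyms : nat;
  tm_delta : 'I_(tm_nstates.+3) -> 'I_(tm_nsyms.+4) ->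
             'I_(tm_nstates.+3) * 'I_(tm_nsyms.+4) * bool }.

Section TMSemantics.
Variable M : TM.
Notation St := 'I_(tm_nstates M).+3.
Notation Sym := 'I_(tm_nsyms M).+4.

(* configuration: state, left tape (nearest cell first), head symbol, right tape *)
Record config := Config { c_state : St; c_left : seq Sym; c_head : Sym; c_right : seq Sym }.

Definition blank : Sym := inord 0.

Definition halting (q : St) : bool := (val q == 1) || (val q == 2).

Definition step (c : config) : config :=
  if halting (c_state c) then c else
  let: (q', b, mv) := tm_delta (c_state c) (c_head c) in
  if mv then
    match c_right c with
    | [::] => Config q' (b :: c_left c) blank [::]
    | x :: r => Config q' (b :: c_left c) x r
    end
  else
    match c_left c with
    | [::] => Config q' [::] blank (b :: c_right c)
    | x :: l => Config q' l x (b :: c_right c)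
    end.

Definition run (t : nat) (c : config) : config := iter t step c.

Definition init (w : seq nat) : config :=
  match [seq (inord x : Sym) | x <- w] with
  | [::] => Config (inord 0) [::] blank [::]
  | a :: r => Config (inord 0) [::] a r
  end.

Definition decides_within (w : seq nat) (t : nat) (b : bool) : Prop :=
  val (c_state (run t (init w))) = (if b then 1 else 2).
End TMSemantics.

(* ---------- Input encoding of (G, k): the n*n adjacency matrix row by row
   (code 1 = no edge, code 2 = edge), then a separator (code 3), then k in unary. *)
Definition encode (n : nat) (e : rel 'I_n) (k : nat) : seq nat :=
  [seq (if e i j then 2 else 1) | i <- enum 'I_n, j <- enum 'I_n]
  ++ 3 :: nseq k 2.

(* Main.v *)
Require Import Defs.
From mathcomp Require Import all_boot.
From mathcomp Require Import zify.
From Stdlib Require Import FunctionalExtensionality Classical.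
Set Implicit Arguments. Unset Strict Implicit. Unset Printing Implicit Defensive.

(* The fractional vertex cover optimum LP lies between mu(G) and the vertex cover
   number vc(G).  Process the vertices one by one: if some fractional optimum gives
   v the value 0 (or 1), then so does some optimal integral cover, and v can be
   fixed for free; otherwise either choice raises LP by at least 1/2, so at most
   2(vc - LP) <= 2k binary choices are made when vc <= mu + k.  Hence G has a cover
   of size at most mu + k iff some string of 2k bits drives a polynomial-time
   procedure to one, and the machine tries the 4^k strings in turn.  The value 2 LP
   is the matching number of the bipartite double cover (Konig), so both LP and mu
   come from a maximum matching algorithm.  Blossoms are never contracted: the
   search grows one alternating tree, storing for every vertex its odd ancestors,
   and an edge joining two even vertices turns every odd vertex that is an ancestor
   of exactly one of them into an even one.

   Data are binary trees, serialised on the stacks of a small imperative language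
   that is compiled to single-tape machines, one track per stack; polynomial-time
   computability is then a closure property of functions. *)

(** * Stack programs on a Turing machine *)

(** Two obstacles shape the development. On a single tape a stack operation costs the height of the
    stack, so a height bound taken from the total running time would square the factor [4^k];
    heights are therefore bounded round by round. Secondly, an uncontracted tree yields no explicit
    augmenting path. The tree search only decides whether an augmentation exists. The path is then
    built by self-reduction, two edges at a time, each extension being tested by a fresh search in
    the graph that remains, so no choice is ever undone. The decision is correct because of an
    invariant that replaces blossoms: each part of the tree cut out at odd vertices becomes
    perfectly matched when any one of its even vertices is deleted. Matchings are lists of ordered
    pairs holding both orientations of an edge; this doubles every matching number and accounts for
    the scale [4 LP] of [lpv]. Soundness of the answer rests on verification alone: each candidate
    set is checked against all edges and against the budget, whereas the linear program only serves
    to show that some bit string succeeds. *)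

Definition store := nat -> seq bool.

Definition upd (s : store) (j : nat) (v : seq bool) : store :=
  fun i => if i == j then v else s i.

Inductive instr :=
  | IPush of nat & bool & nat
  | IPop of nat & nat & nat & nat
  | IJmp of nat
  | IHalt of bool.

Section StackMachine.
Variables (m : nat) (code : seq instr).

(** [None] is the marker of the origin; any other cell carries at most one bit of each stack. *)
Definition cell := option {ffun 'I_m.+1 -> option bool}.
Definition nsym := #|{: cell}|.
Definition nst := 4 * size code.
Notation Sym := 'I_nsym.+4.
Notation St := 'I_nst.+3.

Definition raw_track (a j : nat) : option bool :=
  if a == 0 then None else
  if j == 0 then Some (1 < a) else if j == 1 then Some (odd a) else None.

(** The symbols 1, 2, 3 of the input are read as cells whose tracks 0 and 1 hold the two bits of the
    symbol, so the input already is a pair of stacks. Decoding is not injective, hence tapes are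
    compared only after it. *)
Definition dec (a : Sym) : cell :=
  if a < 4 then Some [ffun j : 'I_m.+1 => raw_track a j]
  else nth None (enum {: cell}) (a - 4).

Definition enc_cell (y : cell) : Sym := inord (4 + index y (enum {: cell})).

Lemma enc_cellK y : dec (enc_cell y) = y.
Proof.
have yE : y \in enum {: cell} by rewrite mem_enum.
have lt : index y (enum {: cell}) < nsym by rewrite /nsym cardE index_mem.
rewrite /dec /enc_cell inordK; last by lia.
by rewrite ltnNge leq_addr /= addKn nth_index.
Qed.

Definition st (pc ph : nat) : St := inord (3 + (4 * pc + ph)).

Definition set_track (F : {ffun 'I_m.+1 -> option bool}) (j : nat) (o : option bool)
  : {ffun 'I_m.+1 -> option bool} :=
  [ffun i : 'I_m.+1 => if val i == j then o else F i].

(* Phase 0 runs right to the top of the relevant stack, phase 1 runs back to the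
   origin marker, phase 2 reads the top symbol, phase 3 writes the marker. *)
Definition delta (q : St) (a : Sym) : St * Sym * bool :=
  if val q == 0 then (st 0 3, a, false) else
  let pc := (val q - 3) %/ 4 in
  let ph := (val q - 3) %% 4 in
  match ph with
  | 0 =>
    match nth (IJmp 0) code pc with
    | IPush j b l =>
      match dec a with
      | Some F => if F (inord j) is None
                  then (st l 1, enc_cell (Some (set_track F j (Some b))), false)
                  else (q, a, true)
      | None => (q, a, true)
      end
    | IPop j _ _ _ =>
      match dec a with
      | Some F => if F (inord j) is None then (st pc 2, a, false) else (q, a, true)
      | None => (q, a, true)
      end
    | IJmp l => (st l 1, a, false)
    | IHalt b => (inord (if b then 1 else 2), a, true)
    end
  | 1 => if dec a is None then (st pc 0, a, true) else (q, a, false)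
  | 2 =>
    match nth (IJmp 0) code pc with
    | IPop j l0 lf lt =>
      match dec a with
      | Some F => if F (inord j) is Some b
                  then (st (if b then lt else lf) 1, enc_cell (Some (set_track F j None)), false)
                  else (q, a, false)
      | None => (st l0 0, a, true)
      end
    | _ => (q, a, true)
    end
  | _ => (st 0 0, enc_cell None, true)
  end.

Definition machine : TM := @mkTM nst nsym delta.

Notation cfg := (config machine).

(** Positions are counted from the left end of the visited tape. They keep their meaning as long as
    the head does not leave that end, whence the condition [0 < p] on left moves below. *)
Definition rep (c : cfg) (q : St) (p : nat) (F : nat -> cell) : Prop :=
  [/\ c_state c = q, size (c_left c) = p &
      forall i, dec (nth (blank machine) (rev (c_left c) ++ c_head c :: c_right c) i) = F i].

Definition fupd (F : nat -> cell) (p : nat) (y : cell) : nat -> cell :=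
  fun i => if i == p then y else F i.

Lemma nth_rev_cons (T : Type) (d : T) (l r : seq T) x i :
  nth d (rev l ++ x :: r) i =
  if i == size l then x else nth d (rev l ++ d :: r) i.
Proof.
rewrite !nth_cat size_rev; case: ltngtP => // [gt|->]; last by rewrite subnn.
by have -> : i - size l = (i - size l).-1.+1 by lia.
Qed.

Lemma step_rep (c : cfg) q p F q' b mv y :
  rep c q p F -> ~~ @halting machine q ->
  (forall a, dec a = F p -> exists2 b', delta q a = (q', b', mv) & dec b' = y) ->
  b = (if mv then p.+1 else p.-1) -> (mv = false -> 0 < p) ->
  rep (step c) q' b (fupd F p y).
Proof.
case: c => [q0 l h r] [/= -> sl Fi] nh dl -> mvp.
have hF : dec h = F p.
  by rewrite -Fi nth_rev_cons sl eqxx.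
have [b' db' b'y] := dl _ hF.
rewrite /step /= (negbTE nh) db'.
have Fup i : dec (nth (blank machine) (rev l ++ b' :: r) i) = fupd F p y i.
  rewrite /fupd nth_rev_cons sl; case: ifP => [_ //|ne].
  by rewrite -Fi nth_rev_cons [in RHS]nth_rev_cons sl ne.
case: mv mvp dl db' => [_ _ _|/(_ erefl) p0 _ _].
  case: r Fi Fup => [|x r] Fi Fup; split => /=; rewrite ?sl //.
    move=> i; rewrite -Fup rev_cons cat_rcons.
    rewrite !nth_cat size_rev; case: ltnP => // _.
    by case: (i - size l) => [|[|k]] /=; rewrite ?nth_nil.
  by move=> i; rewrite -Fup rev_cons cat_rcons.
case: l sl Fi Fup => [|x l] /= sl Fi Fup; first by rewrite -sl in p0.
split => //=; first by rewrite -sl.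
by move=> i; rewrite -Fup rev_cons cat_rcons.
Qed.

Definition reach (T : nat) (x y : St * nat * (nat -> cell)) : Prop :=
  forall c, rep c x.1.1 x.1.2 x.2 ->
  exists2 t, t <= T & rep (run t c) y.1.1 y.1.2 y.2.

Lemma reach0 x : reach 0 x x.
Proof. by move=> c; exists 0. Qed.

Lemma reach_ext T x q p F F' : F =1 F' -> reach T x (q, p, F) -> reach T x (q, p, F').
Proof.
move=> FF H c /H[t tT [a b d]]; exists t => //; split=> //= i.
by rewrite d /= FF.
Qed.

Lemma reach_trans y T1 T2 x z : reach T1 x y -> reach T2 y z -> reach (T1 + T2) x z.
Proof.
move=> H1 H2 c /H1[t1 le1 /H2[t2 le2 R]].
exists (t2 + t1); first by lia.
by rewrite /run iterD.
Qed.

Lemma reach_le T1 T2 x y : T1 <= T2 -> reach T1 x y -> reach T2 x y.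
Proof. by move=> le H c /H[t tT R]; exists t => //; lia. Qed.

Lemma reach1 q p F q' mv y :
  ~~ @halting machine q ->
  (forall a, dec a = F p -> exists2 b', delta q a = (q', b', mv) & dec b' = y) ->
  (mv = false -> 0 < p) ->
  reach 1 (q, p, F) (q', if mv then p.+1 else p.-1, fupd F p y).
Proof.
move=> nh dl mvp c R; exists 1 => //.
exact: (step_rep R nh dl).
Qed.

Lemma reach1_same q p F q' mv :
  ~~ @halting machine q ->
  (forall a, dec a = F p -> delta q a = (q', a, mv)) ->
  (mv = false -> 0 < p) ->
  reach 1 (q, p, F) (q', if mv then p.+1 else p.-1, F).
Proof.
move=> nh dl mvp; apply: (@reach_ext _ _ _ _ (fupd F p (F p))).
  by move=> i; rewrite /fupd; case: eqP => // ->.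
by apply: reach1 => // a /[dup] /dl; exists a.
Qed.

Lemma stP pc ph : pc < size code -> ph < 4 ->
  [/\ val (st pc ph) != 0, (val (st pc ph) - 3) %/ 4 = pc,
      (val (st pc ph) - 3) %% 4 = ph & ~~ @halting machine (st pc ph)].
Proof.
move=> pcs ph4.
have E : val (st pc ph) = 3 + (4 * pc + ph) by rewrite /st /= inordK // /nst; lia.
rewrite /halting E addKn; split; try by lia.
Qed.

(** Stacks lie bottom first next to the marker, so that a push or a pop changes a single cell. *)
Definition tape (s : store) : nat -> cell :=
  fun i => if i is i'.+1 then Some [ffun j : 'I_m.+1 => onth (rev (s j)) i'] else None.

Lemma onth_size (T : Type) (l : seq T) i : size l <= i -> onth l i = None.
Proof. by elim: l i => [|x l IH] [|i] //= /IH. Qed.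

Lemma onth_lt (T : Type) (l : seq T) i : i < size l -> exists y, onth l i = Some y.
Proof.
elim: l i => [|x l IH] [|i] //=; first by exists x.
by move=> /IH.
Qed.

Lemma onth_rcons (T : Type) (l : seq T) x i :
  onth (rcons l x) i = if i == size l then Some x else onth l i.
Proof. by elim: l i => [|y l IH] [|i] //=; rewrite ?IH //; case: i. Qed.

Lemma onth_map_nth (f : nat -> bool) l i : i < size l ->
  onth [seq f a | a <- l] i = Some (f (nth 0 l i)).
Proof. by elim: l i => [|x l IH] [|i] //= /IH. Qed.

Lemma deltaE pc ph a : pc < size code -> ph < 4 ->
  delta (st pc ph) a =
  match ph with
  | 0 =>
    match nth (IJmp 0) code pc with
    | IPush j b l =>
      match dec a with
      | Some F => if F (inord j) is None
                  then (st l 1, enc_cell (Some (set_track F j (Some b))), false)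
                  else (st pc ph, a, true)
      | None => (st pc ph, a, true)
      end
    | IPop j _ _ _ =>
      match dec a with
      | Some F => if F (inord j) is None then (st pc 2, a, false) else (st pc ph, a, true)
      | None => (st pc ph, a, true)
      end
    | IJmp l => (st l 1, a, false)
    | IHalt b => (inord (if b then 1 else 2), a, true)
    end
  | 1 => if dec a is None then (st pc 0, a, true) else (st pc ph, a, false)
  | 2 =>
    match nth (IJmp 0) code pc with
    | IPop j l0 lf lt =>
      match dec a with
      | Some F => if F (inord j) is Some b
                  then (st (if b then lt else lf) 1, enc_cell (Some (set_track F j None)), false)
                  else (st pc ph, a, false)
      | None => (st l0 0, a, true)
      end
    | _ => (st pc ph, a, true)
    end
  | _ => (st 0 0, enc_cell None, true)
  end.
Proof.
move=> h1 h2; have [a1 a2 a3 a4] := stP h1 h2.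
by rewrite /delta (negbTE a1) a2 a3.
Qed.

Lemma reach_return pc s i : pc < size code ->
  reach i.+1 (st pc 1, i, tape s) (st pc 0, 1, tape s).
Proof.
move=> pcs; have nh := (stP pcs (isT : 1 < 4)).
elim: i => [|i IH].
  apply: (@reach1_same _ 0 _ _ true) => //; first by case: nh.
  by move=> a da; rewrite deltaE // da.
apply: (@reach_trans _ 1 i.+1 _ _ _ IH).
apply: (@reach1_same _ i.+1 _ _ false) => //; first by case: nh.
by move=> a da; rewrite deltaE // da.
Qed.

Definition op_reg (x : instr) : option nat :=
  match x with IPush j _ _ => Some j | IPop j _ _ _ => Some j | _ => None end.

Lemma reach_seek pc s j i : pc < size code -> j <= m ->
  op_reg (nth (IJmp 0) code pc) = Some j -> i <= size (s j) ->
  reach i (st pc 0, 1, tape s) (st pc 0, i.+1, tape s).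
Proof.
move=> pcs jm opj; have nh := (stP pcs (isT : 0 < 4)).
elim: i => [|i IH] les; first exact: reach0.
apply: (@reach_le (i + 1)); first by rewrite addn1.
apply: reach_trans (IH (ltnW les)) _.
apply: (@reach1_same _ i.+1 _ _ true) => //; first by case: nh.
move=> a da; rewrite deltaE // da /=.
have [b bE] : exists b, onth (rev (s j)) i = Some b by apply: onth_lt; rewrite size_rev.
by case: (nth _ _ _) opj => // [j' b' l|j' l0 lf lt] [->]; rewrite ffunE inordK // bE.
Qed.

(** Climb to the first empty cell of the track, write there, return to the marker: twice the height,
    plus the write and the final step off the marker. *)
Lemma reach_push pc j b l s : pc < size code -> l < size code -> j <= m ->
  nth (IJmp 0) code pc = IPush j b l ->
  reach (2 * size (s j) + 2) (st pc 0, 1, tape s) (st l 0, 1, tape (upd s j (b :: s j))).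
Proof.
move=> pcs ls jm opj.
have opr : op_reg (nth (IJmp 0) code pc) = Some j by rewrite opj.
apply: (@reach_le (size (s j) + (1 + (size (s j)).+1))); first by lia.
apply: reach_trans (reach_seek pcs jm opr (leqnn _)) _.
apply: (@reach_trans _ 1 (size (s j)).+1 _ _ _ (@reach_return l _ (size (s j)) ls)).
set h := size (s j).
pose F := [ffun j : 'I_m.+1 => onth (rev (s j)) h].
apply: (@reach_ext _ _ _ _ (fupd (tape s) h.+1 (Some (set_track F j (Some b))))).
  move=> [|i] //; rewrite /fupd /tape /= ?eqSS; case: eqP => [->|ne]; congr Some; apply/ffunP=> x.
    rewrite !ffunE /upd; case: ifP => [/eqP e|//].
    by rewrite rev_cons onth_rcons size_rev eqxx.
  rewrite !ffunE /upd; case: ifP => [/eqP e|//].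
  rewrite rev_cons onth_rcons size_rev e.
  by case: eqP.
apply: (@reach1 _ h.+1 _ _ false) => //; first by case: (stP pcs (isT : 0 < 4)).
move=> a da; rewrite deltaE // opj da /= ffunE inordK // onth_size ?size_rev //.
by exists (enc_cell (Some (set_track F j (Some b)))); rewrite ?enc_cellK.
Qed.

Lemma reach_pop0 pc j l0 lf lt s : pc < size code -> l0 < size code -> j <= m ->
  nth (IJmp 0) code pc = IPop j l0 lf lt -> s j = [::] ->
  reach 2 (st pc 0, 1, tape s) (st l0 0, 1, tape s).
Proof.
move=> pcs ls jm opj sj.
apply: (@reach_trans (st pc 2, 0, tape s) 1 1).
  apply: (@reach1_same _ 1 _ _ false) => //; first by case: (stP pcs (isT : 0 < 4)).
  by move=> a da; rewrite deltaE // opj da /= ffunE inordK // sj.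
apply: (@reach1_same _ 0 _ _ true) => //; first by case: (stP pcs (isT : 2 < 4)).
by move=> a da; rewrite deltaE // opj da.
Qed.

Lemma reach_pop pc j l0 lf lt s b r : pc < size code ->
  (if b then lt else lf) < size code -> j <= m ->
  nth (IJmp 0) code pc = IPop j l0 lf lt -> s j = b :: r ->
  reach (2 * size (s j) + 2) (st pc 0, 1, tape s)
    (st (if b then lt else lf) 0, 1, tape (upd s j r)).
Proof.
move=> pcs ls jm opj sj.
have opr : op_reg (nth (IJmp 0) code pc) = Some j by rewrite opj.
have hS : size (s j) = (size r).+1 by rewrite sj.
apply: (@reach_le (size (s j) + (1 + (1 + (size r).+1)))); first by lia.
apply: reach_trans (reach_seek pcs jm opr (leqnn _)) _.
set h := size (s j).
apply: (@reach_trans (st pc 2, h, tape s)).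
  apply: (@reach1_same _ h.+1 _ _ false) => //; first by case: (stP pcs (isT : 0 < 4)).
  by move=> a da; rewrite deltaE // opj da /= ffunE inordK // onth_size // size_rev.
apply: (@reach_trans _ 1 (size r).+1 _ _ _ (@reach_return _ _ (size r) ls)).
pose F := [ffun j : 'I_m.+1 => onth (rev (s j)) (size r)].
apply: (@reach_ext _ _ _ _ (fupd (tape s) h (Some (set_track F j None)))).
  move=> [|i]; rewrite /fupd /tape /h hS //= ?eqSS; case: eqP => [->|ne]; congr Some; apply/ffunP=> x.
    rewrite !ffunE /upd; case: ifP => [/eqP e|//].
    by rewrite onth_size // size_rev.
  rewrite !ffunE /upd; case: ifP => [/eqP e|//].
  rewrite e sj rev_cons onth_rcons size_rev.
  by case: eqP.
rewrite /h hS.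
apply: (@reach1 _ (size r).+1 _ _ false) => //; first by case: (stP pcs (isT : 2 < 4)).
move=> a da; rewrite deltaE // opj da /= ffunE inordK //.
rewrite sj rev_cons onth_rcons size_rev eqxx.
by exists (enc_cell (Some (set_track F j None))); rewrite ?enc_cellK.
Qed.

Lemma reach_jmp pc l s : pc < size code -> l < size code ->
  nth (IJmp 0) code pc = IJmp l ->
  reach 2 (st pc 0, 1, tape s) (st l 0, 1, tape s).
Proof.
move=> pcs ls opj.
apply: (@reach_trans (st l 1, 0, tape s) 1 1).
  apply: (@reach1_same _ 1 _ _ false) => //; first by case: (stP pcs (isT : 0 < 4)).
  by move=> a da; rewrite deltaE // opj.
exact: reach_return.
Qed.

Lemma reach_halt pc b F p : pc < size code ->
  nth (IJmp 0) code pc = IHalt b ->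
  reach 1 (st pc 0, p, F) (inord (if b then 1 else 2), p.+1, F).
Proof.
move=> pcs opj.
apply: (@reach1_same _ p _ _ true) => //; first by case: (stP pcs (isT : 0 < 4)).
by move=> a da; rewrite deltaE // opj.
Qed.

Lemma run_halting t (c : cfg) : halting (c_state c) -> run t c = c.
Proof.
move=> hc; elim: t => //= t ->.
by rewrite /step hc.
Qed.

Definition input_store (w : seq nat) : store :=
  fun j => if j == 0 then rev [seq 1 < a | a <- w]
           else if j == 1 then rev [seq odd a | a <- w] else [::].

(** One step to the left of the input and one to write the marker there. The input then fills cells
    1, 2, ..., with its last symbol on top of stacks 0 and 1. *)
Lemma init_rep (w : seq nat) : 0 < size code -> {in w, forall a, 0 < a < 4} ->
  exists2 t, t <= 2 & rep (run t (init machine w)) (st 0 0) 1 (tape (input_store w)).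
Proof.
move=> cs w4.
pose G := fun i : nat => dec (nth (blank machine) [seq inord x | x <- w] i).
have r0 : rep (init machine w) (inord 0) 0 G.
  by rewrite /init /G {G}; case: w w4 => [|x w] /= w4; split=> //= -[|i] //=; case: i.
exists 2 => //=.
have -> : step (init machine w) = @Config machine (st 0 3) [::] (blank machine)
    (c_head (init machine w) :: c_right (init machine w)).
  case: r0; case: (init machine w) => q l h r /= -> /size0nil -> _.
  by rewrite /step /halting /= /delta /= inordK.
have : rep (@Config machine (st 0 3) [::] (blank machine) (c_head (init machine w) :: c_right (init machine w)))
  (st 0 3) 0 (fun i => if i is i'.+1 then G i' else dec (blank machine)).
  split => //= -[|i] //=; case: r0 => _.
  case: (init machine w) => q l h r /= /size0nil -> /(_ i) <- //.
move=> R; have := @step_rep _ _ _ _ (st 0 0) 1 true None R.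
case=> //.
- by case: (stP cs (isT : 3 < 4)).
- by move=> a _; rewrite deltaE //; exists (enc_cell None); rewrite ?enc_cellK.
move=> a b c; split => // i; rewrite c /fupd.
case: i => //= i; rewrite /G.
have [lt|ge] := ltnP i (size w); last first.
  rewrite nth_default ?size_map // /dec inordK //=; congr Some; apply/ffunP=> j.
  rewrite !ffunE /input_store /raw_track /=.
  by case: ifP => _; last case: ifP => _; rewrite ?revK onth_size ?size_map.
have /w4 /andP[w0 w3] := mem_nth 0 lt.
have w5 : nth 0 w i < nsym.+4 by exact: leq_trans w3 _.
rewrite (nth_map 0) // /dec inordK // w3.
congr Some; apply/ffunP=> j; rewrite !ffunE /raw_track /input_store.
rewrite eqn0Ngt w0 /=.
by move=> /=; case: ifP => _; last case: ifP => _; rewrite ?revK ?onth_map_nth //; case: (i).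
Qed.

End StackMachine.

(** * Structured programs on stacks *)

Inductive cmd :=
  | Skip
  | Push of nat & bool
  | Seq of cmd & cmd
  | Case of nat & cmd & cmd & cmd
  | Loop of nat & cmd & cmd.

(* The cost-annotated big-step semantics: every stack operated on has a height
   satisfying [ok]; [Case] and [Loop] pop the symbol that they inspect. *)
Inductive ev (ok : pred nat) : cmd -> store -> nat -> store -> Prop :=
  | ev_skip s : ev ok Skip s 1 s
  | ev_push j b s : ok (size (s j)) -> ev ok (Push j b) s 1 (upd s j (b :: s j))
  | ev_seq c1 c2 s1 s2 s3 t1 t2 : ev ok c1 s1 t1 s2 -> ev ok c2 s2 t2 s3 ->
      ev ok (Seq c1 c2) s1 (t1 + t2) s3
  | ev_case0 j c0 cf ct s t s' : s j = [::] -> ok 0 -> ev ok c0 s t s' ->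
      ev ok (Case j c0 cf ct) s t.+1 s'
  | ev_case j c0 cf ct s b l t s' : s j = b :: l -> ok (size (s j)) ->
      ev ok (if b then ct else cf) (upd s j l) t s' ->
      ev ok (Case j c0 cf ct) s t.+1 s'
  | ev_loop0 j cf ct s : s j = [::] -> ok 0 -> ev ok (Loop j cf ct) s 1 s
  | ev_loop j cf ct s b l t1 s1 t2 s' : s j = b :: l -> ok (size (s j)) ->
      ev ok (if b then ct else cf) (upd s j l) t1 s1 ->
      ev ok (Loop j cf ct) s1 t2 s' ->
      ev ok (Loop j cf ct) s (t1 + t2).+1 s'.

Fixpoint uses (c : cmd) (m : nat) : bool :=
  match c with
  | Skip => true
  | Push j _ => j < m
  | Seq a b => uses a m && uses b m
  | Case j a b d => [&& j < m, uses a m, uses b m & uses d m]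
  | Loop j a b => [&& j < m, uses a m & uses b m]
  end.

Lemma uses_mono c m m' : m <= m' -> uses c m -> uses c m'.
Proof.
move=> le; elim: c => //= [j _|a IHa b IHb|j a IHa b IHb d IHd|j a IHa b IHb].
- by move=> h; lia.
- by move=> /andP[/IHa -> /IHb ->].
- by move=> /and4P[h /IHa -> /IHb -> /IHd ->]; rewrite !andbT; lia.
- by move=> /and3P[h /IHa -> /IHb ->]; rewrite !andbT; lia.
Qed.

Lemma ev_size ok c s t s' j : ev ok c s t s' -> size (s' j) <= size (s j) + t.
Proof.
elim=> //=.
- by move=> s0; lia.
- move=> i b s0 _; rewrite /upd; case: eqP => [->|_] /=; lia.
- by move=> *; lia.
- by move=> *; lia.
- move=> i c0 cf ct s0 b l t0 s1 e _ _; rewrite /upd; case: eqP => [->|_] /=; rewrite ?e /=; lia.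
- by move=> *; lia.
- move=> i cf ct s0 b l t1 s1 t2 s2 e _ _ + _; rewrite /upd.
  case: eqP => [->|_] /=; rewrite ?e /=; lia.
Qed.

Lemma ev_ok ok ok' c s t s' : {subset ok <= ok'} -> ev ok c s t s' -> ev ok' c s t s'.
Proof.
move=> sub; elim=> *; try (by econstructor; eauto); try by econstructor; eauto; apply: sub.
Qed.

(* Heights grow by at most one per operation, so a height bound can be supplied
   after the fact. *)
Lemma ev_bound ok c s t s' m B : ev ok c s t s' -> uses c m ->
  (forall j, j < m -> size (s j) + t <= B) -> ev (fun h => h <= B) c s t s'.
Proof.
move=> H; elim: H m B => /=.
- by move=> *; constructor.
- move=> j b s0 _ m B jm bd; constructor; have := bd _ jm; lia.
- move=> c1 c2 s1 s2 s3 t1 t2 e1 IH1 e2 IH2 m B /andP[u1 u2] bd.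
  apply: (@ev_seq _ _ _ _ s2).
    by apply: IH1 u1 _ => j /bd; lia.
  by apply: IH2 u2 _ => j /bd; have := ev_size j e1; lia.
- move=> j c0 cf ct s0 t0 s1 e _ _ IH m B /and4P[jm u0 uf ut] bd.
  by apply: ev_case0 => //; apply: IH u0 _ => i /bd; lia.
- move=> j c0 cf ct s0 b l t0 s1 e _ _ IH m B /and4P[jm u0 uf ut] bd.
  apply: (ev_case _ e); first by have := bd _ jm; lia.
  apply: (IH m); first by case: (b).
  by move=> i /bd; rewrite /upd; case: eqP => [->|_]; rewrite ?e /=; lia.
- by move=> *; apply: ev_loop0.
- move=> j cf ct s0 b l t1 s1 t2 s2 e _ e1 IH1 e2 IH2 m B u bd.
  have /and3P[jm uf ut] := u.
  apply: (ev_loop e); first by have := bd _ jm; lia.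
    apply: (IH1 m); first by case: (b).
    by move=> i /bd; rewrite /upd; case: eqP => [->|_]; rewrite ?e /=; lia.
  apply: (IH2 m) => // i /bd; have := ev_size i e1; rewrite /upd.
  by case: eqP => [->|_]; rewrite ?e /=; lia.
Qed.

Fixpoint csize (c : cmd) : nat :=
  match c with
  | Skip => 1
  | Push _ _ => 1
  | Seq a b => csize a + csize b
  | Case _ a b d => (csize a + (csize b + csize d)).+1
  | Loop _ a b => (csize a + csize b).+1
  end.

(* [comp c pc nx] is the code of [c] placed at address [pc], jumping to [nx] when done. *)
Fixpoint comp (c : cmd) (pc nx : nat) : seq instr :=
  match c with
  | Skip => [:: IJmp nx]
  | Push j b => [:: IPush j b nx]
  | Seq a b => comp a pc (pc + csize a) ++ comp b (pc + csize a) nx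
  | Case j c0 cf ct =>
      let p0 := pc.+1 in let pf := p0 + csize c0 in let pt := pf + csize cf in
      IPop j p0 pf pt :: comp c0 p0 nx ++ comp cf pf nx ++ comp ct pt nx
  | Loop j cf ct =>
      let pf := pc.+1 in let pt := pf + csize cf in
      IPop j nx pf pt :: comp cf pf pc ++ comp ct pt pc
  end.

Lemma size_comp c pc nx : size (comp c pc nx) = csize c.
Proof.
elim: c pc nx => //= [a IHa b IHb|j a IHa b IHb d IHd|j a IHa b IHb] pc nx;
  by rewrite !size_cat ?IHa ?IHb ?IHd.
Qed.

Lemma csize_gt0 c : 0 < csize c.
Proof. by elim: c => //= *; lia. Qed.

Section Compile.
Variables (m : nat) (code : seq instr).
Notation reach := (@reach m code).
Notation st := (@st code).
Notation tape := (@tape m).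

Definition code_at (pc : nat) (blk : seq instr) : Prop :=
  pc + size blk <= size code /\
  forall i, i < size blk -> nth (IJmp 0) code (pc + i) = nth (IJmp 0) blk i.

Lemma code_at_cat pc b1 b2 : code_at pc (b1 ++ b2) ->
  code_at pc b1 /\ code_at (pc + size b1) b2.
Proof.
rewrite /code_at size_cat => -[le H]; split; split; try by lia.
  by move=> i lt; rewrite H ?nth_cat ?lt //; lia.
move=> i lt; rewrite -addnA H ?nth_cat; last by lia.
by rewrite ltnNge leq_addr /= addKn.
Qed.

Lemma code_at_cons pc x b : code_at pc (x :: b) ->
  [/\ pc < size code, nth (IJmp 0) code pc = x & code_at pc.+1 b].
Proof.
move=> [/= le H]; split; first by lia.
  by have := H 0; rewrite addn0; apply.
split; first by lia.
by move=> i lt; rewrite addSnnS H.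
Qed.

Lemma code_at_lt pc c nx : code_at pc (comp c pc nx) -> pc < size code.
Proof. by case; rewrite size_comp; have := csize_gt0 c; lia. Qed.

(** A source step touches one stack of height at most [B], and the machine pays one climb and one
    return for it. *)
Lemma comp_reach B c s t s' pc nx : ev (fun h => h <= B) c s t s' -> uses c m.+1 ->
  code_at pc (comp c pc nx) -> nx < size code ->
  reach (t * (2 * B + 2)) (st pc 0, 1, tape s) (st nx 0, 1, tape s').
Proof.
move=> H; elim: H pc nx => /=.
- move=> s0 pc nx _ /code_at_cons[pcs op _] nxs.
  by apply: (@reach_le _ _ 2); [lia | apply: reach_jmp].
- move=> j b s0 le pc nx jm /code_at_cons[pcs op _] nxs.
  by apply: (@reach_le _ _ (2 * size (s0 j) + 2)); [lia | apply: reach_push].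
- move=> c1 c2 s1 s2 s3 t1 t2 e1 IH1 e2 IH2 pc nx /andP[u1 u2] /code_at_cat[].
  rewrite size_comp => k1 k2 nxs; rewrite mulnDl.
  by apply: reach_trans (IH2 _ _ u2 k2 nxs); apply: IH1 => //; apply: code_at_lt k2.
- move=> j c0 cf ct s0 t0 s1 e _ _ IH pc nx /and4P[jm u0 uf ut].
  move=> /code_at_cons[pcs op /code_at_cat[]] k0.
  rewrite size_comp => _ nxs; rewrite mulSn.
  apply: reach_trans (IH _ _ u0 k0 nxs).
  apply: (@reach_le _ _ 2); first by lia.
  by apply: reach_pop0 op e => //; apply: code_at_lt k0.
- move=> j c0 cf ct s0 b l t0 s1 e le _ IH pc nx /and4P[jm u0 uf ut].
  move=> /code_at_cons[pcs op /code_at_cat[]] _.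
  rewrite size_comp => /code_at_cat[]; rewrite size_comp => kf kt nxs; rewrite mulSn.
  pose pb := if b then pc.+1 + csize c0 + csize cf else pc.+1 + csize c0.
  have kb : code_at pb (comp (if b then ct else cf) pb nx) by rewrite /pb; case: (b).
  apply: reach_trans (IH _ _ _ kb nxs); last by case: (b).
  apply: (@reach_le _ _ (2 * size (s0 j) + 2)); first by lia.
  by apply: reach_pop op e => //; apply: code_at_lt kb.
- move=> j cf ct s0 e _ pc nx /and3P[jm uf ut] /code_at_cons[pcs op _] nxs.
  apply: (@reach_le _ _ 2); first by lia.
  exact: reach_pop0 op e.
- move=> j cf ct s0 b l t1 s1 t2 s2 e le e1 IH1 e2 IH2 pc nx u k nxs.
  have /and3P[jm uf ut] := u.
  have [pcs op /code_at_cat[kf]] := code_at_cons k.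
  rewrite size_comp => kt; rewrite mulSn mulnDl.
  pose pb := if b then pc.+1 + csize cf else pc.+1.
  have kb : code_at pb (comp (if b then ct else cf) pb pc) by rewrite /pb; case: (b).
  apply: (@reach_trans _ _ (st pb 0, 1, tape (upd s0 j l))).
    apply: (@reach_le _ _ (2 * size (s0 j) + 2)); first by lia.
    by apply: reach_pop op e => //; apply: code_at_lt kb.
  by apply: reach_trans (IH2 _ _ u k nxs); apply: IH1 => //; case: (b).
Qed.

End Compile.

(* A program that starts on the input and leaves its answer on top of register [r]
   decides that answer on a Turing machine. *)
Lemma program_machine c m r : uses c m.+1 -> r <= m ->
  exists M : TM, forall (w : seq nat) B t s' b l,
  {in w, forall a, 0 < a < 4} ->
  ev (fun h => h <= B) c (input_store w) t s' -> s' r = b :: l -> size (s' r) <= B ->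
  forall T, t.+1 * (2 * B + 2) + 3 <= T -> decides_within M w T b.
Proof.
move=> u rm.
pose e := csize c.
pose code := comp c 0 e ++ [:: IPop r e.+1 e.+2 e.+1; IHalt true; IHalt false].
have ca : code_at code 0 code by split; rewrite ?add0n.
exists (machine m code) => w B t s' b l wP H sr le T leT.
have [k0] := code_at_cat ca; rewrite size_comp add0n -/e => /code_at_cons[p1 o1].
move=> /code_at_cons[p2 o2 /code_at_cons[p3 o3 _]].
have [t0 t02 r0] := init_rep m (leq_ltn_trans (leq0n _) p3) wP.
have H1 := comp_reach H u k0 p1.
have bl : (if b then e.+1 else e.+2) < size code by case: (b).
have bh : nth (IJmp 0) code (if b then e.+1 else e.+2) = IHalt b by case: (b).
have R := reach_trans H1 (reach_trans (reach_pop p1 bl rm o1 sr)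
  (@reach_halt m code _ b (tape m (upd s' r l)) 1 bl bh)).
have [t1 t1le [/= q1 _ _]] := R _ r0.
have -> : T = T - (t1 + t0) + (t1 + t0) by lia.
rewrite /decides_within /run iterD iterD -/(run t0 _) -/(run t1 _).
have E : val (c_state (run t1 (run t0 (init (machine m code) w)))) = if b then 1 else 2.
  by rewrite q1 /= inordK; case: (b).
by rewrite -/(run (T - _) _) run_halting // /halting E; case: (b).
Qed.

(** * Binary trees on stacks *)

Inductive tree := Lf | Nd of tree & tree.

(** Preorder, one bit per node. This is a prefix code, so a tree on top of a stack needs no end
    mark. *)
Fixpoint ser (t : tree) : seq bool :=
  match t with Lf => [:: false] | Nd a b => true :: ser a ++ ser b end.

Definition tsz (t : tree) : nat := size (ser t).

Lemma tsz_Nd a b : tsz (Nd a b) = (tsz a + tsz b).+1.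
Proof. by rewrite /tsz /= size_cat. Qed.

Lemma tsz_gt0 a : 0 < tsz a.
Proof. by case: a. Qed.

Lemma updE s j v i : upd s j v i = if i == j then v else s i.
Proof. by []. Qed.

Lemma upd_id s j : upd s j (s j) = s.
Proof. by apply: functional_extensionality => i; rewrite updE; case: eqP => [->|]. Qed.

Ltac store_eq :=
  apply: functional_extensionality => ?; rewrite /upd;
  repeat (case: eqP => ?); subst; rewrite ?eqxx //=; try congruence; try lia.

Notation evT := (ev predT).

Lemma ev_to ok c s t s1 s2 : ev ok c s t s1 -> s1 = s2 -> ev ok c s t s2.
Proof. by move=> H <-. Qed.

Lemma evT_case j c0 cf ct s b l t s' : s j = b :: l ->
  evT (if b then ct else cf) (upd s j l) t s' -> evT (Case j c0 cf ct) s t.+1 s'.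
Proof. by move=> e; apply: ev_case e _. Qed.

Lemma evT_loop j cf ct s b l t1 s1 t2 s' : s j = b :: l ->
  evT (if b then ct else cf) (upd s j l) t1 s1 ->
  evT (Loop j cf ct) s1 t2 s' -> evT (Loop j cf ct) s (t1 + t2).+1 s'.
Proof. by move=> e; apply: ev_loop e _. Qed.

Definition move_rev (i j : nat) : cmd := Loop i (Push j false) (Push j true).

Lemma ev_move_rev (i j : nat) s : i != j ->
  evT (move_rev i j) s (2 * size (s i)).+1 (upd (upd s i [::]) j (catrev (s i) (s j))).
Proof.
move=> ij; move E : (s i) => l; elim: l s E => [|b l IH] s E.
  by apply: ev_to (ev_loop0 _ _ E isT) _; store_eq.
have -> : (2 * size (b :: l)).+1 = (1 + (2 * size l).+1).+1 by rewrite /=; lia.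
apply: (evT_loop (s1 := upd (upd s i l) j (b :: s j)) E).
  have -> : s j = upd s i l j by rewrite updE eq_sym (negbTE ij).
  by case: (b); apply: ev_push.
have H := IH (upd (upd s i l) j (b :: s j)).
rewrite !updE (negbTE ij) !eqxx in H.
apply: ev_to (H erefl) _; store_eq.
Qed.

Definition move (i j k : nat) : cmd := Seq (move_rev i k) (move_rev k j).

Lemma ev_move (i j k : nat) s : i != j -> i != k -> j != k -> s k = [::] ->
  evT (move i j k) s (4 * size (s i) + 2) (upd (upd s i [::]) j (s i ++ s j)).
Proof.
move=> ij ik jk sk.
have -> : 4 * size (s i) + 2 = (2 * size (s i)).+1 + (2 * size (s i)).+1 by lia.
apply: ev_seq (ev_move_rev _ ik) _.
have kj : k != j by rewrite eq_sym.
have H := ev_move_rev (upd (upd s i [::]) k (catrev (s i) (s k))) kj.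
rewrite !updE eqxx sk !catrevE cats0 size_rev revK (negbTE jk) [j == i]eq_sym (negbTE ij) in H.
rewrite sk catrevE cats0; apply: ev_to H _; store_eq.
Qed.

Definition clear (i : nat) : cmd := Loop i Skip Skip.

Lemma ev_clear (i : nat) s : evT (clear i) s (2 * size (s i)).+1 (upd s i [::]).
Proof.
move E : (s i) => l; elim: l s E => [|b l IH] s E.
  by apply: ev_to (ev_loop0 _ _ E isT) _; store_eq.
have -> : (2 * size (b :: l)).+1 = (1 + (2 * size l).+1).+1 by rewrite /=; lia.
apply: (evT_loop (s1 := upd s i l) E).
  by case: (b); apply: ev_skip.
have H := IH (upd s i l); rewrite updE eqxx in H.
apply: ev_to (H erefl) _; store_eq.
Qed.

Definition copy (i j k : nat) : cmd :=
  Seq (move_rev i k)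
      (Loop k (Seq (Push i false) (Push j false)) (Seq (Push i true) (Push j true))).

Lemma ev_copy (i j k : nat) s : i != j -> i != k -> j != k -> s k = [::] ->
  evT (copy i j k) s (5 * size (s i) + 2) (upd s j (s i ++ s j)).
Proof.
move=> ij ik jk sk.
have -> : 5 * size (s i) + 2 = (2 * size (s i)).+1 + (3 * size (rev (s i))).+1.
  by rewrite size_rev; lia.
apply: ev_seq (ev_move_rev _ ik) _.
rewrite sk catrevE cats0.
have main r : forall s0, s0 k = r -> evT
  (Loop k (Seq (Push i false) (Push j false)) (Seq (Push i true) (Push j true))) s0
  (3 * size r).+1
  (upd (upd (upd s0 k [::]) i (rev r ++ s0 i)) j (rev r ++ s0 j)).
  elim: r => [|b r IH] s0 E.
    by apply: ev_to (ev_loop0 _ _ E isT) _; store_eq.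
  have -> : (3 * size (b :: r)).+1 = ((1 + 1) + (3 * size r).+1).+1 by rewrite /=; lia.
  apply: (evT_loop (s1 := upd (upd (upd s0 k r) i (b :: s0 i)) j (b :: s0 j)) E).
    have P (x : bool) : evT (Seq (Push i x) (Push j x)) (upd s0 k r) (1 + 1)
       (upd (upd (upd s0 k r) i (x :: s0 i)) j (x :: s0 j)).
      apply: ev_seq (@ev_push predT _ _ _ isT) _.
      have -> : x :: s0 j = x :: (upd (upd s0 k r) i (x :: upd s0 k r i)) j.
        by rewrite !updE eq_sym (negbTE ij) (negbTE jk).
      have -> : s0 i = upd s0 k r i by rewrite updE (negbTE ik).
      exact: ev_push.
    by case: (b).
  have H := IH (upd (upd (upd s0 k r) i (b :: s0 i)) j (b :: s0 j)).
  rewrite !updE !eqxx (negbTE ij) ![k == _]eq_sym (negbTE jk) (negbTE ik) in H.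
  apply: ev_to (H erefl) _.
  rewrite rev_cons !cat_rcons; store_eq.
have H := main (rev (s i)) (upd (upd s i [::]) k (rev (s i))).
rewrite !updE eqxx revK (negbTE ik) eqxx (negbTE jk) in H.
rewrite [j == i]eq_sym (negbTE ij) cats0 in H.
apply: ev_to (H erefl) _; store_eq.
Qed.

(* Stack [c] counts, in unary, the subtrees that remain to be read. *)
Definition split (i j k c : nat) : cmd :=
  Seq (Push c true)
  (Seq (Loop c Skip
          (Case i Skip (Push k false)
                (Seq (Push k true) (Seq (Push c true) (Push c true)))))
       (move_rev k j)).

Lemma ev_split (i j k c : nat) s a r :
  uniq [:: i; j; k; c] -> s i = ser a ++ r -> s k = [::] -> s c = [::] ->
  exists2 t, t <= 7 * tsz a + 3 &
  evT (split i j k c) s t (upd (upd s i r) j (ser a ++ s j)).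
Proof.
rewrite /= !inE !negb_or => /and4P[/and3P[ij ik ic] /andP[jk jc] kc _] si sk sc.
have [ji ki ci] : [/\ j != i, k != i & c != i] by rewrite ![_ == i]eq_sym.
have [kj cj ck] : [/\ k != j, c != j & c != k] by rewrite ![_ == j]eq_sym [c == k]eq_sym.
rewrite /split; set L := Loop c _ _.
(* In continuation form: reading one tree takes one bit off the counter and leaves the loop running.
   This lets the two subtrees be read by successive parts of the same loop. *)
have main a0 : forall s0 r0 d t s', s0 i = ser a0 ++ r0 -> s0 c = true :: d ->
  evT L (upd (upd (upd s0 i r0) c d) k (catrev (ser a0) (s0 k))) t s' ->
  exists2 t0, t0 <= 5 * tsz a0 & evT L s0 (t0 + t) s'.
  elim: a0 => [|x IHx y IHy] s0 r0 d t s' si0 sc0 H.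
    exists 3 => //; rewrite (_ : 3 + t = (2 + t).+1) //.
    apply: (evT_loop sc0) H.
    apply: (@evT_case _ _ _ _ _ false r0); first by rewrite updE (negbTE ic).
    set s1 := upd _ _ _.
    by apply: ev_to (@ev_push predT k false s1 isT) _; rewrite /s1; store_eq.
  pose s1 := upd (upd (upd s0 i (ser x ++ ser y ++ r0)) k (true :: s0 k)) c [:: true, true & d].
  pose s2 := upd (upd (upd s1 i (ser y ++ r0)) c (true :: d)) k (catrev (ser x) (s1 k)).
  have [|||t2 t2le H2] := IHy s2 r0 d t s'.
  - by rewrite /s2 !updE (negbTE ik) (negbTE ic) eqxx.
  - by rewrite /s2 !updE (negbTE ck) eqxx.
  - rewrite (_ : upd _ k _ =
      upd (upd (upd s0 i r0) c d) k (catrev (ser (Nd x y)) (s0 k))) //.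
    rewrite /s2 /s1 /= catrev_catl; store_eq.
  have [||t1 t1le H1] := IHx s1 (ser y ++ r0) (true :: d) _ s' _ _ H2.
  - by rewrite /s1 !updE (negbTE ik) (negbTE ic) eqxx.
  - by rewrite /s1 !updE eqxx.
  exists (5 + t1 + t2); first by rewrite tsz_Nd; lia.
  have -> : 5 + t1 + t2 + t = (4 + (t1 + (t2 + t))).+1 by lia.
  apply: (evT_loop sc0) H1.
  apply: (@evT_case _ _ _ _ _ true (ser x ++ ser y ++ r0)).
    by rewrite updE (negbTE ic) si0 /= catA.
  set s3 := upd _ i _.
  rewrite (_ : 3 = 1 + (1 + 1)) //; apply: ev_seq (@ev_push predT _ _ _ isT) _.
  apply: ev_seq (@ev_push predT _ _ _ isT) _.
  set s4 := upd _ c _.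
  by apply: ev_to (@ev_push predT c true s4 isT) _; rewrite /s4 /s1 /s3; store_eq.
pose s1 := upd s c [:: true].
pose s2 := upd (upd s i r) k (rev (ser a)).
have E2 : upd (upd (upd s1 i r) c [::]) k (catrev (ser a) (s1 k)) = s2.
  rewrite /s2 /s1 catrevE; store_eq; by rewrite sk cats0.
have [|||t tle H] := main a s1 r [::] 1 s2.
- by rewrite /s1 updE (negbTE ic).
- by rewrite /s1 updE eqxx.
- by rewrite E2; apply: ev_loop0 => //; rewrite /s2 !updE (negbTE ck) (negbTE ci).
exists (1 + ((t + 1) + (2 * size (s2 k)).+1)).
  by rewrite /s2 updE eqxx size_rev -/(tsz a); lia.
apply: (ev_seq (s2 := s1)); first by rewrite /s1 -sc; apply: ev_push.
apply: ev_seq H _.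
apply: ev_to (ev_move_rev s2 kj) _.
rewrite /s2; store_eq; by rewrite catrevE revK.
Qed.

(** * Polynomial-time functions *)

(** With a base of at least 2, a suitable exponent absorbs any constant, and sums, products and
    compositions of such bounds are again bounded by a single power. *)
Definition pb (a n : nat) : nat := (n + 2) ^ a.

Definition pbd (f : nat -> nat) : Prop := exists a, forall n, f n <= pb a n.

Lemma pb_gt0 a n : 0 < pb a n.
Proof. by rewrite /pb expn_gt0 addn2. Qed.

Lemma pb_mono a n n' : n <= n' -> pb a n <= pb a n'.
Proof. by move=> le; rewrite /pb; case: a => // a; rewrite leq_exp2r //; lia. Qed.

Lemma pbd_pb a : pbd (pb a).
Proof. by exists a. Qed.

Lemma pbd_const c : pbd (fun=> c).
Proof.
exists c => n; apply: leq_trans (ltnW (ltn_expl c (isT : 1 < 2))) _.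
by case: c => // c; rewrite /pb leq_exp2r //; lia.
Qed.

Lemma pbd_id : pbd id.
Proof. by exists 1 => n; rewrite /pb expn1; lia. Qed.

Lemma pbd_mul f g : pbd f -> pbd g -> pbd (fun n => f n * g n).
Proof.
move=> [a Ha] [b Hb]; exists (a + b) => n.
by rewrite /pb expnD leq_mul // ?Ha ?Hb.
Qed.

Lemma pbd_add f g : pbd f -> pbd g -> pbd (fun n => f n + g n).
Proof.
move=> [a Ha] [b Hb]; exists (1 + (a + b)) => n.
apply: leq_trans (leq_add (Ha n) (Hb n)) _.
rewrite /pb [in leqRHS]expnD [in leqRHS]expnD expn1 -/(pb a n) -/(pb b n).
have := pb_gt0 a n; have := pb_gt0 b n; move: (pb a n) (pb b n) => x y y0 x0.
apply: (@leq_trans (2 * (x * y))); first by nia.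
by rewrite leq_mul2r; lia.
Qed.

Lemma pbd_comp f g : pbd f -> pbd g -> pbd (fun n => f (g n)).
Proof.
move=> [a Ha] [b Hb]; exists ((b + 2) * a) => n.
apply: leq_trans (Ha _) _; apply: leq_trans (pb_mono _ (Hb n)) _.
rewrite {1}/pb {2}/pb expnM; case: a {Ha} => // a; rewrite leq_exp2r //.
rewrite expnD; have := pb_gt0 b n; rewrite /pb.
move: ((n + 2) ^ b) => x x0; have -> : (n + 2) ^ 2 = (n + 2) * (n + 2) by rewrite expnS expn1.
by nia.
Qed.

Ltac pbd_tac := repeat first
  [ exact: pbd_pb | exact: pbd_const | exact: pbd_id
  | apply: pbd_add | apply: pbd_mul
  | match goal with |- pbd (fun n => S (@?f n)) =>
      refine (pbd_add (f := fun=> 1) (g := f) _ _) end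
  | match goal with |- pbd (fun n => pb ?a (@?f n)) =>
      refine (pbd_comp (f := pb a) (g := f) _ _) end ].

Class Enc (T : Type) := enc : T -> tree.

Notation sz x := (tsz (enc x)).

(** The final store differs from the initial one in register 0 only: scratch registers come back
    empty and registers from [m] on are untouched. Programs can thus be chained, and a caller can
    park data above [m]. *)
Definition computes A B {eA : Enc A} {eB : Enc B} (c : cmd) (m a : nat) (f : A -> B) :=
  forall (x : A) s, s 0 = ser (enc x) -> (forall j, 0 < j < m -> s j = [::]) ->
  exists2 t, t <= pb a (sz x) & evT c s t (upd s 0 (ser (enc (f x)))).

Definition FP A B {eA : Enc A} {eB : Enc B} (f : A -> B) : Prop :=
  exists c m a, [/\ 0 < m, uses c m & computes c m a f].

Section Closure.
Context {A B C D : Type} {eA : Enc A} {eB : Enc B} {eC : Enc C} {eD : Enc D}.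

Lemma FP_intro (c : cmd) m (T : nat -> nat) (f : A -> B) :
  0 < m -> uses c m -> pbd T ->
  (forall (x : A) s, s 0 = ser (enc x) -> (forall j, 0 < j < m -> s j = [::]) ->
   exists2 t, t <= T (sz x) & evT c s t (upd s 0 (ser (enc (f x))))) ->
  FP f.
Proof.
move=> m0 u [a Ha] H; exists c, m, a; split => // x s s0 sj.
by have [t tle E] := H x s s0 sj; exists t => //; apply: leq_trans tle (Ha _).
Qed.

(** A stack grows by at most one symbol per step, so the time bound limits the output as well. *)
Lemma FP_size (f : A -> B) : FP f -> exists b, forall x, sz (f x) <= pb b (sz x).
Proof.
move=> [c [m [a [m0 u H]]]].
have [b Hb] : pbd (fun n => n + pb a n) by pbd_tac.
exists b => x; apply: leq_trans (Hb _).
pose s : store := fun j => if j == 0 then ser (@enc _ eA x) else [::].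
have [//||t tle E] := H x s; first by case.
by have := ev_size 0 E; rewrite updE /= -/(sz x) -/(sz (f x)); lia.
Qed.

Lemma FP_eq (f g : A -> B) : f =1 g -> FP f -> FP g.
Proof.
move=> fg [c [m [a [m0 u H]]]]; exists c, m, a; split => // x s s0 sj.
by rewrite -fg; apply: H.
Qed.

Lemma FP_same (f : A -> B) : (forall x, enc (f x) = enc x) -> FP f.
Proof.
move=> e; apply: (@FP_intro Skip 1 (fun=> 1)) => //; first by pbd_tac.
by move=> x s s0 _; exists 1 => //; rewrite e -s0 upd_id; apply: ev_skip.
Qed.

End Closure.

Lemma FP_comp A B C {eA : Enc A} {eB : Enc B} {eC : Enc C} (g : B -> C) (f : A -> B) :
  FP f -> FP g -> FP (fun x => g (f x)).
Proof.
move=> Ff; have [b Hb] := FP_size Ff; case: Ff => [c [m [a [m0 u H]]]].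
move=> [c' [m' [a' [m0' u' H']]]].
apply: (@FP_intro _ _ _ _ (Seq c c') (maxn m m') (fun n => pb a n + pb a' (pb b n))).
- by lia.
- by rewrite /= !(uses_mono _ u, uses_mono _ u') //; lia.
- by pbd_tac.
move=> x s s0 sj.
have [|t tle E] := H x s s0; first by move=> j jm; apply: sj; lia.
have [||t' tle' E'] := H' (f x) (upd s 0 (ser (enc (f x)))).
- by rewrite updE.
- by move=> j jm; rewrite updE; case: eqP => [e|_]; [lia | apply: sj; lia].
exists (t + t'); first by have := pb_mono a' (Hb x); lia.
by apply: ev_seq E _; apply: ev_to E' _; store_eq.
Qed.

Lemma FP_id A {eA : Enc A} : FP (fun x : A => x).
Proof. exact: FP_same. Qed.

Fixpoint pushes (i : nat) (l : seq bool) : cmd :=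
  if l is b :: l' then Seq (pushes i l') (Push i b) else Skip.

Lemma ev_pushes i l s : evT (pushes i l) s (size l).+1 (upd s i (l ++ s i)).
Proof.
elim: l => [|b l IH] /=; first by rewrite upd_id; apply: ev_skip.
rewrite -addn1; apply: ev_seq IH _.
by apply: ev_to (@ev_push predT i b _ isT) _; store_eq.
Qed.

Lemma FP_const A B {eA : Enc A} {eB : Enc B} (v : B) : FP (fun _ : A => v).
Proof.
apply: (@FP_intro _ _ _ _ (Seq (clear 0) (pushes 0 (ser (enc v)))) 1
  (fun n => (2 * n).+1 + (sz v).+1)) => //.
- by rewrite /=; elim: (ser _) => //= b l ->.
- by pbd_tac.
move=> x s s0 _; exists ((2 * size (s 0)).+1 + (sz v).+1); first by rewrite s0.
apply: ev_seq (ev_clear _ _) _; apply: ev_to (ev_pushes _ _ _) _.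
by rewrite updE eqxx cats0; store_eq.
Qed.

#[global] Instance enc_prod A B {eA : Enc A} {eB : Enc B} : Enc (A * B) :=
  fun p => Nd (enc p.1) (enc p.2).
#[global] Instance enc_bool : Enc bool := fun b => if b then Nd Lf Lf else Lf.
(** Unary: a number has the same tree as a list of that many leaves, which turns counting loops into
    folds over lists. *)
#[global] Instance enc_nat : Enc nat := fun n => iter n (Nd Lf) Lf.
#[global] Instance enc_seq A {eA : Enc A} : Enc (seq A) :=
  fun s => foldr (fun x t => Nd (enc x) t) Lf s.

Lemma sz_pair A B {eA : Enc A} {eB : Enc B} (x : A) (y : B) : sz (x, y) = (sz x + sz y).+1.
Proof. exact: tsz_Nd. Qed.

Lemma sz_cons A {eA : Enc A} (x : A) (s : seq A) : sz (x :: s) = (sz x + sz s).+1.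
Proof. exact: tsz_Nd. Qed.

Lemma size_le_sz A {eA : Enc A} (s : seq A) : size s <= sz s.
Proof. by elim: s => //= x s IH; rewrite sz_cons; lia. Qed.

Section Closure2.
Context {A B C : Type} {eA : Enc A} {eB : Enc B} {eC : Enc C}.

(** Run [f] on the input while a copy waits in register [M], park the result in [M.+1], restore the
    copy and run [g]. Stated for any [h] whose tree is a node, it yields pairs, list cells and
    successors at once. *)
Lemma FP_Nd (f : A -> B) (g : A -> C) D {eD : Enc D} (h : A -> D) :
  (forall x, enc (h x) = Nd (enc (f x)) (enc (g x))) -> FP f -> FP g -> FP h.
Proof.
move=> hE Ff Fg; have [b Hb] := FP_size Ff; have [b' Hb'] := FP_size Fg.
case: Ff => [c [m [a [m0 u H]]]]; case: Fg => [c' [m' [a' [m0' u' H']]]].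
pose M := maxn m m'.
pose prog := Seq (copy 0 M M.+2) (Seq c (Seq (move 0 M.+1 M.+2) (Seq (move M 0 M.+2)
  (Seq c' (Seq (move M.+1 0 M.+2) (Push 0 true)))))).
apply: (@FP_intro _ _ _ _ prog M.+3 (fun n => 5 * n + 2 + (pb a n + (4 * pb b n + 2 + (4 * n + 2 +
   (pb a' n + (4 * pb b n + 2 + 1))))))) => //.
- by rewrite /= !(@uses_mono _ _ M.+3 _ u, @uses_mono _ _ M.+3 _ u') // /M; lia.
- by pbd_tac.
have M0 : 0 < M by rewrite /M; lia.
have le1 : m <= M by rewrite /M; lia.
have le2 : m' <= M by rewrite /M; lia.
clearbody M.
move=> x s s0 sj.
have sM : [/\ s M = [::], s M.+1 = [::] & s M.+2 = [::]] by split; apply: sj; lia.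
case: sM => [sM sM1 sM2].
have N0 : (0 == M) = false by lia.
pose X := ser (@enc _ eA x).
pose s1 := upd s M X.
have E1 : evT (copy 0 M M.+2) s (5 * sz x + 2) s1.
  by have := @ev_copy 0 M M.+2 s; rewrite s0 sM cats0; apply; rewrite ?sM2 //; lia.
have [||t2 t2le E2] := H x s1.
- by rewrite /s1 updE N0.
- by move=> j jm; rewrite /s1 updE; case: eqP => [|_]; [lia|apply: sj; lia].
set s2 := upd s1 0 _ in E2.
pose s3 := upd (upd s2 0 [::]) M.+1 (ser (@enc _ eB (f x))).
have E3 : evT (move 0 M.+1 M.+2) s2 (4 * sz (f x) + 2) s3.
  have Z : s2 M.+2 = [::] by rewrite /s2 /s1 !updE /= sM2; case: eqP => //; lia.
  apply: ev_to (ev_move _ _ _ Z) _; try by lia.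
  by rewrite /s3 /s2 /s1; store_eq; rewrite sM1 cats0.
pose s4 := upd (upd s3 0 X) M [::].
have E4 : evT (move M 0 M.+2) s3 (4 * sz x + 2) s4.
  have Z : s3 M.+2 = [::] by rewrite /s3 /s2 /s1 !updE /= sM2; repeat case: eqP => //; lia.
  have Z' : s3 M = X.
    by rewrite /s3 /s2 /s1 !updE !eqxx; repeat case: eqP => //; lia.
  rewrite -[sz x]/(size X) -Z'.
  apply: ev_to (ev_move _ _ _ Z) _; try by lia.
  by rewrite Z' /s4 /s3 /s2 /s1; store_eq; rewrite cats0.
have [||t5 t5le E5] := H' x s4.
- by rewrite /s4 !updE N0.
- move=> j jm; rewrite /s4 /s3 /s2 /s1 !updE; repeat (case: eqP => ? //; try lia).
  by apply: sj; lia.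
set s5 := upd s4 0 _ in E5.
pose s6 := upd (upd s5 M.+1 [::]) 0 (ser (@enc _ eB (f x)) ++ ser (@enc _ eC (g x))).
have E6 : evT (move M.+1 0 M.+2) s5 (4 * sz (f x) + 2) s6.
  have Z : s5 M.+2 = [::].
    by rewrite /s5 /s4 /s3 /s2 /s1 !updE /= sM2; repeat case: eqP => //; lia.
  have Z' : s5 M.+1 = ser (enc (f x)).
    by rewrite /s5 /s4 /s3 /s2 /s1 !updE !eqxx; repeat case: eqP => //; lia.
  rewrite -[sz (f x)]/(size (ser (enc (f x)))) -Z'.
  apply: ev_to (ev_move _ _ _ Z) _; try by lia.
  by rewrite Z' /s6 /s5 /s4 /s3 /s2 /s1; store_eq.
exists (5 * sz x + 2 + (t2 + (4 * sz (f x) + 2 + (4 * sz x + 2 + (t5 + (4 * sz (f x) + 2 + 1)))))).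
  by have := Hb x; lia.
apply: ev_seq E1 (ev_seq E2 (ev_seq E3 (ev_seq E4 (ev_seq E5 (ev_seq E6 _))))).
apply: ev_to (@ev_push predT 0 true s6 isT) _.
by rewrite hE /s6 /s5 /s4 /s3 /s2 /s1 /=; store_eq.
Qed.

Lemma FP_pair (f : A -> B) (g : A -> C) : FP f -> FP g -> FP (fun x => (f x, g x)).
Proof. exact: FP_Nd. Qed.

Definition thd (t : tree) := if t is Nd a _ then a else Lf.
Definition ttl (t : tree) := if t is Nd _ b then b else Lf.

Lemma FP_thd (f : A -> B) : (forall x, enc (f x) = thd (enc x)) -> FP f.
Proof.
move=> fE.
apply: (@FP_intro _ _ _ _ (Case 0 Skip (Push 0 false) (Seq (split 0 1 2 3)
   (Seq (clear 0) (move 1 0 2)))) 4 (fun n => 20 * n + 20)) => //; first by pbd_tac.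
move=> x s; rewrite fE /tsz; case: (enc x) => [|a b] /= s0 sj.
  exists 2 => //; apply: (@evT_case _ _ _ _ _ false [::]) => //.
  by apply: ev_to (@ev_push predT _ _ _ isT) _; store_eq.
pose s1 := upd s 0 (ser a ++ ser b).
have [||||t tle E] := @ev_split 0 1 2 3 s1 a (ser b) => //; try by rewrite /s1 !updE sj.
set s2 := upd _ 1 _ in E.
exists (t + ((2 * size (ser b)).+1 + (4 * size (ser a) + 2))).+1.
  by rewrite size_cat; move: tle; rewrite /tsz; lia.
apply: (@evT_case _ _ _ _ _ true (ser a ++ ser b)) => //.
apply: ev_seq E _; apply: ev_seq.
  have Z : s2 0 = ser b by [].
  by rewrite -Z; apply: ev_clear.
have Z : upd s2 0 [::] 1 = ser a by rewrite /s2 /s1 !updE sj //= cats0.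
rewrite -Z; apply: ev_to (ev_move _ _ _ _) _ => //.
  by rewrite /s2 /s1 !updE /= sj.
by rewrite Z; rewrite /s2 /s1; store_eq; rewrite ?cats0 ?sj.
Qed.

Lemma FP_ttl (f : A -> B) : (forall x, enc (f x) = ttl (enc x)) -> FP f.
Proof.
move=> fE.
apply: (@FP_intro _ _ _ _ (Case 0 Skip (Push 0 false) (Seq (split 0 1 2 3)
   (clear 1))) 4 (fun n => 20 * n + 20)) => //; first by pbd_tac.
move=> x s; rewrite fE /tsz; case: (enc x) => [|a b] /= s0 sj.
  exists 2 => //; apply: (@evT_case _ _ _ _ _ false [::]) => //.
  by apply: ev_to (@ev_push predT _ _ _ isT) _; store_eq.
pose s1 := upd s 0 (ser a ++ ser b).
have [||||t tle E] := @ev_split 0 1 2 3 s1 a (ser b) => //; try by rewrite /s1 !updE sj.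
set s2 := upd _ 1 _ in E.
exists (t + (2 * size (ser a)).+1).+1.
  by rewrite size_cat; move: tle; rewrite /tsz; lia.
apply: (@evT_case _ _ _ _ _ true (ser a ++ ser b)) => //.
apply: ev_seq E _.
have Z : s2 1 = ser a by rewrite /s2 /s1 !updE sj //= cats0.
rewrite -Z; apply: ev_to (ev_clear _ _) _.
by rewrite /s2 /s1; store_eq; rewrite ?cats0 ?sj.
Qed.

Lemma FP_if (p : A -> bool) (f g : A -> B) : FP p -> FP f -> FP g ->
  FP (fun x => if p x then f x else g x).
Proof.
move=> [cp [mp [ap [mp0 up Hp]]]] [c [m [a [m0 u H]]]] [c' [m' [a' [m0' u' H']]]].
pose M := maxn mp (maxn m m').
pose back := Seq (clear 0) (move M 0 M.+1).
pose prog := Seq (copy 0 M M.+1) (Seq cp (Case 0 Skip (Seq back c') (Seq back c))).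
apply: (@FP_intro _ _ _ _ prog M.+2 (fun n => 5 * n + 2 + (pb ap n +
   (7 + (4 * n + 2) + (pb a n + pb a' n)).+1))) => //.
- by rewrite /= !(@uses_mono _ _ M.+2 _ u, @uses_mono _ _ M.+2 _ u', @uses_mono _ _ M.+2 _ up) // /M; lia.
- by pbd_tac.
have M0 : 0 < M by rewrite /M; lia.
have le0 : mp <= M by rewrite /M; lia.
have le1 : m <= M by rewrite /M; lia.
have le2 : m' <= M by rewrite /M; lia.
rewrite /prog /back; clearbody M.
move=> x s s0 sj.
have sM : s M = [::] /\ s M.+1 = [::] by split; apply: sj; lia.
case: sM => [sM sM1].
have N0 : (0 == M) = false by lia.
pose X := ser (@enc _ eA x).
pose s1 := upd s M X.
have E1 : evT (copy 0 M M.+1) s (5 * sz x + 2) s1.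
  by have := @ev_copy 0 M M.+1 s; rewrite s0 sM cats0; apply; rewrite ?sM1 //; lia.
have [||t2 t2le E2] := Hp x s1.
- by rewrite /s1 updE N0.
- by move=> j jm; rewrite /s1 updE; case: eqP => [|_]; [lia|apply: sj; lia].
set s2 := upd s1 0 _ in E2.
have back_ok l : size l <= 2 -> exists2 t, t <= 7 + (4 * sz x + 2) &
    evT (Seq (clear 0) (move M 0 M.+1)) (upd s2 0 l) t s.
  move=> ll; exists ((2 * size l).+1 + (4 * sz x + 2)); first by lia.
  apply: (@ev_seq _ _ _ _ (upd s2 0 [::])).
    by apply: ev_to (ev_clear 0 (upd s2 0 l)) _; store_eq.
  have Z : upd s2 0 [::] M = X by rewrite /s2 /s1 !updE eqxx; repeat case: eqP => //; lia.
  rewrite -[sz x]/(size X) -Z.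
  apply: ev_to (ev_move _ _ _ _) _; try by lia.
    by rewrite /s2 /s1 !updE; repeat case: eqP => //; lia.
  by rewrite Z /s2 /s1; store_eq; rewrite cats0 s0.
have [t3 t3le E3] : exists2 t, t <= pb a (sz x) + pb a' (sz x) &
    evT (if p x then c else c') s t (upd s 0 (ser (enc (if p x then f x else g x)))).
  case: (p x).
    have [||t tle E] := H x s => //; first by move=> j jm; apply: sj; lia.
    by exists t => //; lia.
  have [||t tle E] := H' x s => //; first by move=> j jm; apply: sj; lia.
  by exists t => //; lia.
have [t4 t4le E4] := back_ok (if p x then [:: false; false] else [::]) ltac:(by case: (p x)).
exists (5 * sz x + 2 + (t2 + (t4 + t3).+1)); first by lia.
apply: ev_seq E1 (ev_seq E2 _).
apply: (@evT_case _ _ _ _ _ (p x) (if p x then [:: false; false] else [::])).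
  by rewrite /s2 updE /=; case: (p x).
by case: (p x) E3 E4 => E3 E4; apply: ev_seq E4 E3.
Qed.

End Closure2.

Lemma FP_fst A B {eA : Enc A} {eB : Enc B} : FP (@fst A B).
Proof. exact: FP_thd. Qed.

Lemma FP_snd A B {eA : Enc A} {eB : Enc B} : FP (@snd A B).
Proof. exact: FP_ttl. Qed.

(** The list is consumed in place on register [m]. The loop pops the leading bit of a list cell, the
    element is split off onto the accumulator, and one push forms the pair that [g] expects. The
    size of every intermediate accumulator is bounded by hypothesis, since iterating a
    polynomial-time function may otherwise grow exponentially. *)
Lemma FP_fold_core X E A {eX : Enc X} {eE : Enc E} {eA : Enc A}
    (g : E * A -> A) (l : X -> seq E) (a : X -> A) (q : nat) :
  (forall x, enc x = Nd (enc (l x)) (enc (a x))) -> FP g ->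
  (forall x n, sz (foldl (fun z e => g (e, z)) (a x) (take n (l x))) <= pb q (sz x)) ->
  FP (fun x => foldl (fun z e => g (e, z)) (a x) (l x)).
Proof.
move=> xE [c [m [b [m0 u H]]]] Hq.
pose prog M := Case 0 Skip Skip (Seq (split 0 M M.+1 M.+2)
  (Loop M Skip (Seq (split M 0 M.+1 M.+2) (Seq (Push 0 true) c)))).
pose T n := 7 * n + 3 + 1 + pb b (n + pb q n + 1).
apply: (@FP_intro _ _ _ _ (prog m) m.+3 (fun n => (7 * n + 3 + (n * (T n).+1 + 3)).+1)) => //.
- by rewrite /= !(@uses_mono _ _ m.+3 _ u) //; lia.
- by rewrite /T; pbd_tac.
move=> x s s0 sj.
have sM : [/\ s m = [::], s m.+1 = [::] & s m.+2 = [::]] by split; apply: sj; lia.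
case: sM => [sM sM1 sM2].
have N0 : (m == 0) = false by lia.
pose N := tsz (@enc _ eX x).
have [|||| t1 t1le E1] := @ev_split 0 m m.+1 m.+2 (upd s 0 (ser (enc (l x)) ++ ser (enc (a x))))
    (enc (l x)) (ser (enc (a x))).
- by rewrite /= !inE; lia.
- by rewrite updE.
- by rewrite updE.
- by rewrite updE.
set s1 := upd _ m _ in E1.
have lN : sz (l x) + sz (a x) < N by rewrite /N xE tsz_Nd.
have main (r : seq E) (z : A) : forall s',
    (forall n, sz (foldl (fun z e => g (e, z)) z (take n r)) <= pb q N) ->
    sz r <= N ->
    s' 0 = ser (enc z) -> s' m = ser (enc r) -> (forall j, 0 < j < m.+3 -> j != m -> s' j = [::]) ->
    exists2 t, t <= size r * (T N).+1 + 3 &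
    evT (Loop m Skip (Seq (split m 0 m.+1 m.+2) (Seq (Push 0 true) c))) s' t
      (upd (upd s' m [::]) 0 (ser (enc (foldl (fun z e => g (e, z)) z r)))).
  elim: r z => [|e r IH] z s' Hn rN s'0 s'm s'j.
    exists 3; first by lia.
    apply: (@evT_loop _ _ _ _ false [::] 1 (upd s' m [::]) 1) => //.
      exact: ev_skip.
    have e0 : upd s' m [::] m = [::] by rewrite updE eqxx.
    by apply: ev_to (ev_loop0 _ _ e0 isT) _; rewrite /= -s'0; store_eq.
  have rE : sz (e :: r) = (sz e + sz r).+1 by exact: tsz_Nd.
  have z0 : sz z <= pb q N by have := Hn 0; rewrite take0.
  have sM' : [/\ s' m.+1 = [::] & s' m.+2 = [::]] by split; apply: s'j; lia.
  case: sM' => [s'M1 s'M2].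
  pose s2 := upd s' m (ser (@enc _ eE e) ++ ser (@enc _ (@enc_seq E eE) r)).
  have [||||t2 t2le E2] := @ev_split m 0 m.+1 m.+2 s2 (enc e) (ser (enc r)).
  - by rewrite /= !inE; lia.
  - by rewrite /s2 updE eqxx.
  - by rewrite /s2 updE; case: eqP => //; lia.
  - by rewrite /s2 updE; case: eqP => //; lia.
  set s3 := upd _ 0 _ in E2.
  pose s4 := upd s3 0 (ser (@enc _ (@enc_prod E A eE eA) (e, z))).
  have E3 : evT (Push 0 true) s3 1 s4.
    apply: ev_to (@ev_push predT _ _ _ isT) _.
    by rewrite /s4 /s3 /s2 /=; store_eq; rewrite ?s'0 //= eq_sym N0 ?s'0.
  have [||t4 t4le E4] := H (e, z) s4.
  - by rewrite /s4.
  - move=> j jm; rewrite /s4 /s3 /s2 !updE; repeat (case: eqP => ?; try lia).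
    by apply: s'j; lia.
  set s5 := upd s4 0 _ in E4.
  have [|||||t5 t5le E5] := IH (g (e, z)) s5.
  - by move=> n; have := Hn n.+1.
  - by lia.
  - by rewrite /s5 updE.
  - by rewrite /s5 /s4 /s3 /s2 !updE eqxx N0.
  - move=> j jm jM; rewrite /s5 /s4 /s3 /s2 !updE (negbTE jM).
    by case: eqP => [|_]; [lia | apply: s'j].
  exists (t2 + (1 + t4) + t5).+1.
    have : pb b (sz (e, z)) <= pb b (N + pb q N + 1).
      by apply: pb_mono; rewrite sz_pair; lia.
    have TE : 7 * N + 3 + 1 + pb b (N + pb q N + 1) = T N by [].
    move: (T N) TE t5le => TN TE t5le le; rewrite /= mulSn.
    move: (size r * TN.+1) t5le => w t5le; lia.
  apply: (@evT_loop _ _ _ _ true (ser (enc e) ++ ser (enc r)) _ s5) => //.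
    by apply: ev_seq E2 (ev_seq E3 E4).
  by apply: ev_to E5 _; rewrite /s5 /s4 /s3 /s2 /=; store_eq.
have [|||||t6 t6le E6] := main (l x) (a x) s1.
- exact: Hq.
- by lia.
- by rewrite /s1 !updE eq_sym N0.
- by rewrite /s1 !updE eqxx N0 sM cats0.
- move=> j jm jM; rewrite /s1 !updE (negbTE jM).
  by case: eqP => [|_]; [lia | apply: sj].
exists (t1 + t6).+1.
  have szl : size (l x) <= sz (l x).
    exact: size_le_sz.
  have := leq_mul (leq_trans szl (leq_trans (leq_addr _ _) (ltnW lN))) (leqnn (T N).+1).
  rewrite -/N; lia.
apply: (@evT_case _ _ _ _ _ true (ser (enc (l x)) ++ ser (enc (a x)))).
  by rewrite s0 xE.
apply: ev_seq E1 _; apply: ev_to E6 _.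
by rewrite /s1; store_eq.
Qed.

Lemma FP_foldl X E A {eX : Enc X} {eE : Enc E} {eA : Enc A}
    (f : X -> A -> E -> A) (l : X -> seq E) (a : X -> A) (Q : nat -> nat) :
  FP (fun p : X * (E * A) => f p.1 p.2.2 p.2.1) -> FP l -> FP a -> pbd Q ->
  (forall x n, sz (foldl (f x) (a x) (take n (l x))) <= Q (sz x)) ->
  FP (fun x => foldl (f x) (a x) (l x)).
Proof.
move=> Ff Fl Fa pQ HQ.
have [q Hq] : pbd (fun n => n + Q n + 1) by pbd_tac.
pose g (p : E * (X * A)) : X * A := (p.2.1, f p.2.1 p.2.2 p.1).
have Fg : FP g.
  have F2 : FP (fun p : E * (X * A) => p.2) by exact: FP_snd.
  have F21 : FP (fun p : E * (X * A) => p.2.1) by apply: (FP_comp F2); apply: FP_fst.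
  have F22 : FP (fun p : E * (X * A) => p.2.2) by apply: (FP_comp F2); apply: FP_snd.
  have F3 : FP (fun p : E * (X * A) => p.1) by exact: FP_fst.
  apply: FP_pair => //.
  apply: (FP_comp (f := fun p : E * (X * A) => (p.2.1, (p.1, p.2.2))) _ Ff).
  by apply: FP_pair => //; apply: FP_pair.
have key x n : foldl (fun z e => g (e, z)) (x, a x) (take n (l x)) =
    (x, foldl (f x) (a x) (take n (l x))).
  by elim: (take _ _) (a x) => //= e r IH z; rewrite IH.
have Fxa : FP (fun x => (x, a x)) by apply: FP_pair => //; apply: FP_id.
(* A second encoding of [X], as the list together with the initial accumulator. The core lemma
   applies under it, and passing to it from the given encoding is itself in [FP]. *)
pose e' : Enc X := fun x => Nd (@enc _ (@enc_seq E eE) (l x)) (Nd (@enc _ eX x) (@enc _ eA (a x))).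
have F1 : @FP X X eX e' id by exact: (@FP_Nd _ _ _ _ _ _ _ _ _ e' _ _ Fl Fxa).
have F4 : @FP X (X * A) e' (@enc_prod X A eX eA) (fun x => foldl (fun z e => g (e, z)) (x, a x) (l x)).
  apply: (@FP_fold_core X E (X * A) e' eE (@enc_prod X A eX eA) g l (fun x => (x, a x)) q) => // x n.
  rewrite key; have le : @tsz (@enc X eX x) <= @tsz (@enc X e' x).
    by rewrite [in leqRHS]/enc /e' !tsz_Nd; lia.
  apply: leq_trans (pb_mono _ le); apply: leq_trans (Hq _).
  by rewrite sz_pair; have := HQ x n; lia.
apply: (@FP_eq _ _ _ _ (fun x => (foldl (fun z e => g (e, z)) (x, a x) (l x)).2)).
  by move=> x; have := key x (size (l x)); rewrite take_size => ->.
have F5 := FP_comp F1 F4.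
exact: (FP_comp F5 (@FP_snd X A eX eA)).
Qed.

#[global] Instance enc_unit : Enc unit := fun=> Lf.

(** * Closure under Boolean, arithmetic and list operations *)

Section Bool.
Context {X : Type} {eX : Enc X}.

Lemma FP_true : FP (fun _ : X => true). Proof. exact: FP_const. Qed.
Lemma FP_false : FP (fun _ : X => false). Proof. exact: FP_const. Qed.

Lemma FP_andb (p q : X -> bool) : FP p -> FP q -> FP (fun x => p x && q x).
Proof. by move=> Fp Fq; apply: (FP_if Fp Fq FP_false). Qed.

Lemma FP_orb (p q : X -> bool) : FP p -> FP q -> FP (fun x => p x || q x).
Proof. by move=> Fp Fq; apply: (FP_if Fp FP_true Fq). Qed.

Lemma FP_negb (p : X -> bool) : FP p -> FP (fun x => ~~ p x).
Proof. by move=> Fp; apply: (FP_if Fp FP_false FP_true). Qed.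

Lemma FP_eqb (p q : X -> bool) : FP p -> FP q -> FP (fun x => p x == q x).
Proof.
move=> Fp Fq; apply: (FP_eq _ (FP_if Fp Fq (FP_negb Fq))) => x.
by case: (p x); case: (q x).
Qed.

Lemma FP_addb (p q : X -> bool) : FP p -> FP q -> FP (fun x => p x (+) q x).
Proof.
move=> Fp Fq; apply: (FP_eq _ (FP_if Fp (FP_negb Fq) Fq)) => x.
by case: (p x); case: (q x).
Qed.

End Bool.

Lemma FP_prod1 X A B {eX : Enc X} {eA : Enc A} {eB : Enc B} (f : X -> A * B) :
  FP f -> FP (fun x => (f x).1).
Proof. by move=> Ff; apply: (FP_comp Ff); apply: FP_fst. Qed.

Lemma FP_prod2 X A B {eX : Enc X} {eA : Enc A} {eB : Enc B} (f : X -> A * B) :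
  FP f -> FP (fun x => (f x).2).
Proof. by move=> Ff; apply: (FP_comp Ff); apply: FP_snd. Qed.

Lemma FP_S X {eX : Enc X} (f : X -> nat) : FP f -> FP (fun x => (f x).+1).
Proof. by move=> Ff; apply: (@FP_Nd _ _ _ _ _ _ (fun=> false) f) => //; apply: FP_const. Qed.

Lemma FP_pred X {eX : Enc X} (f : X -> nat) : FP f -> FP (fun x => (f x).-1).
Proof. by move=> Ff; apply: (FP_comp Ff); apply: FP_ttl => -[]. Qed.

Lemma FP_cons X A {eX : Enc X} {eA : Enc A} (f : X -> A) (s : X -> seq A) :
  FP f -> FP s -> FP (fun x => f x :: s x).
Proof. exact: FP_Nd. Qed.

Lemma FP_behead X A {eX : Enc X} {eA : Enc A} (s : X -> seq A) :
  FP s -> FP (fun x => behead (s x)).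
Proof. by move=> Ff; apply: (FP_comp Ff); apply: FP_ttl => -[]. Qed.

Lemma FP_nseq_tt X {eX : Enc X} (f : X -> nat) : FP f -> FP (fun x => nseq (f x) tt).
Proof. by move=> Ff; apply: (FP_comp Ff); apply: FP_same; elim=> //= n; rewrite /enc /= => ->. Qed.

Lemma sz_bool (b : bool) : sz b <= 3. Proof. by case: b. Qed.

Lemma sz_nat n : sz n = 2 * n + 1.
Proof. by elim: n => // n IH; rewrite -[sz n.+1]/(tsz (Nd Lf (enc n))) tsz_Nd IH -[tsz Lf]/1; lia. Qed.

Lemma sz_nil A {eA : Enc A} : sz ([::] : seq A) = 1. Proof. by []. Qed.

Lemma sz_cat A {eA : Enc A} (s t : seq A) : sz (s ++ t) = sz s + sz t - 1.
Proof.
elim: s => [|x s IH] /=; first by rewrite sz_nil; lia.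
have s0 : 0 < sz s by exact: tsz_gt0.
have t0 : 0 < sz t by exact: tsz_gt0.
by rewrite !sz_cons IH; lia.
Qed.

Lemma sz_rev A {eA : Enc A} (s : seq A) : sz (rev s) = sz s.
Proof.
elim: s => //= x s IH; rewrite rev_cons -cats1 sz_cat IH !sz_cons sz_nil.
have s0 : 0 < sz s by exact: tsz_gt0.
by lia.
Qed.

Lemma sz_subseq A {eA : Enc A} (m : bitseq) (s : seq A) : sz (mask m s) <= sz s.
Proof.
elim: m s => [|b m IH] [|x s] //=.
by have := IH s; case: b; rewrite /= !sz_cons; lia.
Qed.

Lemma sz_filter A {eA : Enc A} (p : pred A) (s : seq A) : sz (filter p s) <= sz s.
Proof. by rewrite filter_mask sz_subseq. Qed.

Lemma sz_take A {eA : Enc A} n (s : seq A) : sz (take n s) <= sz s.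
Proof.
have s0 : 0 < sz (drop n s) by exact: tsz_gt0.
by rewrite -[in leqRHS](cat_take_drop n s) sz_cat; lia.
Qed.

Lemma sz_drop A {eA : Enc A} n (s : seq A) : sz (drop n s) <= sz s.
Proof.
have s0 : 0 < sz (take n s) by exact: tsz_gt0.
by rewrite -[in leqRHS](cat_take_drop n s) sz_cat; lia.
Qed.

Lemma FP_foldl_inv X E A {eX : Enc X} {eE : Enc E} {eA : Enc A}
    (f : X -> A -> E -> A) (l : X -> seq E) (a : X -> A) (I : X -> A -> Prop) Q :
  FP (fun p : X * (E * A) => f p.1 p.2.2 p.2.1) -> FP l -> FP a -> pbd Q ->
  (forall x, I x (a x)) -> (forall x z e, I x z -> I x (f x z e)) ->
  (forall x z, I x z -> sz z <= Q (sz x)) ->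
  FP (fun x => foldl (f x) (a x) (l x)).
Proof.
move=> Ff Fl Fa pQ I0 IS IQ; apply: (FP_foldl Ff Fl Fa pQ) => x n; apply: IQ.
by elim: (take n _) (a x) (I0 x) => //= e r IH z Iz; apply: IH; apply: IS.
Qed.

Section Lists.
Context {X E A : Type} {eX : Enc X} {eE : Enc E} {eA : Enc A}.

Lemma FP_has (p : X -> E -> bool) (l : X -> seq E) :
  FP (fun q : X * E => p q.1 q.2) -> FP l -> FP (fun x => has (p x) (l x)).
Proof.
move=> Fp Fl.
apply: (@FP_eq _ _ _ _ (fun x => foldl (fun b e => b || p x e) false (l x))).
  move=> x; have H b : foldl (fun b e => b || p x e) b (l x) = b || has (p x) (l x).
    by elim: (l x) b => /= [|e r IH] b; rewrite ?orbF // IH orbA.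
  by rewrite H.
apply: (@FP_foldl_inv _ _ _ _ _ _ (fun x b e => b || p x e) l (fun=> false) (fun _ _ => True) (fun=> 3)) => //.
- apply: FP_orb; first by apply: FP_prod2; apply: FP_snd.
  apply: (FP_comp (f := fun q : X * (E * bool) => (q.1, q.2.1)) _ Fp).
  by apply: FP_pair; [exact: FP_fst | apply: FP_prod1; apply: FP_snd].
- exact: FP_const.
- by pbd_tac.
- by move=> _ z _; apply: sz_bool.
Qed.

Lemma FP_all (p : X -> E -> bool) (l : X -> seq E) :
  FP (fun q : X * E => p q.1 q.2) -> FP l -> FP (fun x => all (p x) (l x)).
Proof.
move=> Fp Fl; apply: (FP_eq _ (FP_negb (FP_has (p := fun x e => ~~ p x e) (FP_negb Fp) Fl))).
by move=> x; rewrite has_predC negbK.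
Qed.

Lemma FP_rev (l : X -> seq E) : FP l -> FP (fun x => rev (l x)).
Proof.
move=> Fl; have [b Hb] := FP_size Fl.
apply: (@FP_eq _ _ _ _ (fun x => foldl (fun z e => e :: z) [::] (l x))).
  have H (s t : seq E) : foldl (fun z e => e :: z) t s = catrev s t by elim: s t => //= e s IH t.
  by move=> x; rewrite H.
apply: (@FP_foldl _ _ _ _ _ _ (fun x z e => e :: z) l (fun=> [::]) (pb b)) => //.
- apply: FP_cons; first by apply: FP_prod1; apply: FP_snd.
  by apply: FP_prod2; apply: FP_snd.
- exact: FP_const.
- exact: pbd_pb.
move=> x n; apply: leq_trans (Hb x).
have H (s t : seq E) : foldl (fun z e => e :: z) t s = catrev s t by elim: s t => //= e s IH t.
by rewrite H -/(rev _) sz_rev sz_take.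
Qed.

Lemma FP_foldr (f : X -> E -> A -> A) (l : X -> seq E) (a : X -> A) (Q : nat -> nat) :
  FP (fun p : X * (E * A) => f p.1 p.2.1 p.2.2) -> FP l -> FP a -> pbd Q ->
  (forall x n, sz (foldr (f x) (a x) (drop n (l x))) <= Q (sz x)) ->
  FP (fun x => foldr (f x) (a x) (l x)).
Proof.
move=> Ff Fl Fa pQ HQ.
apply: (@FP_eq _ _ _ _ (fun x => foldl (fun z e => f x e z) (a x) (rev (l x)))).
  by move=> x; rewrite foldl_rev.
apply: (FP_foldl (f := fun x z e => f x e z) Ff (FP_rev Fl) Fa pQ) => x n.
by rewrite take_rev foldl_rev.
Qed.

End Lists.

Section Lists2.
Context {X E A : Type} {eX : Enc X} {eE : Enc E} {eA : Enc A}.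

Lemma FP_map (f : X -> E -> A) (l : X -> seq E) :
  FP (fun q : X * E => f q.1 q.2) -> FP l -> FP (fun x => map (f x) (l x)).
Proof.
move=> Ff Fl; have [b Hb] := FP_size Fl; have [c Hc] := FP_size Ff.
apply: (@FP_foldr _ _ _ _ _ _ (fun x e z => f x e :: z) l (fun=> [::])
  (fun n => pb b n * (pb c (n + pb b n + 1)).+1 + 1)) => //.
- apply: FP_cons; last by apply: FP_prod2; apply: FP_snd.
  apply: (FP_comp (f := fun q : X * (E * seq A) => (q.1, q.2.1)) _ Ff).
  by apply: FP_pair; [exact: FP_fst | apply: FP_prod1; apply: FP_snd].
- exact: FP_const.
- by pbd_tac.
move=> x n; set s := drop n _.
have Hs : sz s <= pb b (sz x) by apply: leq_trans (Hb x); apply: sz_drop.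
have {}Hs := leq_trans (size_le_sz s) Hs.
have Es e : List.In e s -> sz (f x e) <= pb c (sz x + pb b (sz x) + 1).
  move=> es; apply: leq_trans (Hc (x, e)) _; apply: pb_mono; rewrite sz_pair.
  have h : sz e <= pb b (sz x); last by lia.
  apply: leq_trans (Hb x); apply: leq_trans (sz_drop n _); rewrite -/s.
  elim: s es {Hs} => //= y s IH; rewrite sz_cons; case=> [->|/IH]; lia.
set B := pb c _ in Es *.
apply: (@leq_trans (size s * B.+1 + 1)); last by rewrite leq_add2r leq_mul2r Hs orbT.
elim: s Es {Hs} => //= e s IH Es; rewrite sz_cons mulSn.
have := IH (fun e h => Es e (or_intror h)); have := Es e (or_introl erefl); lia.
Qed.

Lemma FP_filter (p : X -> E -> bool) (l : X -> seq E) :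
  FP (fun q : X * E => p q.1 q.2) -> FP l -> FP (fun x => filter (p x) (l x)).
Proof.
move=> Fp Fl; have [b Hb] := FP_size Fl.
apply: (@FP_eq _ _ _ _ (fun x => foldl (fun z e => if p x e then e :: z else z) [::] (rev (l x)))).
  by move=> x; rewrite foldl_rev.
have F2 : FP (fun q : X * (E * seq E) => q.2.2) by apply: FP_prod2; apply: FP_snd.
have F1 : FP (fun q : X * (E * seq E) => q.2.1) by apply: FP_prod1; apply: FP_snd.
apply: (@FP_foldl X E (seq E) _ _ _ (fun x z e => if p x e then e :: z else z)
  (fun x => rev (l x)) (fun=> [::]) (pb b)).
- apply: FP_if => //; last exact: FP_cons.
  apply: (FP_comp (f := fun q : X * (E * seq E) => (q.1, q.2.1)) _ Fp).
  by apply: FP_pair => //; exact: FP_fst.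
- exact: FP_rev.
- exact: FP_const.
- exact: pbd_pb.
move=> x n; rewrite take_rev foldl_rev; apply: leq_trans (Hb x).
exact: leq_trans (sz_filter _ _) (sz_drop _ _).
Qed.

Lemma FP_last (d : X -> E) (l : X -> seq E) : FP d -> FP l -> FP (fun x => last (d x) (l x)).
Proof.
move=> Fd Fl; have [b Hb] := FP_size Fl; have [c Hc] := FP_size Fd.
apply: (@FP_eq _ _ _ _ (fun x => foldl (fun _ e => e) (d x) (l x))).
  by move=> x; elim: (l x) (d x) => //= e r IH d'.
apply: (@FP_foldl _ _ _ _ _ _ (fun x z e => e) l d (fun n => pb c n + pb b n)) => //.
- by apply: FP_prod1; apply: FP_snd.
- by pbd_tac.
move=> x n; apply: (@leq_trans (sz (d x) + sz (take n (l x)))); last first.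
  by apply: leq_add => //; apply: leq_trans (sz_take _ _) (Hb x).
elim: (take n _) (d x) => /= [|e s IH] d'; first by lia.
by have := IH e; rewrite sz_cons; lia.
Qed.

End Lists2.

Section Lists3.
Context {X E A B : Type} {eX : Enc X} {eE : Enc E} {eA : Enc A} {eB : Enc B}.

Lemma FP_cat (s t : X -> seq E) : FP s -> FP t -> FP (fun x => s x ++ t x).
Proof.
move=> Fs Ft; have [b Hb] := FP_size Fs; have [c Hc] := FP_size Ft.
have H r x : foldr (fun (e : E) z => e :: z) (t x) r = r ++ t x by elim: r => //= e r ->.
apply: (@FP_eq _ _ _ _ (fun x => foldr (fun e z => e :: z) (t x) (s x))); first by move=> x.
apply: (@FP_foldr _ _ _ _ _ _ (fun x e z => e :: z) s t (fun n => pb b n + pb c n)) => //.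
- exact: FP_snd.
- by pbd_tac.
move=> x n; rewrite H sz_cat; apply: leq_trans (leq_subr _ _) _.
by apply: leq_add; [apply: leq_trans (Hb x); apply: sz_drop | apply: Hc].
Qed.

End Lists3.

Section Lists4.
Context {X E A B : Type} {eX : Enc X} {eE : Enc E} {eA : Enc A} {eB : Enc B}.

Lemma sz_flatten (ss : seq (seq E)) : sz (flatten ss) <= sz ss.
Proof. by elim: ss => //= s ss IH; rewrite sz_cat sz_cons; lia. Qed.

Lemma FP_flatten (s : X -> seq (seq E)) : FP s -> FP (fun x => flatten (s x)).
Proof.
move=> Fs; have [b Hb] := FP_size Fs.
apply: (@FP_foldr _ _ _ _ _ _ (fun x => cat) s (fun=> [::]) (pb b)) => //.
- by apply: FP_cat; [apply: FP_prod1; apply: FP_snd | apply: FP_prod2; apply: FP_snd].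
- exact: FP_const.
- exact: pbd_pb.
by move=> x n; apply: leq_trans (sz_flatten _) (leq_trans (sz_drop _ _) (Hb x)).
Qed.

Lemma FP_size_seq (l : X -> seq E) : FP l -> FP (fun x => size (l x)).
Proof.
move=> Fl; have [b Hb] := FP_size Fl.
apply: (@FP_foldr _ _ _ _ _ _ (fun x e z => z.+1) l (fun=> 0) (fun n => 2 * pb b n + 1)) => //.
- by apply: FP_S; apply: FP_prod2; apply: FP_snd.
- exact: FP_const.
- by pbd_tac.
move=> x n; rewrite -/(size _) sz_nat leq_add2r leq_mul2l /=.
by apply: leq_trans (size_le_sz _) (leq_trans (sz_drop _ _) (Hb x)).
Qed.

Lemma FP_subn (f g : X -> nat) : FP f -> FP g -> FP (fun x => f x - g x).
Proof.
move=> Ff Fg; have [b Hb] := FP_size Ff.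
have H k z : foldl (fun z (_ : unit) => z.-1) z (nseq k tt) = z - k.
  by elim: k z => [|k IH] z /=; rewrite ?subn0 // IH; lia.
apply: (@FP_eq _ _ _ _ (fun x => foldl (fun z (_ : unit) => z.-1) (f x) (nseq (g x) tt))).
  by move=> x; rewrite H.
apply: (@FP_foldl_inv _ _ _ _ _ _ (fun x z _ => z.-1) (fun x => nseq (g x) tt) f
  (fun x z => z <= f x) (pb b)) => //.
- by apply: FP_pred; apply: FP_prod2; apply: FP_snd.
- exact: FP_nseq_tt.
- exact: pbd_pb.
- by move=> x z _ le; lia.
by move=> x z le; apply: leq_trans (Hb x); rewrite !sz_nat; lia.
Qed.

Lemma FP_eq0 (f : X -> nat) : FP f -> FP (fun x => f x == 0).
Proof.
move=> Ff; apply: (@FP_eq _ _ _ _ (fun x => ~~ has (fun=> true) (nseq (f x) tt))).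
  by move=> x; case: (f x).
by apply: FP_negb; apply: (FP_has (p := fun _ _ => true)); [exact: FP_const | exact: FP_nseq_tt].
Qed.

Lemma FP_leq (f g : X -> nat) : FP f -> FP g -> FP (fun x => f x <= g x).
Proof. by move=> Ff Fg; apply: FP_eq0; apply: FP_subn. Qed.

Lemma FP_nilp (l : X -> seq E) : FP l -> FP (fun x => nilp (l x)).
Proof. by move=> Fl; apply: FP_eq0; apply: FP_size_seq. Qed.

End Lists4.

Lemma FP_addn X {eX : Enc X} (f g : X -> nat) : FP f -> FP g -> FP (fun x => f x + g x).
Proof.
move=> Ff Fg.
apply: (@FP_eq _ _ _ _ (fun x => size (nseq (f x) tt ++ nseq (g x) tt))).
  by move=> x; rewrite size_cat !size_nseq.
by apply: FP_size_seq; apply: FP_cat; apply: FP_nseq_tt.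
Qed.

Lemma FP_head X E {eX : Enc X} {eE : Enc E} (d : E) (l : X -> seq E) :
  FP l -> FP (fun x => head d (l x)).
Proof.
move=> Fl; apply: (@FP_eq _ _ _ _ (fun x => last d (rev (l x)))).
  by move=> x; case: (l x) => //= e r; rewrite rev_cons last_rcons.
by apply: FP_last; [exact: FP_const | exact: FP_rev].
Qed.

Class FPeq (V : eqType) {eV : Enc V} : Prop := FPeq_op : FP (fun p : V * V => p.1 == p.2).
Arguments FPeq V {eV}.

#[global] Instance FPeq_nat : @FPeq nat enc_nat.
Proof.
apply: (@FP_eq _ _ _ _ (fun p : nat * nat => (p.1 <= p.2) && (p.2 <= p.1))).
  by move=> p; rewrite eqn_leq.
by apply: FP_andb; apply: FP_leq; first [exact: FP_fst | exact: FP_snd].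
Qed.

#[global] Instance FPeq_bool : @FPeq bool enc_bool.
Proof. by apply: FP_eqb; [exact: FP_fst | exact: FP_snd]. Qed.

Lemma FP_eqop X (V : eqType) {eX : Enc X} {eV : Enc V} {eqV : FPeq V} (f g : X -> V) :
  FP f -> FP g -> FP (fun x => f x == g x).
Proof. by move=> Ff Fg; exact: (FP_comp (FP_pair Ff Fg) eqV). Qed.

#[global] Instance FPeq_prod (U V : eqType) {eU : Enc U} {eV : Enc V} {eqU : FPeq U} {eqV : FPeq V} :
  @FPeq (U * V)%type (@enc_prod U V eU eV).
Proof.
have F1 : FP (fun p : (U * V) * (U * V) => p.1) by exact: FP_fst.
have F2 : FP (fun p : (U * V) * (U * V) => p.2) by exact: FP_snd.
by apply: FP_andb; apply: FP_eqop; [exact: (FP_prod1 F1) | exact: (FP_prod1 F2)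
  | exact: (FP_prod2 F1) | exact: (FP_prod2 F2)].
Qed.

Lemma FP_mem X (V : eqType) {eX : Enc X} {eV : Enc V} {eqV : FPeq V} (f : X -> V) (s : X -> seq V) :
  FP f -> FP s -> FP (fun x => f x \in s x).
Proof.
move=> Ff Fs; apply: (@FP_eq _ _ _ _ (fun x => has (pred1 (f x)) (s x))).
  by move=> x; rewrite has_pred1.
apply: (FP_has (p := fun x y => y == f x)) => //.
by apply: FP_eqop; [exact: FP_snd | apply: (FP_comp FP_fst Ff)].
Qed.

Ltac fp_hook := fail.

Ltac fp_step :=
  match goal with
  | |- FP (fun x => x) => exact: FP_id
  | |- FP (fun x => ?c) => exact: FP_const
  | |- FP (fun x => (@?f x).1) => apply: (@FP_prod1 _ _ _ _ _ _ f)
  | |- FP (fun x => (@?f x).2) => apply: (@FP_prod2 _ _ _ _ _ _ f)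
  | |- FP (fun x => (@?f x, @?g x)) => apply: (@FP_pair _ _ _ _ _ _ f g)
  | |- FP (fun x => @?f x && @?g x) => apply: (@FP_andb _ _ f g)
  | |- FP (fun x => @?f x || @?g x) => apply: (@FP_orb _ _ f g)
  | |- FP (fun x => @?f x (+) @?g x) => apply: (@FP_addb _ _ f g)
  | |- FP (fun x => ~~ @?f x) => apply: (@FP_negb _ _ f)
  | |- FP (fun x => @?f x == @?g x) => apply: (@FP_eqop _ _ _ _ _ f g)
  | |- FP (fun x => @?f x \in @?g x) => apply: (@FP_mem _ _ _ _ _ f g)
  | |- FP (fun x => has (@?p x) (@?l x)) => apply: (@FP_has _ _ _ _ p l)
  | |- FP (fun x => all (@?p x) (@?l x)) => apply: (@FP_all _ _ _ _ p l)
  | |- FP (fun x => filter (@?p x) (@?l x)) => apply: (@FP_filter _ _ _ _ p l)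
  | |- FP (fun x => map (@?p x) (@?l x)) => apply: (@FP_map _ _ _ _ _ _ p l)
  | |- FP (fun x => rev (@?l x)) => apply: (@FP_rev _ _ _ _ l)
  | |- FP (fun x => last (@?d x) (@?l x)) => apply: (@FP_last _ _ _ _ d l)
  | |- FP (fun x => head ?d (@?l x)) => apply: (@FP_head _ _ _ _ d l)
  | |- FP (fun x => flatten (@?l x)) => apply: (@FP_flatten _ _ _ _ l)
  | |- FP (fun x => nilp (@?l x)) => apply: (@FP_nilp _ _ _ _ l)
  | |- FP (fun x => size (@?l x)) => apply: (@FP_size_seq _ _ _ _ l)
  | |- FP (fun x => behead (@?l x)) => apply: (@FP_behead _ _ _ _ l)
  | |- FP (fun x => @?f x :: @?g x) => apply: (@FP_cons _ _ _ _ f g)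
  | |- FP (fun x => @?f x ++ @?g x) => apply: (@FP_cat _ _ _ _ f g)
  | |- FP (fun x => (@?f x <= @?g x)%N) => apply: (@FP_leq _ _ f g)
  | |- FP (fun x => (@?f x + @?g x)%N) => apply: (@FP_addn _ _ f g)
  | |- FP (fun x => (@?f x - @?g x)%N) => apply: (@FP_subn _ _ f g)
  | |- FP (fun x => (@?f x).+1) => apply: (@FP_S _ _ f)
  | |- _ => apply: FP_if
  end.

Ltac fp := repeat (cbv beta zeta; first [assumption | fp_hook | fp_step]).

(** * The algorithm *)

Section Algorithm.
Variable V : eqType.
Implicit Types (W C T : seq V) (E M A : seq (V * V)) (st : seq V * seq (V * V)).

Definition pairs W : seq (V * V) := flatten [seq [seq (u, v) | v <- W] | u <- W].

Definition evenv st (z : V) : bool := (z \in st.1) && ((z, z) \notin st.2).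

Definition exposed W M (v : V) : bool := ~~ has (fun w => (v, w) \in M) W.

Definition frontier W E st : seq (V * V) :=
  [seq p <- pairs W | evenv st p.1 && ((p.2 \notin st.1) && (p \in E))].

Definition found W E M st : bool := has (fun p => exposed W M p.2) (frontier W E st).

(** Only ends with different odd ancestors count; an edge between even vertices with the same odd
    ancestors would turn no vertex even. *)
Definition blossoms W E st : seq (V * V) :=
  [seq p <- pairs W | ((p \in E) && (evenv st p.1 && evenv st p.2)) &&
     has (fun q => ((q, p.1) \in st.2) (+) ((q, p.2) \in st.2)) W].

(** The mate of [v] is not computed but recognised by [(v, z) \in M]. Both new vertices inherit the
    odd ancestors of [u] and get [v] as well. *)
Definition grow W M st (u v : V) : seq V * seq (V * V) :=
  ([seq z <- W | (z \in st.1) || ((z == v) || ((v, z) \in M))],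
   [seq p <- pairs W | (p \in st.2) ||
      (((p.2 == v) || ((v, p.2) \in M)) && (((p.1, u) \in st.2) || (p.1 == v)))]).

(** A vertex becomes even by losing all its pairs, the one with itself included; its descendants
    then hang below the next odd ancestor. *)
Definition mark st (x y : V) : seq V * seq (V * V) :=
  (st.1, [seq p <- st.2 | ((p.1, x) \in st.2) == ((p.1, y) \in st.2)]).

(* The state is a pair [(T, A)]: [T] is the vertex set of an alternating tree and
   [(p, z)] is in [A] when [p] is an odd vertex of [T] having [z] in its subtree. *)
Definition search_step W E M (r : V) st : seq V * seq (V * V) :=
  if found W E M st then st
  else if ~~ nilp (frontier W E st) then
    let p := last (r, r) (frontier W E st) in grow W M st p.1 p.2
  else if ~~ nilp (blossoms W E st) then
    let p := last (r, r) (blossoms W E st) in mark st p.1 p.2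
  else st.

(** The list [W ++ W] is only a clock: [potential] starts at no more than twice the number of
    vertices. *)
Definition search_state W E M (r : V) : seq V * seq (V * V) :=
  foldl (fun st _ => search_step W E M r st) ([:: r], [::]) (W ++ W).

Definition search W E M (r : V) : bool := found W E M (search_state W E M r).

(** Rematches [u] from [w] to [v]. For an exposed [u] it is called with [w = u], and no pair of the
    matching is then removed. *)
Definition swap W M (v u w : V) : seq (V * V) :=
  [seq p <- pairs W | ((p \in M) && ((p != (u, w)) && (p != (w, u)))) ||
     ((p == (v, u)) || (p == (u, v)))].

Definition remove2 C (v u : V) : seq V := [seq z <- C | (z != v) && (z != u)].

(* State [(C, (v, M))]: [v] is the exposed end of the augmenting path built so far,
   and the rest of the path is sought inside [C]. *)
Definition aug_step W E (s : seq V * (V * seq (V * V))) : seq V * (V * seq (V * V)) :=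
  let C := s.1 in let v := s.2.1 in let M := s.2.2 in
  let direct := [seq u <- C | ((v, u) \in E) && exposed C M u] in
  let via := [seq p <- pairs C | ((v, p.1) \in E) && ((p \in M) &&
                search (remove2 C v p.1) E M p.2)] in
  if ~~ nilp direct then
    let u := last v direct in ([::], (v, swap W M v u u))
  else if ~~ nilp via then
    let p := last (v, v) via in (remove2 C v p.1, (p.2, swap W M v p.1 p.2))
  else s.

Definition augment W E C (r : V) M : seq (V * V) :=
  (foldl (fun s _ => aug_step W E s) (C, (r, M)) W).2.2.

Definition maxmatch_state W E (l : seq V) : seq V * seq (V * V) :=
  foldl (fun s r =>
    let C := [seq z <- W | (z \in s.1) || (z == r)] in (C, augment W E C r s.2))
    ([::], [::]) l.

Definition maxmatch W E : seq (V * V) := (maxmatch_state W E W).2.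

End Algorithm.

Lemma mem_pairs (V : eqType) (W : seq V) p : (p \in pairs W) = (p.1 \in W) && (p.2 \in W).
Proof.
case: p => a b /=; apply/flatten_mapP/andP => [[x xW /mapP[y yW [-> ->]]]|[aW bW]] //.
by exists a => //; apply/mapP; exists b.
Qed.

Lemma last_in (T : eqType) (d : T) (s : seq T) : ~~ nilp s -> last d s \in s.
Proof. by case: s => //= x s _; apply: mem_last. Qed.

(** * The vertex cover procedure for a given string of choices *)

Section VertexCover.
Variable V : eqType.
Implicit Types (W U S : seq V) (E : seq (V * V)).

Definition dbl U : seq (bool * V) := [seq (true, u) | u <- U] ++ [seq (false, u) | u <- U].

Definition dblE U E : seq ((bool * V) * (bool * V)) :=
  [seq p <- pairs (dbl U) | (p.1.1 != p.2.1) && ((p.1.2, p.2.2) \in E)].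

(* Four times the optimum of the fractional vertex cover problem on the graph
   induced by [U]. *)
Definition lpv E U : nat := size (maxmatch (dbl U) (dblE U E)).

Definition nbrs E U (v : V) : seq V := [seq u <- U | (v, u) \in E].

(** Giving [v] the value 0 forces its neighbours into the cover, at 4 units of [lpv] each; the value
    1 costs 4 units. An equality says that this choice is optimal for the fractional problem, hence
    free. When bits run out the vertex is skipped, and the final check may reject the result. *)
Definition vc_step W E (s : seq V * (seq V * bitseq)) (v : V) : seq V * (seq V * bitseq) :=
  let U := s.1 in let S := s.2.1 in let b := s.2.2 in
  let U0 := [seq u <- U | (u != v) && ((v, u) \notin E)] in
  let U1 := [seq u <- U | u != v] in
  let S0 := [seq u <- W | (u \in S) || (u \in nbrs E U v)] in
  let S1 := [seq u <- W | (u \in S) || (u == v)] in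
  let k := size (nbrs E U v) in
  if v \in U then
    if lpv E U == lpv E U0 + (k + k + (k + k)) then (U0, (S0, b))
    else if lpv E U == lpv E U1 + 4 then (U1, (S1, b))
    else if nilp b then s
    else if head false b then (U1, (S1, behead b)) else (U0, (S0, behead b))
  else s.

Definition vc_run W E (b : bitseq) : seq V :=
  (foldl (vc_step W E) (W, ([::], b)) W).2.1.

(** The budget is read off the length of the string: [2k] bits and [size (maxmatch W E) = 2 mu] turn
    the last test into [size S <= mu + k]. *)
Definition vc_accept W E (b : bitseq) : bool :=
  let S := vc_run W E b in
  all (fun p => (p.1 \in S) || (p.2 \in S)) E &&
  (size S + size S <= size (maxmatch W E) + size b).

End VertexCover.

(** * Polynomial-time computability of the matching and covering procedures *)

Ltac fp_ctx := match goal with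
  | H : FP ?g |- FP (fun q => ?g (@?f q)) => apply: (@FP_comp _ _ _ _ _ _ g f _ H)
  end.
Ltac fp_hook ::= fp_ctx.

Lemma sz_mem (V : eqType) {eV : Enc V} (x : V) (s : seq V) : x \in s -> sz x <= sz s.
Proof.
by elim: s => //= y s IH; rewrite inE sz_cons => /predU1P[->|/IH]; lia.
Qed.

Section AlgorithmFP.
Context {V : eqType} {eV : Enc V} {eqV : FPeq V} {X : Type} {eX : Enc X}.
Implicit Types (W C : X -> seq V) (E M : X -> seq (V * V)) (u v w r : X -> V).
Implicit Types (st : X -> seq V * seq (V * V)).

Lemma FP_pairs W : FP W -> FP (fun x => pairs (W x)).
Proof. by move=> FW; rewrite /pairs; fp. Qed.

Lemma FP_evenv st z : FP st -> FP z -> FP (fun x => evenv (st x) (z x)).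
Proof. by move=> Fst Fz; rewrite /evenv; fp. Qed.

Lemma FP_exposed W M v : FP W -> FP M -> FP v -> FP (fun x => exposed (W x) (M x) (v x)).
Proof. by move=> FW FM Fv; rewrite /exposed; fp. Qed.

Lemma FP_remove2 C v u : FP C -> FP v -> FP u -> FP (fun x => remove2 (C x) (v x) (u x)).
Proof. by move=> FC Fv Fu; rewrite /remove2; fp. Qed.

Lemma FP_mark st u v : FP st -> FP u -> FP v -> FP (fun x => mark (st x) (u x) (v x)).
Proof. by move=> Fst Fu Fv; rewrite /mark; fp. Qed.

End AlgorithmFP.

Ltac fp_hook ::= first [ fp_ctx |
  match goal with
  | |- FP (fun x => pairs (@?W x)) => apply: (FP_pairs (W := W))
  | |- FP (fun x => evenv (@?s x) (@?z x)) => apply: (@FP_evenv _ _ _ _ _ s z)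
  | |- FP (fun x => exposed (@?s x) (@?z x) (@?v x)) => apply: (@FP_exposed _ _ _ _ _ s z v)
  | |- FP (fun x => remove2 (@?s x) (@?z x) (@?v x)) => apply: (@FP_remove2 _ _ _ _ _ s z v)
  | |- FP (fun x => mark (@?s x) (@?z x) (@?v x)) => apply: (@FP_mark _ _ _ _ _ s z v)
  end ].

Section AlgorithmFP2.
Context {V : eqType} {eV : Enc V} {eqV : FPeq V} {X : Type} {eX : Enc X}.
Implicit Types (W C : X -> seq V) (E M : X -> seq (V * V)) (u v w r : X -> V).
Implicit Types (st : X -> seq V * seq (V * V)).

Lemma FP_frontier W E st : FP W -> FP E -> FP st -> FP (fun x => frontier (W x) (E x) (st x)).
Proof. by move=> FW FE Fst; rewrite /frontier; fp. Qed.

Lemma FP_blossoms W E st : FP W -> FP E -> FP st -> FP (fun x => blossoms (W x) (E x) (st x)).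
Proof. by move=> FW FE Fst; rewrite /blossoms; fp. Qed.

Lemma FP_grow W M st u v : FP W -> FP M -> FP st -> FP u -> FP v ->
  FP (fun x => grow (W x) (M x) (st x) (u x) (v x)).
Proof. by move=> FW FM Fst Fu Fv; rewrite /grow; fp. Qed.

Lemma FP_swap W M v u w : FP W -> FP M -> FP v -> FP u -> FP w ->
  FP (fun x => swap (W x) (M x) (v x) (u x) (w x)).
Proof. by move=> FW FM Fv Fu Fw; rewrite /swap; fp. Qed.

Lemma FP_found W E M st : FP W -> FP E -> FP M -> FP st ->
  FP (fun x => found (W x) (E x) (M x) (st x)).
Proof.
move=> FW FE FM Fst; rewrite /found; have := FP_frontier FW FE Fst => FF.
by apply: (FP_has (p := fun x p => exposed (W x) (M x) p.2)) => //; fp.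
Qed.

End AlgorithmFP2.

Ltac fp_hook ::= first [ fp_ctx |
  match goal with
  | |- FP (fun x => pairs (@?W x)) => apply: (FP_pairs (W := W))
  | |- FP (fun x => evenv (@?s x) (@?z x)) => apply: (@FP_evenv _ _ _ _ _ s z)
  | |- FP (fun x => exposed (@?s x) (@?z x) (@?v x)) => apply: (@FP_exposed _ _ _ _ _ s z v)
  | |- FP (fun x => remove2 (@?s x) (@?z x) (@?v x)) => apply: (@FP_remove2 _ _ _ _ _ s z v)
  | |- FP (fun x => mark (@?s x) (@?z x) (@?v x)) => apply: (@FP_mark _ _ _ _ _ s z v)
  | |- FP (fun x => frontier (@?s x) (@?z x) (@?v x)) => apply: (@FP_frontier _ _ _ _ _ s z v)
  | |- FP (fun x => blossoms (@?s x) (@?z x) (@?v x)) => apply: (@FP_blossoms _ _ _ _ _ s z v)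
  | |- FP (fun x => grow (@?a x) (@?b x) (@?c x) (@?d x) (@?e x)) =>
      apply: (@FP_grow _ _ _ _ _ a b c d e)
  | |- FP (fun x => swap (@?a x) (@?b x) (@?c x) (@?d x) (@?e x)) =>
      apply: (@FP_swap _ _ _ _ _ a b c d e)
  | |- FP (fun x => found (@?a x) (@?b x) (@?c x) (@?d x)) => apply: (@FP_found _ _ _ _ _ a b c d)
  end ].

Section AlgorithmFP3.
Context {V : eqType} {eV : Enc V} {eqV : FPeq V} {X : Type} {eX : Enc X}.
Implicit Types (W C : X -> seq V) (E M : X -> seq (V * V)) (u v w r : X -> V).

Lemma FP_search_step W E M r (st : X -> seq V * seq (V * V)) :
  FP W -> FP E -> FP M -> FP r -> FP st ->
  FP (fun x => search_step (W x) (E x) (M x) (r x) (st x)).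
Proof. by move=> FW FE FM Fr Fst; rewrite /search_step; fp. Qed.

End AlgorithmFP3.

Section AlgorithmFP4.
Context {V : eqType} {eV : Enc V} {eqV : FPeq V} {X : Type} {eX : Enc X}.
Implicit Types (W C : X -> seq V) (E M : X -> seq (V * V)) (u v w r : X -> V).

Lemma FP_search_state W E M r : FP W -> FP E -> FP M -> FP r ->
  FP (fun x => search_state (W x) (E x) (M x) (r x)).
Proof.
move=> FW FE FM Fr; have FWW : FP (fun x => pairs (W x)) by fp.
have [b Hb] := FP_size FW; have [c Hc] := FP_size Fr; have [d Hd] := FP_size FWW.
(* After a growth step both lists are filters of [W] and [pairs W], and marking only shrinks the
   second. The term in [r x] covers the initial tree [[:: r]]. *)
apply: (@FP_foldl_inv _ _ _ _ _ _ (fun x st _ => search_step (W x) (E x) (M x) (r x) st)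
  (fun x => W x ++ W x) (fun x => ([:: r x], [::]))
  (fun x st => sz st.1 <= sz (W x) + sz (r x) + 2 /\ sz st.2 <= sz (pairs (W x)))
  (fun n => pb b n + pb c n + 2 + pb d n + 1)).
- cbv beta; apply: FP_search_step; fp.
- by fp.
- by fp.
- by pbd_tac.
- move=> x /=; rewrite sz_cons sz_nil; split; first by lia.
  exact: tsz_gt0.
- move=> x st _ [I1 I2]; rewrite /search_step; case: ifP => _ //; case: ifP => _.
    rewrite /grow /=; split; last exact: sz_filter.
    by rewrite -addnA; apply: leq_trans (leq_addr _ _); apply: sz_filter.
  case: ifP => _ //; split => //=.
  exact: leq_trans (sz_filter _ _) I2.
- move=> x [T A] [/= I1 I2]; rewrite sz_pair.
  have := Hb x; have := Hc x; have := Hd x; lia.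
Qed.

Lemma FP_search W E M r : FP W -> FP E -> FP M -> FP r ->
  FP (fun x => search (W x) (E x) (M x) (r x)).
Proof.
by move=> FW FE FM Fr; apply: FP_found => //; apply: FP_search_state.
Qed.

End AlgorithmFP4.

Ltac fp_hook_search := first [ fp_ctx |
  match goal with
  | |- FP (fun x => pairs (@?W x)) => apply: (FP_pairs (W := W))
  | |- FP (fun x => exposed (@?s x) (@?z x) (@?v x)) => apply: (@FP_exposed _ _ _ _ _ s z v)
  | |- FP (fun x => remove2 (@?s x) (@?z x) (@?v x)) => apply: (@FP_remove2 _ _ _ _ _ s z v)
  | |- FP (fun x => swap (@?a x) (@?b x) (@?c x) (@?d x) (@?e x)) =>
      apply: (@FP_swap _ _ _ _ _ a b c d e)
  | |- FP (fun x => search (@?a x) (@?b x) (@?c x) (@?d x)) => apply: (@FP_search _ _ _ _ _ a b c d)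
  end ].
Ltac fp_hook ::= fp_hook_search.

Section AlgorithmFP5.
Context {V : eqType} {eV : Enc V} {eqV : FPeq V} {X : Type} {eX : Enc X}.
Implicit Types (W C : X -> seq V) (E M : X -> seq (V * V)) (u v w r : X -> V).

Lemma FP_aug_step W E (s : X -> seq V * (V * seq (V * V))) :
  FP W -> FP E -> FP s -> FP (fun x => aug_step (W x) (E x) (s x)).
Proof. by move=> FW FE Fs; rewrite /aug_step; fp. Qed.

End AlgorithmFP5.

Section AlgorithmFP6.
Context {V : eqType} {eV : Enc V} {eqV : FPeq V} {X : Type} {eX : Enc X}.
Implicit Types (W C : X -> seq V) (E M : X -> seq (V * V)) (u v w r : X -> V).

Lemma FP_augment W E C r M : FP W -> FP E -> FP C -> FP r -> FP M ->
  FP (fun x => augment (W x) (E x) (C x) (r x) (M x)).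
Proof.
move=> FW FE FC Fr FM; rewrite /augment.
have FWW : FP (fun x => pairs (W x)) by fp.
have [b Hb] := FP_size FC; have [c Hc] := FP_size Fr; have [d Hd] := FP_size FM.
have [e He] := FP_size FWW.
apply: FP_prod2; apply: FP_prod2.
apply: (@FP_foldl_inv _ _ _ _ _ _ (fun x s _ => aug_step (W x) (E x) s)
  W (fun x => (C x, (r x, M x)))
  (fun x s => [/\ sz s.1 <= sz (C x), sz s.2.1 <= sz (C x) + sz (r x)
      & sz s.2.2 <= sz (M x) + sz (pairs (W x))])
  (fun n => (pb b n + (pb b n + pb c n + (pb d n + pb e n)).+1).+1)).
- cbv beta; apply: FP_aug_step; fp.
- by fp.
- by fp.
- by pbd_tac.
- by move=> x /=; split; lia.
- move=> x [D [v N]] _ /= [I1 I2 I3]; rewrite /aug_step /=.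
  have sw (v' u w : V) : sz (swap (W x) N v' u w) <= sz (M x) + sz (pairs (W x)).
    by apply: leq_trans (leq_addl _ _); apply: sz_filter.
  case: ifP => _.
    by split => //; [exact: tsz_gt0 | exact: sw].
  case: ifP => [h|_] //; split => //=.
    by apply: leq_trans I1; apply: sz_filter.
  have := last_in (v, v) h; set q := last _ _; rewrite mem_filter mem_pairs.
  by move=> /and3P[_ _ /sz_mem] ; lia.
- move=> x [D [v N]] [/= I1 I2 I3]; rewrite !sz_pair.
  have := Hb x; have := Hc x; have := Hd x; have := He x; lia.
Qed.
End AlgorithmFP6.

Lemma sz_augment (V : eqType) {eV : Enc V} (W : seq V) E C r M B :
  sz M <= B -> sz (pairs W) <= B -> sz (augment W E C r M) <= B.
Proof.
move=> MB WB; rewrite /augment.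
elim: {2}W (C, (r, M)) (MB : sz (C, (r, M)).2.2 <= B) => //= _ l IH s sB.
apply: IH; rewrite /aug_step; case: ifP => _ /=; last case: ifP => _ //=.
all: exact: leq_trans (sz_filter _ _) WB.
Qed.

Section AlgorithmFP7.
Context {V : eqType} {eV : Enc V} {eqV : FPeq V} {X : Type} {eX : Enc X}.
Implicit Types (W C U : X -> seq V) (E M : X -> seq (V * V)) (u v w r : X -> V).

Lemma FP_maxmatch W E : FP W -> FP E -> FP (fun x => maxmatch (W x) (E x)).
Proof.
move=> FW FE; rewrite /maxmatch /maxmatch_state.
have FWW : FP (fun x => pairs (W x)) by fp.
have [b Hb] := FP_size FW; have [e He] := FP_size FWW.
apply: FP_prod2.
apply: (@FP_foldl_inv _ _ _ _ _ _ (fun x s (r : V) =>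
    ([seq z <- W x | (z \in s.1) || (z == r)],
     augment (W x) (E x) [seq z <- W x | (z \in s.1) || (z == r)] r s.2))
  W (fun x => ([::], [::]))
  (fun x s => sz s.1 <= sz (W x) /\ sz s.2 <= sz (pairs (W x)))
  (fun n => (pb b n + pb e n).+1)).
- cbv beta; apply: FP_pair; first by fp.
  by apply: FP_augment; fp.
- by fp.
- by fp.
- by pbd_tac.
- by move=> x; split; exact: tsz_gt0.
- move=> x [D N] r [/= I1 I2]; split; first exact: sz_filter.
  exact: sz_augment.
- move=> x [D N] [/= I1 I2]; rewrite !sz_pair.
  have := Hb x; have := He x; lia.
Qed.

End AlgorithmFP7.

Section VertexCoverFP.
Context {V : eqType} {eV : Enc V} {eqV : FPeq V} {X : Type} {eX : Enc X}.
Implicit Types (W C U : X -> seq V) (E M : X -> seq (V * V)) (u v w r : X -> V).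

Lemma FP_dbl U : FP U -> FP (fun x => dbl (U x)).
Proof. by move=> FU; rewrite /dbl; fp. Qed.

End VertexCoverFP.

Section VertexCoverFP2.
Context {V : eqType} {eV : Enc V} {eqV : FPeq V} {X : Type} {eX : Enc X}.
Implicit Types (W C U : X -> seq V) (E M : X -> seq (V * V)) (u v w r : X -> V).

Lemma FP_dblE U E : FP U -> FP E -> FP (fun x => dblE (U x) (E x)).
Proof. by move=> FU FE; have FD := FP_dbl FU; rewrite /dblE; fp. Qed.

Lemma FP_nbrs E U v : FP U -> FP E -> FP v -> FP (fun x => nbrs (E x) (U x) (v x)).
Proof. by move=> FU FE Fv; rewrite /nbrs; fp. Qed.

End VertexCoverFP2.

Section VertexCoverFP3.
Context {V : eqType} {eV : Enc V} {eqV : FPeq V} {X : Type} {eX : Enc X}.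
Implicit Types (W C U : X -> seq V) (E M : X -> seq (V * V)) (u v w r : X -> V).

Lemma FP_lpv E U : FP E -> FP U -> FP (fun x => lpv (E x) (U x)).
Proof.
move=> FE FU; rewrite /lpv; apply: FP_size_seq; apply: FP_maxmatch.
  exact: FP_dbl.
exact: FP_dblE.
Qed.

End VertexCoverFP3.

Ltac fp_hook ::= first [ fp_ctx |
  match goal with
  | |- FP (fun x => pairs (@?W x)) => apply: (FP_pairs (W := W))
  | |- FP (fun x => lpv (@?E x) (@?U x)) => apply: (FP_lpv (E := E) (U := U))
  | |- FP (fun x => nbrs (@?E x) (@?U x) (@?v x)) => apply: (FP_nbrs (E := E) (U := U) (v := v))
  | |- FP (fun x => maxmatch (@?W x) (@?E x)) => apply: (FP_maxmatch (E := E) (W := W))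
  end ].

Section VertexCoverFP4.
Context {V : eqType} {eV : Enc V} {eqV : FPeq V} {X : Type} {eX : Enc X}.
Implicit Types (W C U : X -> seq V) (E M : X -> seq (V * V)) (u v w r : X -> V).

Lemma FP_vc_step W E (s : X -> seq V * (seq V * bitseq)) v :
  FP W -> FP E -> FP s -> FP v -> FP (fun x => vc_step (W x) (E x) (s x) (v x)).
Proof. by move=> FW FE Fs Fv; rewrite /vc_step; fp. Qed.

End VertexCoverFP4.

Section VertexCoverFP5.
Context {V : eqType} {eV : Enc V} {eqV : FPeq V} {X : Type} {eX : Enc X}.
Implicit Types (W C U : X -> seq V) (E M : X -> seq (V * V)) (u v w r : X -> V).

Lemma sz_behead A {eA : Enc A} (s : seq A) : sz (behead s) <= sz s.
Proof. by case: s => //= x s; rewrite sz_cons; lia. Qed.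

Lemma FP_vc_run W E (b : X -> bitseq) : FP W -> FP E -> FP b ->
  FP (fun x => vc_run (W x) (E x) (b x)).
Proof.
move=> FW FE Fb; rewrite /vc_run.
have [c Hc] := FP_size FW; have [d Hd] := FP_size Fb.
apply: FP_prod1; apply: FP_prod2.
apply: (@FP_foldl_inv _ _ _ _ _ _ (fun x => vc_step (W x) (E x))
  W (fun x => (W x, ([::], b x)))
  (fun x s => [/\ sz s.1 <= sz (W x), sz s.2.1 <= sz (W x) & sz s.2.2 <= sz (b x)])
  (fun n => (pb c n + (pb c n + pb d n).+1).+1)).
- by cbv beta; apply: FP_vc_step; fp.
- by fp.
- by fp.
- by pbd_tac.
- by move=> x; split => //; exact: tsz_gt0.
- move=> x [U [S f]] v [/= I1 I2 I3]; rewrite /vc_step /=.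
  have i1 (p : pred V) : sz (filter p U) <= sz (W x) by apply: leq_trans (sz_filter _ _) I1.
  have i2 (p : pred V) : sz (filter p (W x)) <= sz (W x) by exact: sz_filter.
  have i3 := leq_trans (sz_behead f) I3.
  by repeat case: ifP => _; split => //=; first [exact: i1 | exact: i2].
- move=> x [U [S f]] [/= I1 I2 I3]; rewrite !sz_pair.
  have := Hc x; have := Hd x; lia.
Qed.

Lemma FP_vc_accept W E (b : X -> bitseq) : FP W -> FP E -> FP b ->
  FP (fun x => vc_accept (W x) (E x) (b x)).
Proof.
move=> FW FE Fb; have FS := FP_vc_run FW FE Fb; rewrite /vc_accept.
pose S x := vc_run (W x) (E x) (b x); rewrite -/S in FS.
apply: (FP_eq (f := fun x => all (fun p => (p.1 \in S x) || (p.2 \in S x)) (E x) &&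
  (size (S x) + size (S x) <= size (maxmatch (W x) (E x)) + size (b x)))) => //.
by fp.
Qed.

End VertexCoverFP5.

(** * Alternating trees *)

Section Counting.
Variables (V : eqType) (W : seq V).
Hypothesis uW : uniq W.
Implicit Types (a b c : pred V) (x : V).

Lemma count_split a b : count a W = count (predI a b) W + count (predD a b) W.
Proof. by elim: W => //= z s ->; case: (a z); case: (b z) => /=; lia. Qed.

Lemma count_D1 a x : x \in W -> a x -> count a W = (count (fun z => a z && (z != x)) W).+1.
Proof.
move=> xW ax; rewrite (count_split a (pred1 x)) -add1n; congr (_ + _).
  rewrite (@eq_count _ _ (pred1 x)); first by rewrite count_uniq_mem // xW.
  by move=> z /=; case: eqP => [->|]; rewrite ?ax ?andbF.
by apply: eq_count => z /=; rewrite andbC.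
Qed.

Lemma count_le a b : (forall z, z \in W -> a z -> b z) -> count a W <= count b W.
Proof.
move=> ab; rewrite -!size_filter; apply: uniq_leq_size; first exact: filter_uniq.
by move=> z; rewrite !mem_filter => /andP[/ab h zW]; rewrite h.
Qed.

Lemma count_lt a b x : (forall z, a z -> b z) -> x \in W -> b x -> ~~ a x ->
  count a W < count b W.
Proof.
move=> ab xW bx nax; rewrite (count_D1 xW bx) ltnS; apply: count_le => z _ az.
by rewrite ab //; apply: contraNneq nax => <-.
Qed.

Lemma count_disj a b c : (forall z, a z -> c z) -> (forall z, b z -> c z) ->
  (forall z, a z -> ~~ b z) -> count a W + count b W <= count c W.
Proof.
move=> ac bc ab; rewrite (count_split c a); apply: leq_add; apply: count_le => z _ /=.
  by move=> az; rewrite ac.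
by move=> bz; rewrite bc // andbT; apply: contraL bz => /ab.
Qed.

Lemma count_inj a b (f : V -> V) : (forall z, a z -> b (f z) /\ f z \in W) ->
  {in a &, injective f} -> count a W <= count b W.
Proof.
move=> ab inj; rewrite -!size_filter -(size_map f); apply: uniq_leq_size.
  rewrite map_inj_in_uniq ?filter_uniq // => x y.
  by rewrite !mem_filter => /andP[ax _] /andP[ay _]; apply: inj.
move=> z /mapP[x]; rewrite mem_filter => /andP[ax _] ->.
by have [h1 h2] := ab x ax; rewrite mem_filter h1.
Qed.

End Counting.

(** * Perfect matchings of vertex sets *)

Section PerfectMatching.
Variables (V : eqType) (e : rel V).
Hypotheses (esym : symmetric e) (eirr : irreflexive e).
Implicit Types (R Y : pred V).

(** A perfect matching of the subgraph induced by [R], given as an involution on [R]; the values of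
    [f] outside [R] are arbitrary. *)
Definition pm R : Prop :=
  exists f : V -> V, forall z, R z -> [/\ R (f z), e z (f z) & f (f z) = z].

Lemma pm_eq R R' : R =1 R' -> pm R -> pm R'.
Proof. by move=> RR [f H]; exists f => z; rewrite -!RR; apply: H. Qed.

Lemma pm0 R : (forall z, ~~ R z) -> pm R.
Proof. by move=> R0; exists id => z; rewrite (negbTE (R0 z)). Qed.

Lemma pm2 x y : e x y -> pm (fun z => (z == x) || (z == y)).
Proof.
move=> exy; have xy : x != y by apply: contraTneq exy => ->; rewrite eirr.
exists (fun z => if z == x then y else x) => z /orP[/eqP->|/eqP->].
  by rewrite eqxx [y == x]eq_sym (negbTE xy) eqxx orbT.
by rewrite [y == x]eq_sym (negbTE xy) !eqxx esym.
Qed.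

Lemma pmU R1 R2 : pm R1 -> pm R2 -> (forall z, R1 z -> ~~ R2 z) ->
  pm (fun z => R1 z || R2 z).
Proof.
move=> [f1 H1] [f2 H2] dis; exists (fun z => if R1 z then f1 z else f2 z) => z.
case: ifP => [/[dup] r1 /H1[a b c] _|nr /= /H2[a b c]]; first by rewrite a c.
have n2 : R1 (f2 z) = false by apply/negP => /dis; rewrite a.
by rewrite n2 a b c.
Qed.

Lemma pm_odd (W : seq V) R : uniq W -> (forall z, R z -> z \in W) -> pm R ->
  ~~ odd (count R W).
Proof.
move=> uW; move: {2}(count R W) (leqnn (count R W)) => n.
elim/ltn_ind: n R => n IH R le sub P.
case h : (has R W); last by move: h; rewrite has_count; case: (count _ _).
case/hasP: h => x xW Rx; case: P => f H; have [Rf ef ff] := H x Rx.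
have xf : f x != x by apply: contraTneq ef => ->; rewrite eirr.
have E1 := count_D1 uW xW Rx.
have E2 := @count_D1 _ W uW (fun z => R z && (z != x)) (f x) (sub _ Rf).
rewrite Rf xf in E2; rewrite E1 E2 //= negbK.
apply: (IH n.-2) => //.
- by have := E2 isT; lia.
- by have := E2 isT; lia.
- by move=> z /andP[/andP[/sub]].
exists f => z /andP[/andP[Rz zx] zfx]; have [a b c] := H z Rz.
rewrite a b c; split => //=; apply/andP; split.
  by apply: contraNneq zfx => <-; rewrite c.
by apply: contraNneq zx => h; rewrite -c h ff.
Qed.

End PerfectMatching.

(** * The invariant of an uncontracted alternating tree *)

Section Matchings.
Variables (V : eqType) (e : rel V) (W : seq V).
Hypotheses (esym : symmetric e) (eirr : irreflexive e) (uW : uniq W).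

Definition matching (M : rel V) : Prop :=
  (forall x y, M x y -> [/\ x \in W, y \in W, e x y & M y x]) /\
  (forall x y z, M x y -> M x z -> y = z).

Definition cov (M : rel V) (x : V) : bool := has (M x) W.

Lemma covP (M : rel V) x : matching M -> reflect (exists y, M x y) (cov M x).
Proof.
move=> [mM _]; apply: (iffP hasP) => [[y _ My]|[y My]]; first by exists y.
by exists y => //; case: (mM _ _ My).
Qed.

Lemma pm_closed (M : rel V) (R : pred V) : matching M ->
  (forall z, R z -> exists2 w, M z w & R w) -> pm e R.
Proof.
move=> mM H; have [mM1 mM2] := mM.
exists (fun z => nth z W (find (M z) W)) => z Rz; have [w Mzw Rw] := H z Rz.
have key x y : M x y -> nth x W (find (M x) W) = y.
  by move=> Mxy; apply: (mM2 x) => //; apply: nth_find; apply/(covP _ mM); exists y.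
have [_ _ ezw Mwz] := mM1 _ _ Mzw.
by rewrite (key _ _ Mzw) (key _ _ Mwz).
Qed.

Lemma pm_cov (M : rel V) : matching M -> pm e (cov M).
Proof.
move=> mM; apply: pm_closed (mM) _ => z /(covP _ mM)[w Mzw]; exists w => //.
by apply/(covP _ mM); exists z; case: (mM.1 _ _ Mzw).
Qed.

Section Inv.
Variables (M : rel V) (r : V).
Hypotheses (mM : matching M) (rW : r \in W) (rexp : ~~ cov M r).
Implicit Types (T : pred V) (A : rel V) (b : option V) (Q : pred V).

(* The part of an alternating tree at and below [b], the odd vertex [b] excluded,
   with the subtrees of the vertices of [Q] cut off. *)
Definition region T A b Q (z : V) : bool :=
  [&& T z, (if b is Some p then A p z && (z != p) else true)
    & ~~ has (fun q => Q q && A q z) W].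

(** [inv_pm] is the heart: every region becomes perfectly matched once one of its even vertices is
    deleted. With [b = None] and nothing cut off it says that the exposed end of the tree can be
    moved to any even vertex. Arbitrary [b] and [Q] are allowed because turning an odd vertex even
    splits its region at that vertex. By [inv_chain] the odd ancestors of a vertex form a chain, and
    by [inv_mate] each odd vertex has an even companion with the same odd ancestors, so the class of
    even vertices below it is not empty. *)
Record inv T A : Prop := Inv {
  invT : T r;
  invW : forall z, T z -> z \in W;
  invA : forall p z, A p z -> T p /\ T z;
  inv_odd : forall p z, A p z -> A p p;
  inv_trans : forall q p z, A q p -> A p z -> A q z;
  inv_anti : forall p q, A p q -> A q p -> p = q;
  inv_chain : forall p q z, A p z -> A q z -> A p q \/ A q p;
  invM : forall z, T z -> z != r -> exists2 w, M z w & T w;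
  inv_r : forall p, ~~ A p r;
  inv_mate : forall p, A p p -> exists w, [/\ T w, ~~ A w w & forall q, A q w = A q p];
  inv_pm : forall b Q x, region T A b Q x -> ~~ A x x ->
    pm e (fun z => region T A b Q z && (z != x)) }.

Lemma regionP T A b Q z : inv T A -> reflect
  [/\ T z, (forall p, b = Some p -> A p z /\ z <> p) & forall q, Q q -> ~~ A q z]
  (region T A b Q z).
Proof.
move=> I; apply: (iffP and3P) => [[Tz bz /hasPn Qz]|[Tz bz Qz]]; split => //.
- by move=> p bE; move: bz; rewrite bE => /andP[-> /eqP].
- move=> q Qq; apply/negP => Aqz.
  have qW : q \in W by apply: (invW I); case: (invA I Aqz).
  by have := Qz _ qW; rewrite Qq Aqz.
- by case: b bz => // p /(_ _ erefl)[-> /eqP].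
- by apply/hasPn => q _; rewrite negb_and orbC -implybE; apply/implyP => Aqz; apply: contraL Aqz => /Qz.
Qed.

Lemma inv_init T : T =1 pred1 r -> inv T (fun _ _ => false).
Proof.
move=> TE; split => //=.
- by rewrite TE /= eqxx.
- by move=> z; rewrite TE => /eqP->.
- by move=> z; rewrite TE => /eqP ->; rewrite eqxx.
- move=> b Q x xR _; apply: pm0 => z; apply/negP => /andP[].
  by move: xR; rewrite /region !TE => /andP[/= /eqP-> _] /andP[/= /eqP-> _]; rewrite eqxx.
Qed.

(** [T] is closed under mates except at the exposed root, so the mate [w] of the new vertex [v] is
    new too. Both hang below [u], with [v] odd and [w] even. *)
Lemma inv_grow T A T' A' u v w : inv T A ->
  T u -> ~~ A u u -> ~~ T v -> v \in W -> e u v -> M v w ->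
  (forall z, T' z = [|| T z, z == v | z == w]) ->
  (forall p z, A' p z = A p z || ((z == v) || (z == w)) && (A p u || (p == v))) ->
  inv T' A' /\ ~~ T w.
Proof.
move=> I Tu Eu nTv vW euv Mvw T'E A'E.
have [_ wW evw Mwv] := mM.1 _ _ Mvw.
have vw : v != w by apply: contraTneq evw => ->; rewrite eirr.
have wr : w != r by apply: contraNneq rexp => <-; apply/(covP _ mM); exists v.
have nTw : ~~ T w.
  apply: contra nTv => Tw; have [x Mwx Tx] := invM I Tw wr.
  by rewrite (mM.2 _ _ _ Mwv Mwx).
have TA p z : A p z -> T p && T z by case/(invA I) => -> ->.
have nAv p : A p v = false by apply/negP => /TA /andP[_]; apply/negP.
have nAw p : A p w = false by apply/negP => /TA /andP[_]; apply/negP.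
have nA1 p : A v p = false by apply/negP => /TA /andP[/(negP nTv)].
have nA2 p : A w p = false by apply/negP => /TA /andP[/(negP nTw)].
have uv : u != v by apply: contraNneq nTv => <-.
have uw : u != w by apply: contraNneq nTw => <-.
have A'T p z : T z -> A' p z = A p z.
  move=> Tz; rewrite A'E; case: eqP => [zv|_]; first by rewrite -zv Tz in nTv.
  by case: eqP => [zw|_]; [rewrite -zw Tz in nTw | rewrite /= orbF].
have A'v p : A' p v = A p u || (p == v) by rewrite A'E nAv eqxx.
have A'w p : A' p w = A p u || (p == v) by rewrite A'E nAw eqxx orbT.
have T'T z : T z -> T' z by rewrite T'E => ->.
have T'c z : T' z -> [\/ T z, z = v | z = w].
  by rewrite T'E => /or3P[h|/eqP h|/eqP h]; [constructor 1|constructor 2|constructor 3].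
have A'odd p z : A' p z -> p = v \/ A p p.
  rewrite A'E => /orP[/(inv_odd I)|/andP[_ /orP[/(inv_odd I)|/eqP]]]; by auto.
have T'v : T' v by rewrite T'E eqxx orbT.
have T'w : T' w by rewrite T'E eqxx !orbT.
have T'vE z : ~~ T z -> T' z -> (z == v) || (z == w) by rewrite T'E => /negbTE ->.
split => //; split.
- by apply: T'T; exact: invT I.
- by move=> z /T'c[/(invW I)|->|->].
- move=> p z; rewrite A'E => /orP[/(invA I)[/T'T ? /T'T]|/andP[zz /orP[/(invA I)[/T'T ? _]|/eqP->]]] //.
    by split => //; case/orP: zz => /eqP ->.
  by split => //; case/orP: zz => /eqP ->.
- move=> p z /A'odd[->|App]; first by rewrite A'v eqxx orbT.
  by rewrite A'E App.
- move=> q p z Aqp; rewrite [A' p z]A'E => /orP[Apz|/andP[zz pu]].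
    have [Tp Tz] := invA I Apz; rewrite A'T // in Aqp.
    by rewrite A'T // (inv_trans I Aqp Apz).
  suff h : A q u || (q == v) by rewrite A'E zz h orbT.
  case/orP: pu => [Apu|/eqP pv]; last by rewrite pv A'v in Aqp.
  have [Tp _] := invA I Apu; rewrite A'T // in Aqp.
  by rewrite (inv_trans I Aqp Apu).
- have key p : A' p v -> A' v p -> p = v.
    move=> h /[dup]; rewrite A'E nA1 /= => /andP[/orP[/eqP//|/eqP pw] _] _.
    by move: h; rewrite A'v pw nA2 eq_sym (negbTE vw).
  move=> p q pq qp.
  have [pv|Ap] := A'odd _ _ pq; first by subst p; rewrite (key _ qp pq).
  have [qv|Aq] := A'odd _ _ qp; first by subst q; rewrite (key _ pq qp).
  have [Tp _] := invA I Ap; have [Tq _] := invA I Aq.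
  by apply: (inv_anti I); rewrite -A'T.
- move=> p q z; rewrite A'E [A' q z]A'E => /orP[Ap|/andP[zz Ap]] /orP[Aq|/andP[zz' Aq]].
  + have [Tp _] := invA I Ap; have [Tq _] := invA I Aq.
    by rewrite !A'T //; apply: (inv_chain I) Ap Aq.
  + have [_ Tz] := invA I Ap.
    by case/orP: zz' Tz => /eqP->; rewrite ?(negbTE nTv) ?(negbTE nTw).
  + have [_ Tz] := invA I Aq.
    by case/orP: zz Tz => /eqP->; rewrite ?(negbTE nTv) ?(negbTE nTw).
  case/orP: Ap => [Ap|/eqP->]; last by rewrite [A' q v]A'v Aq; right.
  case/orP: Aq => [Aq|/eqP->]; last by rewrite [A' p v]A'v Ap; left.
  have [Tp _] := invA I Ap; have [Tq _] := invA I Aq.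
  by rewrite !A'T //; apply: (inv_chain I) Ap Aq.
- move=> z /T'c[Tz|->|->] zr; last by exists v.
    by have [x Mx Tx] := invM I Tz zr; exists x => //; apply: T'T.
  by exists w.
- by move=> p; rewrite A'T ?(inv_r I) //; exact: invT I.
- move=> p /A'odd[->|App].
    exists w; split => //; first by rewrite A'w nA2 eq_sym (negbTE vw).
    by move=> q; rewrite A'w A'v.
  have [x [Tx nx xE]] := inv_mate I App; have [Tp _] := invA I App.
  by exists x; split; [exact: T'T | rewrite A'T | move=> q; rewrite !A'T].
move=> b Q x /and3P[T'x bx Qx] nx.
have reg z : T z -> (forall p, b = Some p -> T p) -> region T' A' b Q z = region T A b Q z.
  move=> Tz bT; rewrite /region T'T // Tz /=; congr (_ && _).
    by case: (b) => // p; rewrite A'T.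
  by congr (~~ _); apply: eq_has => q; rewrite A'T.
(* Strictly below [v] there is only [w], and nothing remains once it is deleted. *)
have [bv|bv] := boolP (b == Some v).
  have rw z : region T' A' b Q z -> z = w.
    rewrite (eqP bv) => /and3P[/T'c[Tz|->|->] /andP[]] //; last by rewrite eqxx.
    by rewrite A'T // nA1.
  apply: pm0 => z; apply/negP => /andP[/rw ->]; rewrite (rw x) ?eqxx //.
  by apply/and3P.
have bT p : b = Some p -> T p.
  move=> bE; move: bx bv; rewrite bE => /andP[/A'odd[->|App] _]; first by rewrite eqxx.
  by move=> _; case: (invA I App).
have pV p : b = Some p -> p != v /\ p != w.
  by move=> /bT Tp; split; [apply: contraNneq nTv => <- | apply: contraNneq nTw => <-].
(* For any other [b], the vertices [v] and [w] enter a region together, and they do so exactly when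
   [u] is in it and [v] is not cut off. *)
have rv z : (z == v) || (z == w) -> region T' A' b Q z = region T A b Q u && ~~ Q v.
  move=> zz; have A'z p : A' p z = A p u || (p == v) by case/orP: zz => /eqP->; rewrite ?A'v ?A'w.
  have T'z : T' z by case/orP: zz => /eqP ->.
  rewrite /region T'z Tu /= -andbA; congr (_ && _).
    case: (b) bT pV => [p /(_ _ erefl) Tp /(_ _ erefl)[pv pw]|//].
    rewrite A'z (negbTE pv) orbF.
    have -> : z != p by case/orP: zz => /eqP->; rewrite eq_sym.
    rewrite andbT; case: eqP => [up|_]; last by rewrite andbT.
    by rewrite -up (negbTE Eu).
  apply/idP/idP.
    move=> /hasPn H; apply/andP; split.
      by apply/hasPn => q /H; rewrite A'z; case: (Q q) => //=; rewrite negb_or => /andP[].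
    by have := H _ vW; rewrite A'z eqxx orbT andbT.
  move=> /andP[/hasPn H nQv]; apply/hasPn => q /H; rewrite A'z.
  by case: eqP => [->|_]; [rewrite (negbTE nQv) | rewrite orbF].
have pmvw : pm e (fun z => (z == v) || (z == w)) by apply: pm2.
have [Tx|nTx] := boolP (T x).
  have xR : region T A b Q x by rewrite -reg //; apply/and3P.
  have P := inv_pm I xR; rewrite A'T // in nx.
  have [RR|nRR] := boolP (region T A b Q u && ~~ Q v).
    apply: pm_eq (pmU (P nx) pmvw _) => z /=.
      have [Tz|nTz] := boolP (T z).
        rewrite reg //; have [zz|_] := boolP ((z == v) || (z == w)); last by rewrite orbF.
        by case/orP: zz Tz => /eqP->; rewrite ?(negbTE nTv) ?(negbTE nTw).
      have -> : region T A b Q z = false by rewrite /region (negbTE nTz).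
      have [zz|zz] /= := boolP ((z == v) || (z == w)).
        rewrite rv // RR; case: eqP => // zx; by rewrite zx Tx in nTz.
      by rewrite /region; case: (boolP (T' z)) => //= /(T'vE _ nTz); rewrite (negbTE zz).
    move=> /andP[/and3P[Tz _ _] _]; apply/negP => /orP[] /eqP h; move: Tz; rewrite h.
      by rewrite (negbTE nTv).
    by rewrite (negbTE nTw).
  apply: pm_eq (P nx) => z /=; congr (_ && _).
  have [Tz|nTz] := boolP (T z); first by rewrite reg.
  have -> : region T A b Q z = false by rewrite /region (negbTE nTz).
  have [zz|zz] := boolP ((z == v) || (z == w)); first by rewrite rv // (negbTE nRR).
  by rewrite /region; case: (boolP (T' z)) => //= /(T'vE _ nTz); rewrite (negbTE zz).
have xw : x = w.
  by case: (T'c _ T'x) nx => // [Tx|->]; [rewrite Tx in nTx | rewrite A'v eqxx orbT].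
have xR : region T' A' b Q w by rewrite -xw; apply/and3P.
have RR : region T A b Q u && ~~ Q v by rewrite -(rv w) // eqxx orbT.
have [Ru nQv] := andP RR.
(* When [w] is the deleted vertex, [v] is matched to [u], and the old region without [u] by the
   invariant. *)
have pmuv : pm e (fun z => (z == u) || (z == v)) by apply: pm2.
apply: pm_eq (pmU (inv_pm I Ru Eu) pmuv _) => z /=.
  rewrite xw.
  have [Tz|nTz] := boolP (T z).
    rewrite reg //; have -> : z != w by apply: contraNneq nTw => <-.
    have -> : (z == v) = false by apply: contraNF nTv => /eqP <-.
    by case: eqP => [->|_]; rewrite ?Ru ?orbT ?andbT ?orbF.
  have -> : region T A b Q z = false by rewrite /region (negbTE nTz).
  have -> /= : (z == u) = false by apply: contraNF nTz => /eqP ->.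
  have [->|zv] := eqVneq z v; first by rewrite rv ?eqxx // RR vw.
  have [->|zw] := eqVneq z w; first by rewrite andbF.
  rewrite /region; case: (boolP (T' z)) => //= /(T'vE _ nTz).
  by rewrite (negbTE zv) (negbTE zw).
move=> /andP[/and3P[Tz _ _] zu]; rewrite negb_or zu /=.
by apply: contraNneq nTv => <-.
Qed.

(* A marked odd vertex [z]: an edge leaving its subtree splits the region in two. *)
Lemma inv_split T A b Q z x y : inv T A ->
  T x -> ~~ A x x -> T y -> ~~ A y y -> e x y ->
  (forall p, b = Some p -> A p x = A p y) -> (forall q, Q q -> A q x = A q y) ->
  region T A b Q z -> A z x -> ~~ A z y ->
  pm e (fun z' => region T A b Q z' && (z' != z)).
Proof.
move=> I Tx Ex Ty Ey exy bE QE R' Azx nAzy.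
have [Tz bz Qz] := regionP _ _ _ I R'.
have Azz := inv_odd I Azx.
have xz : x != z by apply: contraNneq Ex => ->.
have yz : y != z by apply: contraNneq Ey => ->.
have xy : x != y by apply: contraTneq exy => ->; rewrite eirr.
have Rx : region T A b Q x.
  apply/(regionP _ _ _ I); split => //.
    move=> p /bz[Apz zp]; have Apx := inv_trans I Apz Azx; split => // xp.
    by rewrite xp (inv_odd I Apx) in Ex.
  move=> q Qq; apply/negP => Aqx; have [h|h] := inv_chain I Azx Aqx.
    have : A q y by rewrite -QE.
    by move=> /(inv_trans I h) h2; rewrite h2 in nAzy.
  by have := Qz _ Qq; rewrite h.
have Ry : region T A b Q y.
  apply/(regionP _ _ _ I); split => //.
    move=> p bp; have [Apz zp] := bz _ bp; have Apx := inv_trans I Apz Azx.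
    have Apy : A p y by rewrite -bE.
    by split => // yp; rewrite yp (inv_odd I Apy) in Ey.
  move=> q Qq; have [_ _ /(_ q Qq)] := regionP _ _ _ I Rx.
  by rewrite QE //; apply.
pose Q2 := fun q => Q q || (q == z).
have R1x : region T A (Some z) Q x.
  apply/(regionP _ _ _ I); split => //; first by move=> p [<-]; split => //; apply/eqP.
  by have [] := regionP _ _ _ I Rx.
have R2y : region T A b Q2 y.
  have [_ by_ Qy] := regionP _ _ _ I Ry.
  by apply/(regionP _ _ _ I); split => // q /orP[/Qy|/eqP->].
have split_R z' : region T A b Q z' && (z' != z) =
    region T A (Some z) Q z' || region T A b Q2 z'.
  apply/andP/orP.
    move=> [/(regionP _ _ _ I)[Tz' bz' Qz'] nz']; have [h|h] := boolP (A z z').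
      by left; apply/(regionP _ _ _ I); split => // p [<-]; split => //; apply/eqP.
    by right; apply/(regionP _ _ _ I); split => // q /orP[/Qz'|/eqP->].
  case=> /(regionP _ _ _ I)[Tz' bz' Qz'].
    have [Azz' nz'] := bz' _ erefl; split; last by apply/eqP.
    apply/(regionP _ _ _ I); split => // p bp; have [Apz zp] := bz _ bp.
    split; first exact: (inv_trans I Apz Azz').
    by move=> z'p; rewrite z'p in Azz'; apply: zp; apply: (inv_anti I).
  split; last first.
    by have := Qz' z; rewrite /Q2 eqxx orbT => /(_ isT); apply: contraNneq => ->.
  by apply/(regionP _ _ _ I); split => // q Qq; apply: Qz'; rewrite /Q2 Qq.
have dis z' : region T A (Some z) Q z' -> ~~ region T A b Q2 z'.
  move=> /(regionP _ _ _ I)[_ /(_ _ erefl)[h _] _]; apply/negP => /(regionP _ _ _ I)[_ _ /(_ z)].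
  by rewrite /Q2 eqxx orbT h => /(_ isT).
(* [x] lies in the part below [z] and [y] in the part outside. Each part without its end of the edge
   is perfectly matched, and the edge joins the two ends. *)
have P1 := inv_pm I R1x Ex; have P2 := inv_pm I R2y Ey.
have P3 := pm2 esym eirr exy.
have D12 z' : region T A (Some z) Q z' && (z' != x) -> ~~ (region T A b Q2 z' && (z' != y)).
  by move=> /andP[/dis h _]; rewrite (negbTE h).
apply: pm_eq (pmU (pmU P1 P2 D12) P3 _) => z' /=; rewrite ?split_R.
  have [->|zx] := eqVneq z' x; first by rewrite R1x /= orbT.
  have [->|zy] := eqVneq z' y; first by rewrite R2y /= !orbT.
  by rewrite /= !andbT orbF.
move=> /orP[/andP[h1 h2]|/andP[h1 h2]]; rewrite negb_or h2 ?andbT /=.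
  by apply: contraL R2y => /eqP <-; apply: dis.
by apply: contraL h1 => /eqP ->; apply: dis.
Qed.

(** A region of the new tree is a region of the old one in which only the unmarked vertices of [Q]
    are cut off. If the deleted vertex was even before, the old invariant applies; if it has just
    become even, exactly one end of the edge lies below it and [inv_split] applies. *)
Lemma inv_mark T A A' x y : inv T A ->
  T x -> ~~ A x x -> T y -> ~~ A y y -> e x y ->
  (forall p z, A' p z = A p z && (A p x == A p y)) -> inv T A'.
Proof.
move=> I Tx Ex Ty Ey exy A'E.
have A'A p z : A' p z -> A p z by rewrite A'E => /andP[].
split.
- exact: invT I.
- exact: invW I.
- by move=> p z /A'A /(invA I).
- by move=> p z; rewrite !A'E => /andP[/(inv_odd I) -> ->].
- by move=> q p z; rewrite !A'E => /andP[qp ->] /andP[pz _]; rewrite (inv_trans I qp pz).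
- by move=> p q /A'A pq /A'A qp; apply: (inv_anti I).
- move=> p q z; rewrite !A'E => /andP[pz ->] /andP[qz ->]; rewrite !andbT.
  exact: (inv_chain I) pz qz.
- exact: invM I.
- by move=> p; apply: contra (inv_r I p) => /A'A.
- move=> p /A'A Ap; have [w [Tw nw wE]] := inv_mate I Ap.
  by exists w; split => //; [apply: contra nw => /A'A | move=> q; rewrite !A'E wE].
move=> b Q z R' nz.
pose Q' := fun q => Q q && (A q x == A q y).
have regE z' : (forall p, b = Some p -> A p x == A p y) ->
    region T A' b Q z' = region T A b Q' z'.
  move=> bE; rewrite /region; congr [&& _, _ & _].
    by case: (b) bE => // p /(_ _ erefl); rewrite A'E => ->; rewrite andbT.
  by congr (~~ _); apply: eq_has => q; rewrite /Q' A'E -andbA; congr (_ && _); rewrite andbC.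
have bE p : b = Some p -> A p x == A p y.
  by move=> bp; move: R'; rewrite bp => /and3P[_ /andP[]]; rewrite A'E => /andP[].
rewrite regE // in R'.
apply: (@pm_eq _ _ (fun z' => region T A b Q' z' && (z' != z))).
  by move=> z'; rewrite regE.
have [Az|] := boolP (A z z); last exact: (inv_pm I R').
have {}nz : A z x != A z y by move: nz; rewrite A'E Az.
have [Azx|nAzx] := boolP (A z x).
  apply: (inv_split I Tx Ex Ty Ey exy _ _ R') => //.
  - by move=> p /bE /eqP.
  - by move=> q /andP[_ /eqP].
  - by move: nz; rewrite Azx; case: (A z y).
apply: (inv_split I Ty Ey Tx Ex _ _ _ R') => //.
- by rewrite esym.
- by move=> p /bE /eqP.
- by move=> q /andP[_ /eqP].
- by move: nz; rewrite (negbTE nAzx); case: (A z y).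
Qed.

(** Match the tree without [u] by the invariant, add the edge from [u] to [v], and keep [M] off the
    tree, where mates stay off the tree. Everything covered by [M] stays covered, and [r] is
    gained. *)
Lemma found_aug T A u v : inv T A -> T u -> ~~ A u u -> ~~ T v -> v \in W ->
  e u v -> ~~ cov M v ->
  exists Y : pred V, [/\ forall z, Y z -> z \in W, pm e Y & count (cov M) W < count Y W].
Proof.
move=> I Tu Eu nTv vW euv nv.
have regT z : region T A None pred0 z = T z.
  by rewrite /region; case: (T z) => //=; apply/hasPn => q _.
have P1 : pm e (fun z => T z && (z != u)).
  have Ru : region T A None pred0 u by rewrite regT.
  by apply: pm_eq (inv_pm I Ru Eu) => z; rewrite regT.
have P2 := pm2 esym eirr euv.
have P3 : pm e (fun z => cov M z && ~~ T z).
  apply: pm_closed (mM) _ => z /andP[/(covP _ mM)[w Mzw] nTz]; exists w => //.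
  have Mwz : M w z by case: (mM.1 _ _ Mzw).
  apply/andP; split; first by apply/(covP _ mM); exists z.
  apply: contra nTz => Tw; have wr : w != r.
    by apply: contraNneq rexp => <-; apply/(covP _ mM); exists z.
  by have [w' Mww' Tw'] := invM I Tw wr; rewrite (mM.2 _ _ _ Mwz Mww').
have uv : u != v by apply: contraTneq euv => ->; rewrite eirr.
have D12 z : T z && (z != u) -> ~~ ((z == u) || (z == v)).
  by move=> /andP[Tz zu]; rewrite negb_or zu /=; apply: contraNneq nTv => <-.
have P := pmU (pmU P1 P2 D12) P3.
exists (fun z => ((T z && (z != u)) || ((z == u) || (z == v))) || (cov M z && ~~ T z)).
split; last first.
- apply: (@count_lt _ _ uW _ _ r) => //; last first.
  + by rewrite (invT I) /=; case: eqP.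
  + move=> z cz; rewrite cz /=; have [Tz|] := boolP (T z); rewrite ?orbT //=.
    by case: eqP.
- apply: P => z /orP[/andP[Tz _]|/orP[/eqP->|/eqP->]].
  + by rewrite Tz andbF.
  + by rewrite Tu andbF.
  + by rewrite (negbTE nv).
- move=> z /= /orP[/orP[/andP[Tz _]|/orP[/eqP->|/eqP->]]|/andP[cz _]] //.
  + exact: (invW I).
  + exact: (invW I).
  + by case/(covP _ mM): cz => w /mM.1[].
Qed.

(** A Tutte-Berge count. The even vertices fall into classes with equal odd ancestors, one more
    class than there are odd vertices, all of odd size. In a stuck tree an edge from an even vertex
    leads to its own class or to an odd vertex. So a matching leaves a vertex uncovered in each
    class that has no pair with an odd vertex, and there is at least one such class. *)
Lemma stuck_max T A : inv T A ->
  (forall u v, T u -> ~~ A u u -> e u v -> v \in W -> T v) ->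
  (forall x y p, T x -> ~~ A x x -> T y -> ~~ A y y -> e x y -> A p x = A p y) ->
  (forall Y : pred V, (forall z, Y z -> z \in W /\ z != r) -> pm e Y ->
     count Y W <= count (cov M) W) ->
  forall Y : pred V, (forall z, Y z -> z \in W) -> pm e Y ->
    count Y W <= count (cov M) W.
Proof.
move=> I cl1 cl2 maxM Y YW PY; have [f fY] := PY.
have f_inj : {in Y &, injective f}.
  by move=> x y xY yY fxy; have [_ _ <-] := fY x xY; have [_ _ <-] := fY y yY; rewrite fxy.
pose O p := A p p.
have OT p : O p -> T p by case/(invA I).
pose Y' z := Y z && (~~ T z && ~~ T (f z)).
(* Off the tree keep the pairs of [Y], on the tree those of [M]: together a matching that avoids
   [r], to which the maximality of [M] applies. *)
have cY' : count Y' W + count (fun z => T z && (z != r)) W <= count (cov M) W.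
  have dis z : Y' z -> ~~ (T z && (z != r)) by move=> /and3P[_ /negbTE-> _].
  have P : pm e (fun z => Y' z || (T z && (z != r))).
    apply: pmU dis.
      exists f => z /and3P[Yz nTz nTf]; have [a b c] := fY z Yz.
      by rewrite /Y' a b c nTz nTf.
    apply: pm_closed (mM) _ => z /andP[Tz zr]; have [w Mw Tw] := invM I Tz zr.
    exists w => //; rewrite Tw; apply: contraNneq rexp => <-.
    by apply/(covP _ mM); exists z; case: (mM.1 _ _ Mw).
  apply: leq_trans (maxM _ _ P); first by apply: (count_disj uW) => // z ->; rewrite ?orbT.
  move=> z /orP[/and3P[Yz nTz _]|/andP[Tz ->]]; last by rewrite (invW I).
  by rewrite YW //; split => //; apply: contraNneq nTz => ->; apply: invT I.
have cT : count T W = (count (fun z => T z && (z != r)) W).+1.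
  by apply: (count_D1 uW) => //; apply: invT I.
(* The count below reads [|Y| <= |Y'| + |X1| + |X2|], [|X2| <= |X3|], [|X3| + |X4| <= |O|],
   [|X1| + |X5| <= |T|] and [|O| + 1 <= |X4| + |X5|]. Hence [|Y| <= |Y'| + |T| - 1]. *)
pose X1 z := Y z && T z.
pose X2 z := Y z && (~~ T z && T (f z)).
pose X3 z := O z && (Y z && ~~ T (f z)).
pose X4 z := O z && (Y z && T (f z)).
pose X5 z := T z && (~~ O z && ~~ Y z).
have c1 : count Y W <= count Y' W + (count X1 W + count X2 W).
  have h1 : count (predI Y X1) W <= count X1 W by apply: (count_le uW) => z _ /= /andP[].
  have h2 : count (predD Y X1) W <= count Y' W + count X2 W.
    rewrite (count_split uW _ Y'); apply: leq_add; apply: (count_le uW) => z _ /=.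
      by move=> /andP[].
    rewrite /X1 /X2 /Y'; case: (Y z) => //=; case: (T z) => //=.
    by rewrite !andbT negbK.
  rewrite (count_split uW Y X1); lia.
have c2 : count X2 W <= count X3 W.
  apply: (@count_inj _ _ uW _ _ f).
    move=> z /and3P[Yz nTz Tf]; have [Yf ef ff] := fY z Yz; split; last exact: YW.
    rewrite /X3 Yf ff nTz !andbT /O; apply: contraNT nTz => nO.
    by apply: cl1 Tf nO _ (YW _ Yz); rewrite esym.
  by move=> x y /andP[xY _] /andP[yY _]; apply: f_inj.
have c3 : count X3 W + count X4 W <= count O W.
  apply: (count_disj uW) => // z; try by move=> /andP[].
  by move=> /and3P[_ _ nT]; rewrite /X4 (negbTE nT) !andbF.
have c4 : count X1 W + count X5 W <= count T W.
  apply: (count_disj uW) => // z; try by move=> /andP[].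
  by move=> /andP[Yz _]; rewrite /X5 Yz !andbF.
(* The class of the even vertices with the same odd ancestors as the odd vertex [b], or with none
   for [b = None]. *)
pose Reg b z := [&& T z, ~~ O z & all (fun q => A q z == if b is Some p then A q p else false) W].
have RegP b z : Reg b z -> [/\ T z, ~~ O z & forall q, A q z = if b is Some p then A q p else false].
  move=> /and3P[Tz Oz /allP H]; split => // q.
  have [qW|qW] := boolP (q \in W); first exact/eqP/H.
  have nA z' : A q z' = false.
    by apply/negP => /(invA I)[/(invW I) h]; rewrite h in qW.
  by rewrite nA; case: (b) => // p; rewrite nA.
have Reg_nbr b z y : Reg b z -> e z y -> y \in W -> T y /\ (~~ O y -> Reg b y).
  move=> /RegP[Tz Oz zE] ezy yW; have Ty := cl1 _ _ Tz Oz ezy yW; split => // Oy.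
  apply/and3P; split => //; apply/allP => q _.
  by rewrite -zE (cl2 z y).
pose idx := None :: [seq Some p | p <- W & O p].
have idxP p : Some p \in idx -> O p.
  rewrite inE /= => /mapP[p']; rewrite mem_filter => /andP[Op _] [->] //.
have uidx : uniq idx.
  rewrite /= map_inj_uniq ?filter_uniq // ?andbT; last by move=> ? ? [].
  by apply/negP => /mapP[].
have sidx : size idx = (count O W).+1 by rewrite /= size_map size_filter.
have Reg_inj b b' z : b \in idx -> b' \in idx -> Reg b z -> Reg b' z -> b = b'.
  move=> bi bi' /RegP[_ _ zE] /RegP[_ _ zE'].
  have zz q : (if b is Some p then A q p else false) = (if b' is Some p then A q p else false).
    by rewrite -zE -zE'.
  case: b bi zz {zE} => [p /idxP Op|_]; case: b' bi' {zE'} => [p' /idxP Op'|_] // zz.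
  - by congr Some; apply: (inv_anti I); [rewrite -zz | rewrite zz].
  - by have := zz p; rewrite -/(O p) Op.
  - by have := zz p'; rewrite -/(O p') Op'.
have Reg_x b : b \in idx -> exists x, Reg b x.
  case: b => [p /idxP Op|_].
    have [w [Tw nw wE]] := inv_mate I Op; exists w; apply/and3P; split => //.
    by apply/allP => q _; rewrite wE.
  exists r; apply/and3P; split; [exact: invT I | exact: inv_r I _ |].
  by apply/allP => q _; rewrite (negbTE (inv_r I q)).
(* A class is the region at [b] with the subtrees of all deeper odd vertices cut off. Without one
   vertex it is perfectly matched, so its size is odd. *)
have Reg_odd b : b \in idx -> odd (count (Reg b) W).
  move=> bi; have [x Rx] := Reg_x b bi; have [Tx Ox _] := RegP _ _ Rx.
  pose Q q := if b is Some p then A p q && (q != p) else true.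
  have RE z : Reg b z = region T A b Q z.
    apply/idP/idP.
      move=> /RegP[Tz Oz zE]; apply/(regionP _ _ _ I); split => //.
        move=> p bp; have Op : O p by apply: idxP; rewrite -bp.
        rewrite zE bp; split => // zp; by rewrite zp Op in Oz.
      move=> q; rewrite /Q zE; case: (b) => // p /andP[Apq qp].
      by apply: contraNN qp => Aqp; apply/eqP; apply: (inv_anti I).
    move=> /(regionP _ _ _ I)[Tz bz Qz]; apply/and3P; split => //.
      apply/negP => Oz; have := Qz z; rewrite /Q -/(O z) Oz; case: (b) bz => [p|_ /(_ isT)//].
      by move=> /(_ _ erefl)[-> /eqP ->] /(_ isT).
    apply/allP => q _; move: bz Qz; rewrite /Q; case: (b) => [p /(_ _ erefl)[Apz zp] Qz|_ /(_ q isT)/negbTE->//].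
    apply/eqP; apply/idP/idP => [Aqz|Aqp]; last exact: (inv_trans I Aqp Apz).
    have [Apq|//] := inv_chain I Apz Aqz.
    have [->|qp] := eqVneq q p; first exact: (inv_odd I Apz).
    by have := Qz q; rewrite Apq qp Aqz => /(_ isT).
  rewrite (count_D1 uW (invW I Tx) Rx) /=.
  have Rx' : region T A b Q x by rewrite -RE.
  apply: (pm_odd eirr uW) (pm_eq _ (inv_pm I Rx' Ox)).
    by move=> z /andP[/RegP[/(invW I)]].
  by move=> z; rewrite RE.
(* By parity [f] cannot match a class within itself: some vertex of it is uncovered or has its
   partner elsewhere. *)
pose bad b z := Reg b z && ~~ (Y z && Reg b (f z)).
have has_bad b : b \in idx -> has (bad b) W.
  move=> bi; apply/negPn/negP => /hasPn nb.
  have H z : Reg b z -> Y z /\ Reg b (f z).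
    move=> Rz; have [Tz _ _] := RegP _ _ Rz; apply/andP.
    by have := nb z (invW I Tz); rewrite /bad Rz /= negbK.
  have := Reg_odd b bi; apply/negP; apply: (pm_odd eirr uW).
    by move=> z /RegP[/(invW I)].
  by exists f => z /H[/fY[_ ef ff] Rf].
pose zz b := nth r W (find (bad b) W).
have zzP b : b \in idx -> bad b (zz b) by move=> /has_bad; apply: nth_find.
(* An injection of the [|O| + 1] classes into the disjoint sets [X4] and [X5]: an uncovered bad
   vertex is taken itself, a covered one gives its partner, which must be odd. *)
pose g b := if Y (zz b) then f (zz b) else zz b.
have gX5 b : b \in idx -> ~~ Y (zz b) -> X5 (g b).
  move=> /zzP /andP[/RegP[Tz Oz _] _] nY; rewrite /g (negbTE nY) /X5.
  by rewrite Tz Oz nY.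
have gX4 b : b \in idx -> Y (zz b) -> X4 (g b).
  move=> /zzP /andP[Rz nb] Yz; rewrite /g Yz; move: nb; rewrite Yz /= => nR.
  have [Yf ef ff] := fY _ Yz; have [Tf Of] := Reg_nbr _ _ _ Rz ef (YW _ Yf).
  rewrite /X4 Yf ff; have [-> _ _] := RegP _ _ Rz; rewrite !andbT.
  by apply: contraNT nR => /Of.
have X45 z : X4 z -> ~~ X5 z by move=> /andP[Oz _]; rewrite /X5 Oz !andbF.
have g_inj : {in idx &, injective g}.
  move=> b b' bi bi' gbb.
  have Rb := zzP _ bi; have Rb' := zzP _ bi'.
  case/andP: Rb => Rb _; case/andP: Rb' => Rb' _.
  suff h : zz b = zz b' by apply: (Reg_inj _ _ (zz b)) => //; rewrite h.
  have [Yb|Yb] := boolP (Y (zz b)); have [Yb'|Yb'] := boolP (Y (zz b')).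
  - by move: gbb; rewrite /g Yb Yb'; apply: f_inj.
  - by have := X45 _ (gX4 _ bi Yb); rewrite gbb gX5.
  - by have := X45 _ (gX4 _ bi' Yb'); rewrite -gbb gX5.
  - by move: gbb; rewrite /g (negbTE Yb) (negbTE Yb').
have c5 : (count O W).+1 <= count X4 W + count X5 W.
  have -> : count X4 W + count X5 W = count (predU X4 X5) W.
    rewrite -count_predUI (@eq_count _ (predI X4 X5) pred0) ?count_pred0 ?addn0 //.
    by move=> z /=; case h : (X4 z) => //=; apply/negbTE/X45.
  rewrite -sidx -(size_map g) -size_filter; apply: uniq_leq_size.
    by rewrite map_inj_in_uniq.
  move=> z /mapP[b bi ->]; rewrite mem_filter /=.
  have [Yb|Yb] := boolP (Y (zz b)).
    have X4g := gX4 _ bi Yb; have /andP[Og _] := X4g.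
    by rewrite X4g (invW I) // OT.
  have X5g := gX5 _ bi Yb; have /andP[Tg _] := X5g.
  by rewrite X5g orbT (invW I).
lia.
Qed.

End Inv.
End Matchings.

(** * Correctness of the search for an augmentation *)

Lemma foldl_fix (A T : Type) (f : A -> A) (x : A) (l : seq T) :
  f x = x -> foldl (fun y _ => f y) x l = x.
Proof. by move=> fx; elim: l => //= _ l; rewrite fx. Qed.

Section Search.
Variables (V : eqType) (E : seq (V * V)).
Definition edge_rel (u v : V) : bool := (u, v) \in E.
Local Notation adj := edge_rel.
Hypotheses (esym : symmetric adj) (eirr : irreflexive adj).

Definition restr (W : seq V) (M : seq (V * V)) (x y : V) : bool :=
  [&& (x, y) \in M, x \in W & y \in W].

Section Fixed.
Variables (W : seq V) (M : seq (V * V)) (r : V).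
Hypotheses (uW : uniq W) (mM : matching adj W (restr W M)) (rW : r \in W).
Hypothesis rexp : ~~ cov W (restr W M) r.
Implicit Types (st : seq V * seq (V * V)).

Definition stT st : pred V := fun z => z \in st.1.
Definition stA st : rel V := fun p z => (p, z) \in st.2.

Definition sinv st : Prop := inv adj W (restr W M) r (stT st) (stA st).

(** A growth step brings vertices into the tree, at most one of them odd, and a marking step only
    removes odd vertices. With weight 2 on the first count both steps lower the sum. *)
Definition potential st : nat :=
  2 * count (fun z => z \notin st.1) W + count (fun p => (p, p) \in st.2) W.

Lemma exposedE v : v \in W -> exposed W M v = ~~ cov W (restr W M) v.
Proof.
move=> vW; congr (~~ _); apply: eq_in_has => w wW.
by rewrite /restr vW wW !andbT.
Qed.

Lemma frontierP st p : (p \in frontier W E st) =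
  [&& p.1 \in W, p.2 \in W, evenv st p.1, p.2 \notin st.1 & adj p.1 p.2].
Proof.
rewrite mem_filter mem_pairs /edge_rel -surjective_pairing.
by case: (p.1 \in W); case: (p.2 \in W); rewrite ?andbF ?andbT.
Qed.

Lemma blossomsP st p : reflect
  [/\ p.1 \in W, p.2 \in W, adj p.1 p.2, evenv st p.1 && evenv st p.2
    & exists2 q, q \in W & stA st q p.1 != stA st q p.2]
  (p \in blossoms W E st).
Proof.
rewrite mem_filter mem_pairs /edge_rel -surjective_pairing.
apply: (iffP idP) => [/andP[/andP[/andP[pE ev] /hasP[q qW h]] /andP[p1 p2]]|[p1 p2 pE ev [q qW h]]].
  by split => //; exists q => //; move: h; rewrite /stA; case: (_ \in _); case: (_ \in _).
rewrite pE ev p1 p2 !andbT; apply/hasP; exists q => //.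
by move: h; rewrite /stA; case: (_ \in _); case: (_ \in _).
Qed.

Lemma grow_ok st u v : sinv st -> (u, v) \in frontier W E st -> ~~ exposed W M v ->
  sinv (grow W M st u v) /\ potential (grow W M st u v) < potential st.
Proof.
move=> I; rewrite frontierP /= => /and5P[uWW vW /andP[uT uE] vT euv] ev.
have [w wW vwM] : exists2 w, w \in W & (v, w) \in M by apply/hasP; move: ev; rewrite negbK.
have Mvw : restr W M v w by rewrite /restr vwM vW wW.
have fn z : z \in W -> (v, z) \in M -> z = w.
  by move=> zW vzM; apply: (mM.2 v) => //; rewrite /restr vzM vW zW.
have TW z : z \in st.1 -> z \in W by apply: (invW I).
have AW p z : (p, z) \in st.2 -> (p \in W) && (z \in W).
  by move=> h; have [/TW -> /TW ->] := invA I (h : stA st p z).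
have T'E z : stT (grow W M st u v) z = [|| stT st z, z == v | z == w].
  rewrite /stT mem_filter; have [zW|zW] := boolP (z \in W); rewrite ?andbT ?andbF.
    congr (_ || (_ || _)); apply/idP/eqP => [|->] //; exact: fn.
  symmetry; apply/negbTE; rewrite !negb_or; apply/and3P; split; apply: contra zW => //.
  - exact: TW.
  - by move=> /eqP->.
  - by move=> /eqP->.
have A'E p z : stA (grow W M st u v) p z =
    stA st p z || ((z == v) || (z == w)) && (stA st p u || (p == v)).
  rewrite /stA mem_filter mem_pairs /=.
  apply/andP/idP.
    move=> [/orP[->//|/andP[h1 ->]] /andP[_ zW]]; rewrite andbT; apply/orP; right.
    by case/orP: h1 => [->//|/(fn _ zW) ->]; rewrite eqxx orbT.
  move=> /orP[/[dup] h /AW ->|/andP[h1 h2]]; first by rewrite h.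
  have -> : (p \in W) && (z \in W).
    apply/andP; split; last by case/orP: h1 => /eqP->.
    by case/orP: h2 => [/AW/andP[]|/eqP->].
  split => //; apply/orP; right; rewrite h2 andbT.
  by case/orP: h1 => /eqP->; rewrite ?eqxx ?vwM ?orbT.
have [I' nTw] := inv_grow esym eirr mM rexp I uT uE vT vW euv Mvw T'E A'E.
split => //; rewrite /potential.
have c1 : count (fun z => z \notin (grow W M st u v).1) W < count (fun z => z \notin st.1) W.
  apply: (count_lt uW _ vW vT).
    by move=> z; apply: contra => zT; have := T'E z; rewrite /stT zT.
  by rewrite negbK; have := T'E v; rewrite /stT eqxx orbT.
have c2 : count (fun p => (p, p) \in (grow W M st u v).2) W <= (count (fun p => (p, p) \in st.2) W).+1.
  have [h|h] := boolP ((v, v) \in (grow W M st u v).2); last first.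
    apply: leqW; apply: (count_le uW) => p _ /= /[dup] pp.
    rewrite -/(stA (grow W M st u v) p p) A'E => /orP[//|/andP[/orP[]/eqP pv]].
      by rewrite pv in pp; rewrite pp in h.
    by rewrite pv => /orP[/(invA I)[wT _]|/eqP wv]; [rewrite wT in nTw | rewrite pv wv in pp; rewrite pp in h].
  rewrite (count_D1 uW vW h) ltnS; apply: (count_le uW) => p _ /= /andP[].
  rewrite -/(stA (grow W M st u v) p p) A'E => /orP[//|/andP[/orP[]/eqP-> ]]; first by rewrite eqxx.
  by move=> /orP[/(invA I)[wT _]|->//]; rewrite wT in nTw.
by move: c1 c2; clear; lia.
Qed.

Lemma mark_ok st x y : sinv st -> (x, y) \in blossoms W E st ->
  sinv (mark st x y) /\ potential (mark st x y) < potential st.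
Proof.
move=> I /blossomsP[/= xW yW exy /andP[/andP[xT xE] /andP[yT yE]] [q qW Dq]].
have A'E p z : stA (mark st x y) p z = stA st p z && (stA st p x == stA st p y).
  by rewrite /stA mem_filter /= andbC.
split; first exact: (inv_mark esym eirr I xT xE yT yE exy A'E).
rewrite /potential ltn_add2l; apply: (count_lt uW _ qW) => //=.
- by move=> z; rewrite -/(stA (mark st x y) z z) A'E => /andP[].
- move: Dq; have [h|h] := boolP (stA st q x); first by rewrite -/(stA st q q) (inv_odd I h).
  by have [h' _|h'] := boolP (stA st q y); [rewrite -/(stA st q q) (inv_odd I h') | ].
- by rewrite -/(stA (mark st x y) q q) A'E (negbTE Dq) andbF.
Qed.

Definition stuck st : bool :=
  [&& ~~ found W E M st, nilp (frontier W E st) & nilp (blossoms W E st)].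

Lemma search_iter (T : Type) (l : seq T) st : sinv st -> potential st <= size l ->
  let st' := foldl (fun s _ => search_step W E M r s) st l in
  sinv st' /\ (found W E M st' || stuck st').
Proof.
elim: l st => [|a l IH] st I /= le; last first.
  have [f|f] := boolP (found W E M st).
    have fx : search_step W E M r st = st by rewrite /search_step f.
    by rewrite fx foldl_fix // f.
  rewrite /search_step (negbTE f).
  have [nf|nf] := boolP (nilp (frontier W E st)); last first.
    apply: IH; move: (last_in (r, r) nf); case: (last _ _) => u v h.
      by case: (grow_ok I h) => //; apply: contra f => ex; apply/hasP; exists (u, v).
    have [|_] := grow_ok I h; last by move=> /= lt; lia.
    by apply: contra f => ex; apply/hasP; exists (u, v).
  have [nb|nb] := boolP (nilp (blossoms W E st)); last first.
    apply: IH; move: (last_in (r, r) nb); case: (last _ _) => u v h.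
      by case: (mark_ok I h).
    by have [_ /= lt] := mark_ok I h; lia.
  have sk : stuck st by rewrite /stuck f nf nb.
  have fx : search_step W E M r st = st by rewrite /search_step (negbTE f) nf nb.
  by rewrite foldl_fix // sk orbT.
(* Potential 0: all of [W] is in the tree and no vertex is odd, so no edge leaves the tree and no
   two vertices differ in odd ancestors. *)
split => //; move: le; rewrite leqn0 addn_eq0 muln_eq0 /= => /andP[c1 c2].
have allT z : z \in W -> z \in st.1.
  by move=> zW; move: c1; rewrite -leqn0 leqNgt -has_count => /hasPn /(_ z zW); rewrite negbK.
have noA p z : (p, z) \in st.2 -> False.
  move=> /[dup] /(invA I)[/(invW I) pW _] /(inv_odd I) h.
  by move: c2; rewrite -leqn0 leqNgt -has_count => /hasPn /(_ p pW); rewrite -/(stA st p p) h.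
have nf : frontier W E st = [::].
  case F : (frontier W E st) => [//|p s]; have : p \in frontier W E st by rewrite F mem_head.
  by rewrite frontierP => /and5P[_ /allT -> _].
have nb : blossoms W E st = [::].
  case F : (blossoms W E st) => [//|p s]; have : p \in blossoms W E st by rewrite F mem_head.
  move=> /blossomsP[_ _ _ _ [q _]]; rewrite /stA.
  by case h1 : (_ \in _); case h2 : (_ \in _) => //; [case: (noA _ _ h1) | case: (noA _ _ h2)].
by rewrite /stuck /found nf nb.
Qed.

Definition augmentable : Prop := exists Y : pred V,
  [/\ forall z, Y z -> z \in W, pm adj Y & count (cov W (restr W M)) W < count Y W].

Lemma search_spec :
  (forall Y : pred V, (forall z, Y z -> z \in W /\ z != r) -> pm adj Y ->
     count Y W <= count (cov W (restr W M)) W) ->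
  search W E M r <-> augmentable.
Proof.
move=> maxM; rewrite /search /search_state.
have I0 : sinv ([:: r], [::]).
  by apply: inv_init => // z; rewrite /stT inE.
have [] := @search_iter V (W ++ W) ([:: r], [::]) I0.
  rewrite /potential size_cat /= (@eq_count _ (fun p => (p, p) \in [::]) pred0) // count_pred0.
  by have := count_size (fun z => z \notin [:: r]) W; lia.
set st := foldl _ _ _ => I fs; split.
  move=> /hasP[[u v]]; rewrite frontierP /= => /and5P[uWW vW /andP[uT uE] vT euv].
  by rewrite exposedE // => ex; apply: (found_aug esym eirr uW mM rW rexp I uT uE vT).
move=> [Y [YW PY lt]]; case/orP: fs => // /and3P[_ nf nb].
have cl1 u v : stT st u -> ~~ stA st u u -> adj u v -> v \in W -> stT st v.
  move=> uT uE euv vW; apply/negPn/negP => vT.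
  have : (u, v) \in frontier W E st.
    by rewrite frontierP /= (invW I uT) vW /evenv /= [u \in _]uT uE vT.
  by move: nf => /nilP ->.
have cl2 x y p : stT st x -> ~~ stA st x x -> stT st y -> ~~ stA st y y -> adj x y ->
    stA st p x = stA st p y.
  move=> xT xE yT yE exy; apply/eqP/negPn/negP => D.
  have pW : p \in W.
    move: D; have [h|h] := boolP (stA st p x); first by case: (invA I h) => /(invW I).
    by have [h' _|] := boolP (stA st p y); first by case: (invA I h') => /(invW I).
  have : (x, y) \in blossoms W E st.
    apply/blossomsP; split => //=; [exact: (invW I) | exact: (invW I) | | by exists p].
    by rewrite /evenv [x \in _]xT [y \in _]yT xE yE.
  by move: nb => /nilP ->.
have := stuck_max esym eirr uW mM rW rexp I cl1 cl2 maxM YW PY.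
by rewrite leqNgt lt.
Qed.

End Fixed.
End Search.

(** * Augmentation and maximum matchings *)

Lemma count_sub (V : eqType) (C W : seq V) (Y : pred V) : uniq C -> uniq W ->
  {subset C <= W} -> (forall z, Y z -> z \in C) -> count Y C = count Y W.
Proof.
move=> uC uW CW YC; rewrite -!size_filter; apply/perm_size/uniq_perm; rewrite ?filter_uniq //.
move=> z; rewrite !mem_filter; case h : (Y z) => //=.
by rewrite YC // CW // YC.
Qed.

Lemma pm_D2 (V : eqType) (e : rel V) (Y : pred V) (f : V -> V) x : irreflexive e ->
  (forall z, Y z -> [/\ Y (f z), e z (f z) & f (f z) = z]) -> Y x ->
  pm e (fun z => [&& Y z, z != x & z != f x]).
Proof.
move=> eirr H Yx; exists f => z /and3P[Yz zx zy]; have [a b c] := H z Yz.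
have [_ _ ffx] := H x Yx.
split => //; rewrite a /=; apply/andP; split.
  by apply: contraNneq zy => h; rewrite -c h.
by apply: contraNneq zx => h; rewrite -c h ffx.
Qed.

Section Augment.
Variables (V : eqType) (E : seq (V * V)) (W : seq V).
Notation adj := (edge_rel E).
Hypotheses (esym : symmetric adj) (eirr : irreflexive adj) (uW : uniq W).
Implicit Types (C : seq V) (M : seq (V * V)).

Definition mrel M : rel V := fun x y => (x, y) \in M.
Definition mok M : Prop := matching adj W (mrel M).
Definition cv M : pred V := cov W (mrel M).
Definition cvC C M : pred V := fun x => (x \in C) && cv M x.
Definition mclosed C M : Prop := forall x y, (x, y) \in M -> x \in C -> y \in C.

Definition augC C M : Prop := exists Y : pred V,
  [/\ forall z, Y z -> z \in C, pm adj Y & count (cvC C M) W < count Y W].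

Definition maxC C v M : Prop := forall Y : pred V,
  (forall z, Y z -> z \in C /\ z != v) -> pm adj Y -> count Y W <= count (cvC C M) W.

(** The situation while a path is being built: inside [C] any improvement on [M] has to cover the
    exposed vertex [v], by [ap_max], and [M] has no pair leaving [C]. *)
Record augpos C v M : Prop := AugPos {
  ap_uniq : uniq C;
  ap_sub : {subset C <= W};
  ap_ok : mok M;
  ap_closed : mclosed C M;
  ap_v : v \in C;
  ap_exp : ~~ cv M v;
  ap_max : maxC C v M }.

Lemma cvP M x : mok M -> reflect (exists y, (x, y) \in M) (cv M x).
Proof. by move=> h; apply: (iffP (covP _ h)). Qed.

Lemma mok_sym M x y : mok M -> (x, y) \in M -> (y, x) \in M.
Proof. by move=> [h _] /h[]. Qed.

Lemma mok_fun M x y z : mok M -> (x, y) \in M -> (x, z) \in M -> y = z.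
Proof. by move=> [_ h]; apply: h. Qed.

Lemma mok_adj M x y : mok M -> (x, y) \in M -> [/\ x \in W, y \in W & adj x y].
Proof. by move=> [h _] /h[]. Qed.

Lemma swapE M v u w x y : v \in W -> u \in W -> mok M ->
  ((x, y) \in swap W M v u w) =
  [|| [&& (x, y) \in M, (x, y) != (u, w) & (x, y) != (w, u)],
      (x, y) == (v, u) | (x, y) == (u, v)].
Proof.
move=> vW uuW mM; rewrite mem_filter mem_pairs /=.
case h : ((x, y) \in M) => /=.
  by have [-> -> _] := mok_adj mM h; rewrite !andbT.
case: (altP ((x, y) =P (v, u))) => [[-> ->]|_]; first by rewrite vW uuW.
by case: (altP ((x, y) =P (u, v))) => [[-> ->]|_] /=; first by rewrite vW uuW.
Qed.

Lemma swap_ok M v u w : v \in W -> u \in W -> mok M -> adj v u -> ~~ cv M v ->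
  (forall y, (u, y) \in M -> y = w) -> mok (swap W M v u w).
Proof.
move=> vW uuW mM avu nv uw; have nvM y : (v, y) \in M -> False.
  by move=> h; move/negP: nv; apply; apply/(cvP _ mM); exists y.
have vu : v != u by apply: contraTneq avu => ->; rewrite eirr.
split => x y.
  rewrite /mrel !swapE // => /or3P[/and3P[h h1 h2]|/eqP[-> ->]|/eqP[-> ->]].
  - have [xW yW axy] := mok_adj mM h; split => //.
    rewrite (mok_sym mM h) /=; apply/orP; left; apply/andP; split.
      by apply: contra h2 => /eqP[-> ->].
    by apply: contra h1 => /eqP[-> ->].
  - by rewrite eqxx orbT orbT; split.
  - by rewrite eqxx orbT /= esym; split.
move=> z; rewrite /mrel !swapE //.
move=> /or3P[/and3P[h h1 h2]|/eqP[-> ->]|/eqP[-> ->]];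
  move=> /or3P[/and3P[h' h1' h2']|/eqP e1|/eqP e1]; try (case: e1 => *; subst); try by [].
- exact: (mok_fun mM h h').
- by case: (nvM _ h).
- by move: h1; rewrite (uw _ h) eqxx.
- by case: (nvM _ h').
- by move: h1'; rewrite (uw _ h') eqxx.
Qed.

Lemma swap_cv M v u w x : v \in W -> u \in W -> mok M -> adj v u -> ~~ cv M v ->
  (forall y, (u, y) \in M -> y = w) -> u = w \/ (u, w) \in M ->
  cv (swap W M v u w) x = [|| x == v, x == u | cv M x && (x != w)].
Proof.
move=> vW uuW mM avu nv uw wu; have mM' := swap_ok vW uuW mM avu nv uw.
have nvM y : (v, y) \in M -> False.
  by move=> h; move/negP: nv; apply; apply/(cvP _ mM); exists y.
have vu : v != u by apply: contraTneq avu => ->; rewrite eirr.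
apply/(cvP _ mM')/or3P.
  move=> [y]; rewrite swapE // => /or3P[/and3P[h h1 h2]|/eqP[-> _]|/eqP[-> _]]; last 2 first.
  - by constructor 1.
  - by constructor 2.
  have [xu|xu] := eqVneq x u; first by constructor 2.
  constructor 3; apply/andP; split; first by apply/(cvP _ mM); exists y.
  apply/eqP => xw; case: wu => [uw'|wu]; first by rewrite xw -uw' eqxx in xu.
  have h3 := mok_sym mM wu; rewrite -xw in h3.
  by rewrite (mok_fun mM h h3) xw eqxx in h2.
have [->|xu] := eqVneq x u; first by exists v; rewrite swapE // eqxx !orbT.
have [->|xv] := eqVneq x v; first by exists u; rewrite swapE // eqxx !orbT.
case=> // /andP[/(cvP _ mM)[y h] xw]; exists y; rewrite swapE // h /=.
apply/orP; left; apply/andP; split; first by apply: contra xu => /eqP[->].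
by apply: contra xw => /eqP[->].
Qed.

Lemma mem_remove2 C v u z : (z \in remove2 C v u) = [&& z \in C, z != v & z != u].
Proof. by rewrite mem_filter andbC. Qed.

Section Sub.
Variables (C : seq V) (v : V) (M : seq (V * V)) (u w : V).
Hypotheses (J : augpos C v M) (uC : u \in C) (avu : adj v u) (uw : (u, w) \in M).
Let C2 := remove2 C v u.
Let mM := ap_ok J.

Let nvM y : (v, y) \in M -> False.
Proof. by move=> h; move/negP: (ap_exp J); apply; apply/(cvP _ mM); exists y. Qed.

Let vu : v != u. Proof. by apply: contraTneq avu => ->; rewrite eirr. Qed.
Let wC : w \in C. Proof. exact: (ap_closed J uw). Qed.
Let wu : (w, u) \in M. Proof. exact: mok_sym uw. Qed.
Let wv : w != v. Proof. by apply/eqP => h; apply: (@nvM u); rewrite -h. Qed.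
Let uw' : u != w.
Proof. by have [_ _] := mok_adj mM uw; apply: contraTneq => ->; rewrite eirr. Qed.
Let wC2 : w \in C2. Proof. by rewrite mem_remove2 wC wv eq_sym. Qed.
Let uC2 : uniq C2. Proof. by rewrite filter_uniq // (ap_uniq J). Qed.
Let C2W : {subset C2 <= W}.
Proof. by move=> z; rewrite mem_remove2 => /and3P[/(ap_sub J)]. Qed.

(** Since [v] is exposed, deleting [v] and [u] destroys only the pair of [u] and [w]. So [w] becomes
    exposed and can be the root of the next search. *)
Let covE x : cov C2 (restr C2 M) x = [&& cvC C M x, x != u & x != w].
Proof.
apply/hasP/and3P.
  move=> [y yC2 /and3P[h xC2 _]]; move: xC2 yC2; rewrite !mem_remove2.
  move=> /and3P[xC xv xu] /and3P[yC yv yu]; split => //.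
    by rewrite /cvC xC; apply/(cvP _ mM); exists y.
  by apply/eqP => xw; move: h yu; rewrite xw => /(mok_fun mM wu) ->; rewrite eqxx.
move=> [/andP[xC /(cvP _ mM)[y h]] xu xw].
have xv : x != v by apply/eqP => e; apply: (@nvM y); rewrite -e.
have yC2 : y \in C2.
  rewrite mem_remove2 (ap_closed J h xC) /=; apply/andP; split.
    by apply/eqP => e; apply: (@nvM x); apply: mok_sym mM _; rewrite -e.
  apply/eqP => e; move: xw; rewrite e in h.
  by rewrite (mok_fun mM uw (mok_sym mM h)) eqxx.
by exists y => //; rewrite /restr h yC2 mem_remove2 xC xv xu.
Qed.

Let count2 : count (cvC C M) W = (count (cov C2 (restr C2 M)) W).+2.
Proof.
have uWW := ap_sub J uC; have wWW := ap_sub J wC.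
rewrite (@count_D1 _ W uW _ u) //; last first.
  by rewrite /cvC uC; apply/(cvP _ mM); exists w.
rewrite (@count_D1 _ W uW _ w) //.
  by congr (_.+2); apply: eq_count => z; rewrite covE /= andbA.
by rewrite /cvC wC eq_sym uw' andbT; apply/(cvP _ mM); exists u.
Qed.

(** With the pair of [u] and [w] added, [Y] is a matching of [C] that avoids [v], and [ap_max]
    bounds it. *)
Lemma sub_max (Y : pred V) : (forall z, Y z -> z \in C2 /\ z != w) -> pm adj Y ->
  count Y W + 2 <= count (cvC C M) W.
Proof.
move=> YC PY; have P2 := pm2 esym eirr (let: And3 _ _ h := mok_adj mM uw in h).
have dis z : Y z -> ~~ ((z == u) || (z == w)).
  by move=> /YC[]; rewrite mem_remove2 negb_or => /and3P[_ _ ->] ->.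
apply: leq_trans (ap_max J _ (pmU PY P2 dis)).
  have -> : 2 = count (fun z => (z == u) || (z == w)) W.
    rewrite (@count_D1 _ W uW _ u (ap_sub J uC)) ?eqxx //.
    rewrite (@count_D1 _ W uW _ w (ap_sub J wC)) ?eqxx ?orbT 1?eq_sym //.
    rewrite (@eq_count _ _ pred0) ?count_pred0 // => z /=.
    by case: eqP => //=; case: eqP.
  by apply: (count_disj uW) => // z ->; rewrite ?orbT.
move=> z /orP[/YC[]|/orP[/eqP->|/eqP->]] //; rewrite 1?eq_sym //.
by rewrite mem_remove2 => /and3P[].
Qed.

(** The test behind a path extension. The 2 stands for [v] and [u], which are matched to each other
    outside [C2]: the search tells whether some larger matching of [C] contains that pair. *)
Lemma sub_search : search C2 E M w <->
  exists Y : pred V, [/\ forall z, Y z -> z \in C2, pm adj Y &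
    count (cvC C M) W < count Y W + 2].
Proof.
have mM2 : matching adj C2 (restr C2 M).
  split => [x y /and3P[h xC yC]|x y z /and3P[h _ _] /and3P[h' _ _]]; last exact: (mok_fun mM h h').
  by have [_ _ a] := mok_adj mM h; rewrite /restr (mok_sym mM h) xC yC.
have cs (Y : pred V) : (forall z, Y z -> z \in C2) -> count Y C2 = count Y W.
  by apply: count_sub => //.
have ccov : count (cov C2 (restr C2 M)) C2 = count (cov C2 (restr C2 M)) W.
  by apply: cs => z /hasP[y _ /and3P[]].
rewrite search_spec //.
- split=> -[Y [YC PY lt]]; exists Y; split => //.
    by move: lt; rewrite (cs Y) // ccov count2; clear; lia.
  by move: lt; rewrite (cs Y) // ccov count2; clear; lia.
- by rewrite covE eqxx !andbF.
- move=> Y YC PY; rewrite ccov (cs Y); last by move=> z /YC[].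
  by have := sub_max YC PY; rewrite count2; clear; lia.
Qed.

Let M' := swap W M v u w.
Let uniq_w y : (u, y) \in M -> y = w. Proof. by move=> h; apply: mok_fun mM h uw. Qed.
Let vW := ap_sub J (ap_v J).
Let uuW := ap_sub J uC.

Lemma sub_cv x : cv M' x = [|| x == v, x == u | cv M x && (x != w)].
Proof. by apply: swap_cv => //; [exact: ap_exp J | right]. Qed.

Let cvC2 : count (cvC C2 M') W = count (cov C2 (restr C2 M)) W.
Proof.
apply: eq_count => z; rewrite covE /cvC sub_cv mem_remove2.
have [->|zv] := eqVneq z v; first by rewrite !andbF (negbTE (ap_exp J)) andbF.
by have [->|zu] /= := eqVneq z u; rewrite !andbT ?andbF // andbA.
Qed.

(** The swap moves the exposed end from [v] to [w], while on [C2] the new matching is the old one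
    without the pair of [u] and [w]. *)
Lemma sub_pos : augpos C2 w M'.
Proof.
have mM' : mok M' by apply: swap_ok => //; exact: ap_exp J.
split => //.
- move=> x y; rewrite /M' swapE // !mem_remove2 => h /and3P[xC xv xu].
  case/or3P: h => [/and3P[h h1 h2]|/eqP[xv']|/eqP[xu']]; last 2 first.
  + by rewrite xv' eqxx in xv.
  + by rewrite xu' eqxx in xu.
  rewrite (ap_closed J h xC) /=; apply/andP; split.
    by apply/eqP => e; apply: (@nvM x); apply: mok_sym mM _; rewrite -e.
  apply/eqP => e; move: h2; rewrite e in h *.
  by rewrite (mok_fun mM uw (mok_sym mM h)) eqxx.
- by rewrite sub_cv (negbTE wv) eq_sym (negbTE uw') eqxx andbF.
- by move=> Y YC PY; rewrite cvC2; have := sub_max YC PY; rewrite count2; clear; lia.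
Qed.

Lemma sub_aug : search C2 E M w -> augC C2 M'.
Proof.
move=> /sub_search[Y [YC PY lt]]; exists Y; split => //.
by move: lt; rewrite cvC2 count2; clear; lia.
Qed.

Lemma sub_count : count (cv M') W = count (cv M) W.
Proof.
have wWW := ap_sub J wC.
have mcw : cv M w by apply/(cvP _ mM); exists u.
rewrite [RHS](@count_D1 _ W uW _ w) // (@count_D1 _ W uW _ v) //; last by rewrite sub_cv eqxx.
congr (_.+1); apply: eq_count => z /=; rewrite sub_cv.
have [->|zv] := eqVneq z v; first by rewrite andbF (negbTE (ap_exp J)).
have [->|zu] := eqVneq z u; last by rewrite andbT.
by rewrite uw' andbT; symmetry; apply/(cvP _ mM); exists w.
Qed.

Lemma sub_back : search C2 E M w -> augC C M.
Proof.
move=> /sub_search[Y [YC PY lt]].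
have P2 := pm2 esym eirr avu.
have dis z : Y z -> ~~ ((z == v) || (z == u)).
  by move=> /YC; rewrite mem_remove2 negb_or => /and3P[_ -> ->].
exists (fun z => Y z || ((z == v) || (z == u))); split => //.
- move=> z /orP[/YC|/orP[/eqP->|/eqP->]] //; last exact: ap_v J.
  by rewrite mem_remove2 => /and3P[].
- exact: pmU PY P2 dis.
apply: leq_trans lt _.
have -> : 2 = count (fun z => (z == v) || (z == u)) W.
  rewrite (@count_D1 _ W uW _ v vW) ?eqxx //.
  rewrite (@count_D1 _ W uW _ u uuW) ?eqxx ?orbT 1?eq_sym //.
  rewrite (@eq_count _ _ pred0) ?count_pred0 // => z /=.
  by case: eqP => //=; case: eqP.
by apply: (count_disj uW) => // z ->; rewrite ?orbT.
Qed.

End Sub.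

Lemma exposed_closed C v M u : augpos C v M -> u \in C -> exposed C M u = ~~ cv M u.
Proof.
move=> J uC; congr (~~ _); apply/hasP/(cvP _ (ap_ok J)) => [[y _ h]|[y h]]; exists y => //.
exact: (ap_closed J h uC).
Qed.

Definition directs C v M := [seq u <- C | ((v, u) \in E) && exposed C M u].
Definition vias C v M := [seq p <- pairs C | ((v, p.1) \in E) && ((p \in M) &&
  search (remove2 C v p.1) E M p.2)].

Lemma aug_stepE C v M : aug_step W E (C, (v, M)) =
  if ~~ nilp (directs C v M) then
    let u := last v (directs C v M) in ([::], (v, swap W M v u u))
  else if ~~ nilp (vias C v M) then
    let p := last (v, v) (vias C v M) in (remove2 C v p.1, (p.2, swap W M v p.1 p.2))
  else (C, (v, M)).
Proof. by []. Qed.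

(* Some vertex of an augmenting matching must be matched to [v], by maximality. *)
Lemma augC_cand C v M : augpos C v M -> augC C M ->
  nilp (directs C v M) -> ~~ nilp (vias C v M).
Proof.
move=> J [Y [YC PY lt]] nd; have mM := ap_ok J; have [f fY] := PY.
have Yv : Y v.
  apply: contraLR lt => nY; rewrite -leqNgt; apply: (ap_max J) => // z Yz.
  by split; [exact: YC | apply: contraNneq nY => <-].
have [Yu avu fu] := fY _ Yv; have uC := YC _ Yu.
have cu : cv M (f v).
  apply/negPn/negP => ncu; have : f v \in directs C v M.
    by rewrite mem_filter uC (exposed_closed J uC) ncu !andbT; exact: avu.
  by move: nd => /nilP ->.
have [w uw] := cvP _ mM cu.
have P2 : pm adj (fun z => [&& Y z, z != v & z != f v]) by exact: (pm_D2 eirr fY _).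
have vu : v != f v by apply: contraTneq avu => <-; rewrite eirr.
have S : search (remove2 C v (f v)) E M w.
  apply/(sub_search J uC avu uw); exists (fun z => [&& Y z, z != v & z != f v]); split => //.
    by move=> z /and3P[/YC zC zv zu]; rewrite mem_remove2 zC zv zu.
  have Yfv : Y (f v) && (f v != v) by rewrite Yu eq_sym.
  rewrite (count_D1 uW (ap_sub J (ap_v J)) Yv) in lt.
  rewrite (@count_D1 _ W uW _ (f v) (ap_sub J uC) Yfv) in lt.
  rewrite addn2; apply: leq_trans lt _; rewrite !ltnS.
  by apply: (count_le uW) => z _ /andP[/andP[-> ->] ->].
have : (f v, w) \in vias C v M.
  by rewrite mem_filter mem_pairs uC (ap_closed J uw uC) /= uw S; rewrite /edge_rel in avu; rewrite avu.
by case: (vias C v M).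
Qed.

(** The path is closed at an exposed neighbour, or extended by two edges, or shown not to exist. An
    extension is made only after a successful search, so the augmentability of the smaller instance
    is carried along. *)
Lemma aug_stepP C v M : augpos C v M ->
  [\/ [/\ augC C M & exists M', [/\ aug_step W E (C, (v, M)) = ([::], (v, M')), mok M',
           count (cv M') W = (count (cv M) W).+2 & forall x, cv M' x -> cv M x \/ x \in C]],
      [/\ augC C M & exists C' v' M', [/\ aug_step W E (C, (v, M)) = (C', (v', M')),
           augpos C' v' M' /\ augC C' M', size C' < size C /\ {subset C' <= C},
           count (cv M') W = count (cv M) W & forall x, cv M' x -> cv M x \/ x \in C]]
    | ~ augC C M /\ aug_step W E (C, (v, M)) = (C, (v, M))].
Proof.
move=> J; have mM := ap_ok J; rewrite aug_stepE.
have [nd|nd] /= := boolP (nilp (directs C v M)); last first.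
  have := last_in v nd; set u := last _ _; rewrite mem_filter => /andP[/andP[avu ex] uC].
  have ncu : ~~ cv M u by rewrite -(exposed_closed J uC).
  have uu y : (u, y) \in M -> y = u.
    by move=> h; move/negP: ncu; case; apply/(cvP _ mM); exists y.
  have vW := ap_sub J (ap_v J); have uuW := ap_sub J uC.
  have vu : v != u by apply: contraTneq (avu : adj v u) => ->; rewrite eirr.
  have cvE x : cv (swap W M v u u) x = [|| x == v, x == u | cv M x && (x != u)].
    by apply: swap_cv => //; [exact: ap_exp J | left].
  constructor 1; split; last first.
    exists (swap W M v u u); split => //.
    - by apply: swap_ok => //; exact: ap_exp J.
    - rewrite (@count_D1 _ W uW _ v) //; last by rewrite cvE eqxx.
      rewrite (@count_D1 _ W uW _ u) //; last by rewrite cvE eqxx orbT eq_sym.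
      congr (_.+2); apply: eq_count => z; rewrite /= cvE.
      have [->|zv] := eqVneq z v; first by rewrite (negbTE (ap_exp J)).
      by have [->|zu] := eqVneq z u; rewrite ?(negbTE ncu) ?andbF //= !andbT.
    - by move=> x; rewrite cvE => /or3P[/eqP->|/eqP->|/andP[]]; auto; right => //; exact: ap_v J.
  have P2 := pm2 esym eirr (avu : adj v u).
  have P1 : pm adj (cvC C M).
    apply: pm_closed (mM) _ => z /andP[zC /(cvP _ mM)[y h]]; exists y => //.
    by rewrite /cvC (ap_closed J h zC); apply/(cvP _ mM); exists z; apply: mok_sym mM h.
  have dis z : cvC C M z -> ~~ ((z == v) || (z == u)).
    by move=> /andP[_ cz]; apply/negP => /orP[]/eqP h; move: cz;
      rewrite h ?(negbTE ncu) ?(negbTE (ap_exp J)).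
  exists (fun z => cvC C M z || ((z == v) || (z == u))); split.
  - by move=> z /orP[/andP[]|/orP[/eqP->|/eqP->]] //; exact: ap_v J.
  - exact: pmU P1 P2 dis.
  - apply: (@count_lt _ W uW _ _ v) => //; first by move=> z ->.
      by rewrite eqxx orbT.
    by rewrite /cvC (negbTE (ap_exp J)) andbF.
have [nv|nv] /= := boolP (nilp (vias C v M)).
  by constructor 3; split => // A; have := augC_cand J A nd; rewrite nv.
have := last_in (v, v) nv; case: (last _ _) => u w; rewrite mem_filter mem_pairs /=.
move=> /andP[/and3P[avu uw S] /andP[uC wC]].
constructor 2; split; first exact: (sub_back J uC avu uw S).
exists (remove2 C v u), w, (swap W M v u w); split => //.
- by split; [exact: (sub_pos J uC avu uw) | exact: (sub_aug J uC avu uw S)].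
- split; last by move=> z; rewrite mem_remove2 => /and3P[].
  rewrite size_filter -(count_predT C); apply: (@count_lt _ C (ap_uniq J) _ _ v) => //.
    exact: ap_v J.
  by rewrite /= eqxx.
- exact: (sub_count J uC avu uw).
- move=> x; rewrite (sub_cv J uC avu uw) => /or3P[/eqP->|/eqP->|/andP[]]; auto.
  by right; exact: ap_v J.
Qed.

(** Every extension removes vertices from [C], and [C] always contains [v]; so the path is closed
    before the clock runs out. *)
Lemma aug_iter (T : Type) (l : seq T) C v M : augpos C v M -> augC C M -> size C <= size l ->
  let M' := (foldl (fun s _ => aug_step W E s) (C, (v, M)) l).2.2 in
  [/\ mok M', count (cv M') W = (count (cv M) W).+2 & forall x, cv M' x -> cv M x \/ x \in C].
Proof.
elim: l C v M => [|a l IH] C v M J A le /=.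
  by have := ap_v J; move: le; rewrite leqn0 size_eq0 => /eqP ->.
case: (aug_stepP J) => [[_ [M' [-> h1 h2 h3]]]|[_ [C' [v' [M' [-> [J' A'] [sz sub] h2 h3]]]]]|[/(_ A)//]].
  by rewrite foldl_fix.
have [|k1 k2 k3] := IH C' v' M' J' A'; first by move: sz le => /=; lia.
split => //; first by rewrite k2 h2.
by move=> x /k3[/h3|/sub]; auto.
Qed.

Definition maximal (D : pred V) M : Prop := forall Y : pred V,
  (forall z, Y z -> D z) -> pm adj Y -> count Y W <= count (cv M) W.

(** If [M] is maximum on [D], it is maximum among the matchings of [D] and [r] that avoid [r], which
    is the starting position of an augmentation from [r]. *)
Lemma maxmatch_iter (l D : seq V) M : {subset l <= W} -> {subset D <= W} -> uniq l ->
  (forall z, z \in l -> z \notin D) -> mok M -> (forall x, cv M x -> x \in D) ->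
  maximal (mem D) M ->
  let s := foldl (fun s r => let C := [seq z <- W | (z \in s.1) || (z == r)] in
    (C, augment W E C r s.2)) (D, M) l in
  mok s.2 /\ maximal (fun z => (z \in D) || (z \in l)) s.2.
Proof.
elim: l D M => [|r l IH] D M lW DW ul lD mM cD mx /=.
  by split => // Y YD; apply: mx => z /YD; rewrite orbF.
have /andP[rl ul'] : (r \notin l) && uniq l by [].
have rW : r \in W by apply: lW; rewrite mem_head.
have rD : r \notin D by apply: lD; rewrite mem_head.
set C := [seq z <- W | _].
have CE z : (z \in C) = (z \in D) || (z == r).
  rewrite mem_filter; case zD : (z \in D) => /=; first by rewrite DW.
  by case: eqP => [->|].
have ncr : ~~ cv M r by apply: contra rD => /cD.
have cC : count (cvC C M) W = count (cv M) W.
  by apply: eq_count => z; rewrite /cvC CE; case h : (cv M z); rewrite ?andbF ?andbT ?(cD _ h).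
have J : augpos C r M.
  split => //.
  - by rewrite filter_uniq.
  - by move=> z; rewrite mem_filter => /andP[].
  - move=> x y h _; rewrite CE; apply/orP; left; apply: cD; apply/(cvP _ mM).
    by exists x; apply: mok_sym mM h.
  - by rewrite CE eqxx orbT.
  - move=> Y YC; rewrite cC; apply: mx => z /YC[]; rewrite CE => /orP[//|->] //.
set M' := augment W E C r M.
have [mM' mx' cD'] : [/\ mok M', maximal (mem C) M' & forall x, cv M' x -> x \in C].
  have [A|[nA st]] : augC C M \/ ~ augC C M /\ aug_step W E (C, (r, M)) = (C, (r, M)).
    by case: (aug_stepP J) => [[A _]|[A _]|]; auto.
  - have [k1 k2 k3] := aug_iter J A (uniq_leq_size (ap_uniq J) (ap_sub J) : size C <= size W).
    rewrite -/(augment W E C r M) -/M' in k1 k2 k3.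
    split => //; last by move=> x /k3[/cD h|//]; rewrite CE h.
    move=> Y YC PY; rewrite k2; have [f fY] := PY.
    have [Yr|nYr] := boolP (Y r); last first.
      apply: leqW; apply: leqW; apply: mx => // z Yz; have := YC z Yz.
      by rewrite /= CE => /orP[//|/eqP zr]; rewrite -zr Yz in nYr.
    have [Yu aru fu] := fY _ Yr; have ru : f r != r by apply: contraTneq aru => ->; rewrite eirr.
    (* Deleting [r] and its partner from [Y] leaves a matching of [D], so [Y] exceeds the old
       optimum by at most two vertices, the gain of one augmentation. *)
    have P2 : pm adj (fun z => [&& Y z, z != r & z != f r]) by exact: (pm_D2 eirr fY _).
    have Yfr : Y (f r) && (f r != r) by rewrite Yu.
    rewrite (count_D1 uW rW Yr) (@count_D1 _ W uW _ (f r) (ap_sub J (YC _ Yu)) Yfr) !ltnS.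
    rewrite (@eq_count _ _ (fun z => [&& Y z, z != r & z != f r])); last first.
      by move=> z /=; rewrite andbA.
    apply: mx P2 => z /and3P[/YC]; rewrite /= CE => /orP[//|->] //.
  - have -> : M' = M by rewrite /M' /augment foldl_fix.
    split => //; last by move=> x /cD h; rewrite CE h.
    move=> Y YC PY; rewrite leqNgt; apply/negP => lt; apply: nA; exists Y; split => //.
    by rewrite cC.
have [|||||||h1 h2] := IH C M' => //.
- by move=> z zl; apply: lW; rewrite inE zl orbT.
- by move=> z; rewrite mem_filter => /andP[].
- move=> z zl; rewrite CE negb_or lD ?inE ?zl ?orbT //=.
  by apply: contraNneq rl => <-.
split => // Y YD PY; apply: h2 => // z /YD; rewrite inE CE.
by case/or3P => ->; rewrite ?orbT.
Qed.

Lemma maxmatch_spec : mok (maxmatch W E) /\ maximal (mem W) (maxmatch W E).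
Proof.
have [|||||||h1 h2] := @maxmatch_iter W [::] [::] => //.
- by move=> x /hasP[y _].
- move=> Y Y0 PY; rewrite (@eq_count _ _ pred0) ?count_pred0 // => z.
  by apply/negbTE/negP => /Y0.
Qed.

End Augment.

(** * Fractional vertex covers *)

Lemma uniq_pairs (V : eqType) (W : seq V) : uniq W -> uniq (pairs W).
Proof. by move=> uW; apply: allpairs_uniq => // -[a b] [c d] _ _ [-> ->]. Qed.

Lemma uniq_augment (V : eqType) (W : seq V) E C r M : uniq W -> uniq M -> uniq (augment W E C r M).
Proof.
move=> uW uM; rewrite /augment.
elim: {2}W (C, (r, M)) (uM : uniq (C, (r, M)).2.2) => //= _ l IH s us.
apply: IH; rewrite /aug_step; case: ifP => _ /=; last case: ifP => _ //=.
all: by rewrite filter_uniq // uniq_pairs.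
Qed.

Lemma uniq_maxmatch (V : eqType) (W : seq V) E : uniq W -> uniq (maxmatch W E).
Proof.
move=> uW; rewrite /maxmatch /maxmatch_state.
set F := (fun s r => _); have H l s : uniq s.2 -> uniq (foldl F s l).2; last exact: H.
by elim: l s => //= r l IH s us; apply: IH => /=; apply: uniq_augment.
Qed.

Lemma size_matching (V : eqType) (E : seq (V * V)) (W : seq V) M : uniq W -> uniq M ->
  mok E W M -> size M = count (cv W M) W.
Proof.
move=> uW uM mM; rewrite -size_filter -(size_map fst M); apply/perm_size/uniq_perm.
- rewrite map_inj_in_uniq // => -[a b] [c d] h1 h2 /= e; rewrite e in h1 *.
  by rewrite (mok_fun mM h1 h2).
- exact: filter_uniq.
move=> x; rewrite mem_filter; apply/mapP/andP.
  move=> [[a b] h ->] /=; have [aW _ _] := mok_adj mM h.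
  by split => //; apply/(cvP _ mM); exists b.
by move=> [/(cvP _ mM)[y h] _]; exists (x, y).
Qed.

Lemma nat_min (P : nat -> Prop) : (exists n, P n) -> exists n, P n /\ forall m, P m -> n <= m.
Proof.
move=> [n Pn]; elim/ltn_ind: n Pn => n IH Pn.
have [[m [Pm lt]]|H] := classic (exists m, P m /\ m < n); first exact: IH lt Pm.
by exists n; split => // m Pm; rewrite leqNgt; apply/negP => lt; apply: H; exists m.
Qed.

(** * Konig's theorem for two copies of a vertex set *)

Section Konig.
Variables (V : eqType) (U : seq V).
Hypothesis uU : uniq U.
Implicit Types (P Q : pred V) (r : rel V).

Definition bicover r P Q : Prop := forall u v, r u v -> P u || Q v.
Definition bisize P Q : nat := count P U + count Q U.

Definition del r (a b : V) : rel V := fun u v => r u v && ((u, v) != (a, b)).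

(* Lovasz: if deleting either of two edges at a common vertex lowers the covering
   number, the two smaller covers can be uncrossed into one that is too small. *)
Lemma critical_fst r t x y z P1 Q1 P2 Q2 : x \in U ->
  (forall P Q, bicover r P Q -> t <= bisize P Q) -> r x y -> r x z -> y != z ->
  bicover (del r x y) P1 Q1 -> bisize P1 Q1 < t ->
  bicover (del r x z) P2 Q2 -> bisize P2 Q2 < t -> False.
Proof.
move=> xU min rxy rxz yz c1 s1 c2 s2.
have nP1 : ~~ P1 x.
  apply/negP => P1x; have : bicover r P1 Q1; last by move/min; lia.
  move=> u v ruv; have [/eqP[-> _]|ne] := boolP ((u, v) == (x, y)); first by rewrite P1x.
  by apply: c1; rewrite /del ruv ne.
have nP2 : ~~ P2 x.
  apply/negP => P2x; have : bicover r P2 Q2; last by move/min; lia.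
  move=> u v ruv; have [/eqP[-> _]|ne] := boolP ((u, v) == (x, z)); first by rewrite P2x.
  by apply: c2; rewrite /del ruv ne.
have Q2y : Q2 y.
  have := c2 x y; rewrite (negbTE nP2) /=; apply; rewrite /del rxy.
  by apply: contra yz => /eqP[->].
have Q1z : Q1 z.
  have := c1 x z; rewrite (negbTE nP1) /=; apply; rewrite /del rxz.
  by apply: contra yz => /eqP[->].
(* The two uncrossed covers together exceed the given pair by at most one, for [x]. The given pair
   has total size at most [2t - 2], so one of the new covers is smaller than [t]. *)
have k1 : bicover r (predI P1 P2) (predU Q1 Q2).
  move=> u v ruv /=; have [/eqP[-> ->]|n1] := boolP ((u, v) == (x, y)); first by rewrite Q2y !orbT.
  have [/eqP[-> ->]|n2] := boolP ((u, v) == (x, z)); first by rewrite Q1z !orbT.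
  have := c1 u v; have := c2 u v; rewrite /del ruv n1 n2 => /(_ isT) + /(_ isT).
  by case: (P1 u); case: (P2 u); case: (Q1 v); case: (Q2 v).
have k2 : bicover r (predU (predU P1 P2) (pred1 x)) (predI Q1 Q2).
  move=> u v ruv /=; have [ux|ux] := eqVneq u x; first by rewrite orbT.
  have h w : (u, v) != (x, w) by apply: contra ux => /eqP[->].
  have := c1 u v; have := c2 u v; rewrite /del ruv !h => /(_ isT) + /(_ isT).
  by case: (P1 u); case: (P2 u); case: (Q1 v); case: (Q2 v).
have := min _ _ k1; have := min _ _ k2; rewrite /bisize in s1 s2 *.
have := count_predUI P1 P2 U; have := count_predUI Q1 Q2 U.
have := count_predUI (predU P1 P2) (pred1 x) U.
have : count (pred1 x) U = 1 by rewrite count_uniq_mem // xU.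
lia.
Qed.

Lemma bicover_min r : exists t, (exists P Q, bicover r P Q /\ bisize P Q = t) /\
  forall P Q, bicover r P Q -> t <= bisize P Q.
Proof.
have [|t [[P [Q [c s]]] min]] :=
    @nat_min (fun t => exists P Q, bicover r P Q /\ bisize P Q = t).
  by exists (bisize predT predT), predT, predT.
exists t; split; first by exists P, Q.
by move=> P' Q' c'; apply: min; exists P', Q'.
Qed.

Definition arcs (l : seq (V * V)) : rel V := fun u v => (u, v) \in l.

Lemma bisizeC P Q : bisize P Q = bisize Q P.
Proof. exact: addnC. Qed.

(** If some edge can be deleted without lowering the covering number, induct. Otherwise every edge
    is critical, so by [critical_fst] on either side no two edges share an end: [l] itself is a
    matching, and its first ends form a cover of the same size. *)
Lemma konig (l : seq (V * V)) : uniq l -> {in l, forall p, p.1 \in U /\ p.2 \in U} ->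
  exists m P Q, [/\ {subset m <= l}, uniq (map fst m), uniq (map snd m),
     bicover (arcs l) P Q & bisize P Q <= size m].
Proof.
move: {2}(size l) (leqnn (size l)) => n; elim: n l => [|n IH] l le ul lU.
  exists [::], pred0, pred0; split => //; last by rewrite /bisize !count_pred0.
  by move=> u v; rewrite /arcs; case: l le {ul lU}.
have [t [[P0 [Q0 [c0 s0]]] min]] := bicover_min (arcs l).
have remE p : {subset rem p l <= l} by move=> q; apply: mem_rem.
have [[p [pl H]]|H] := classic (exists p, p \in l /\
    forall P Q, bicover (arcs (rem p l)) P Q -> t <= bisize P Q).
  have [|||m [P [Q [ml u1 u2 c s]]]] := IH (rem p l).
  - by rewrite size_rem //; case: (size l) le.
  - exact: rem_uniq.
  - by move=> q /remE; apply: lU.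
  exists m, P0, Q0; split => //; first by move=> q /ml /remE.
  by rewrite s0; apply: leq_trans (H _ _ c) s.
have crit a b : (a, b) \in l -> exists P Q, bicover (del (arcs l) a b) P Q /\ bisize P Q < t.
  move=> pl; have [//|nH] := classic (exists P Q, bicover (del (arcs l) a b) P Q /\ bisize P Q < t).
  case: H; exists (a, b); split => // P Q c; rewrite leqNgt; apply/negP => lt.
  apply: nH; exists P, Q; split => // u v /andP[h ne]; apply: c.
  by rewrite /arcs mem_rem_uniq // inE ne.
exists l, (fun u => u \in map fst l), pred0; split => //.
- rewrite map_inj_in_uniq // => -[x y] [x' z] h1 h2 /= e; rewrite -e in h2 *.
  apply/eqP; apply: contraT => ne; exfalso.
  have yz : y != z by apply: contra ne => /eqP->.
  have [P1 [Q1 [c1 s1]]] := crit _ _ h1; have [P2 [Q2 [c2 s2]]] := crit _ _ h2.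
  have [xU _] := lU _ h1.
  exact: (critical_fst xU min h1 h2 yz c1 s1 c2 s2).
- rewrite map_inj_in_uniq // => -[y x] [z x'] h1 h2 /= e; rewrite -e in h2 *.
  apply/eqP; apply: contraT => ne; exfalso.
  have yz : y != z by apply: contra ne => /eqP->.
  have [P1 [Q1 [c1 s1]]] := crit _ _ h1; have [P2 [Q2 [c2 s2]]] := crit _ _ h2.
  have [_ xU] := lU _ h1.
  have tr P Q w : bicover (del (arcs l) w x) P Q ->
      bicover (del (fun u v => arcs l v u) x w) Q P.
    move=> c u v /andP[h ne']; rewrite orbC; apply: c; rewrite /del h.
    by apply: contra ne' => /eqP[-> ->].
  rewrite bisizeC in s1; rewrite bisizeC in s2.
  apply: (critical_fst xU _ h1 h2 yz (tr _ _ _ c1) s1 (tr _ _ _ c2) s2).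
  by move=> P Q c; rewrite bisizeC; apply: min => u v h; rewrite orbC; apply: c.
- by move=> u v h; rewrite orbF; apply/mapP; exists (u, v).
- rewrite /bisize count_pred0 addn0 -(size_map fst l) -size_filter.
  apply: uniq_leq_size; first exact: filter_uniq.
  by move=> u; rewrite mem_filter => /andP[].
Qed.

End Konig.

(** * Duality and persistency for fractional covers *)

Section Duality.
Variables (V : eqType) (E : seq (V * V)).
Notation adj := (edge_rel E).
Hypotheses (esym : symmetric adj) (eirr : irreflexive adj).

(** A vertex cover of the bipartite double cover. Giving each vertex half the number of its chosen
    copies is a half-integral fractional cover, and all fractional covers below are represented
    so. *)
Definition ubicover (U : seq V) (P Q : pred V) : Prop :=
  forall u v, u \in U -> v \in U -> adj u v -> P u || Q v.

Section FixedU.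
Variable U : seq V.
Hypothesis uU : uniq U.

Lemma mem_dbl b u : ((b, u) \in dbl U) = (u \in U).
Proof.
rewrite mem_cat; apply/orP/idP => [[] /mapP[x xU [_ ->]] //|uUU].
by case: b; [left | right]; apply/mapP; exists u.
Qed.

Lemma uniq_dbl : uniq (dbl U).
Proof.
rewrite cat_uniq !map_inj_uniq ?uU //=; try by move=> x y [].
by rewrite andbT; apply/hasPn => -[b x] /mapP[y _ [-> _]]; apply/negP => /mapP[].
Qed.

Lemma count_dbl (P : pred (bool * V)) :
  count P (dbl U) = count (fun u => P (true, u)) U + count (fun u => P (false, u)) U.
Proof. by rewrite count_cat !count_map. Qed.

Lemma dblEP b u c v : edge_rel (dblE U E) (b, u) (c, v) = [&& b != c, adj u v, u \in U & v \in U].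
Proof. by rewrite /edge_rel mem_filter mem_pairs /= !mem_dbl -andbA. Qed.

Lemma dbl_sym : symmetric (edge_rel (dblE U E)).
Proof.
move=> [b u] [c v]; rewrite !dblEP esym eq_sym; congr (_ && (_ && _)); exact: andbC.
Qed.

Lemma dbl_irr : irreflexive (edge_rel (dblE U E)).
Proof. by move=> [b u]; rewrite dblEP eqxx. Qed.

Let M2 := maxmatch (dbl U) (dblE U E).

Lemma lpv_count : lpv E U = count (cv (dbl U) M2) (dbl U).
Proof.
have [h _] := maxmatch_spec dbl_sym dbl_irr uniq_dbl.
by apply: size_matching h; [exact: uniq_dbl | apply: uniq_maxmatch; exact: uniq_dbl].
Qed.

Lemma lpv_ge (Y : pred (bool * V)) : (forall z, Y z -> z \in dbl U) ->
  pm (edge_rel (dblE U E)) Y -> count Y (dbl U) <= lpv E U.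
Proof.
move=> YU PY; rewrite lpv_count.
by have [_ h] := maxmatch_spec dbl_sym dbl_irr uniq_dbl; apply: h.
Qed.

(** A matched vertex outside the cover has its partner inside, so the cover contains at least half
    of the matched vertices. *)
Lemma lpv_weak P Q : ubicover U P Q -> lpv E U <= 2 * (count P U + count Q U).
Proof.
move=> c; rewrite lpv_count.
have [mM _] := maxmatch_spec dbl_sym dbl_irr uniq_dbl; rewrite -/M2 in mM.
have [f fY] := pm_cov mM; rewrite -/(cv (dbl U) M2) in fY.
set Y := cv (dbl U) M2 in fY *.
pose X (z : bool * V) := if z.1 then P z.2 else Q z.2.
rewrite (count_split uniq_dbl Y X).
have -> : count P U + count Q U = count X (dbl U) by rewrite count_dbl.
have h1 : count (predI Y X) (dbl U) <= count X (dbl U).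
  by apply: (count_le uniq_dbl) => z _ /andP[].
suff : count (predD Y X) (dbl U) <= count X (dbl U) by lia.
apply: (@count_inj _ _ uniq_dbl _ _ f).
  move=> z /andP[nX Yz]; have [Yf ef ff] := fY z Yz.
  split; last by case/hasP: Yf => w _ /(mok_adj mM)[].
  case: z (f z) nX {Yz Yf ff} ef => [b u] [d v]; rewrite /X /= dblEP.
  case: b; case: d => //= nX /and3P[a uUU vU].
    by have := c u v uUU vU a; rewrite (negbTE nX).
  by have := c v u vU uUU; rewrite esym a (negbTE nX) orbF => /(_ isT).
move=> x y /andP[_ Yx] /andP[_ Yy] e.
by have [_ _ <-] := fY x Yx; have [_ _ <-] := fY y Yy; rewrite e.
Qed.

(** [konig] supplies a cover no larger than a matching. Each edge of that matching covers two
    vertices of the double cover, and [lpv] dominates the number of vertices covered by any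
    matching. *)
Lemma lpv_strong : exists P Q, ubicover U P Q /\ 2 * (count P U + count Q U) = lpv E U.
Proof.
pose l := [seq p <- pairs U | p \in E].
have [||m [P [Q [ml u1 u2 c s]]]] := @konig V U uU l.
- by rewrite filter_uniq // uniq_pairs.
- by move=> p; rewrite mem_filter mem_pairs => /andP[_ /andP].
have uc : ubicover U P Q.
  by move=> u v uUU vU a; apply: c; rewrite /arcs mem_filter mem_pairs /= uUU vU !andbT; exact: a.
exists P, Q; split => //; apply/eqP; rewrite eqn_leq lpv_weak // andbT.
apply: (@leq_trans (2 * size m)); first by rewrite leq_mul2l.
pose Y (z : bool * V) := if z.1 then z.2 \in map fst m else z.2 \in map snd m.
have mU p : p \in m -> [/\ p.1 \in U, p.2 \in U & adj p.1 p.2].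
  move=> /ml; rewrite mem_filter mem_pairs /edge_rel -surjective_pairing.
  by move=> /andP[-> /andP[-> ->]].
have cY : 2 * size m = count Y (dbl U).
  rewrite count_dbl /Y /= mul2n -addnn; congr (_ + _).
    rewrite -size_filter -(size_map fst); apply/perm_size/uniq_perm; rewrite ?filter_uniq //.
    move=> x; rewrite mem_filter; case h : (x \in _) => //=; symmetry.
    by case/mapP: h => p /mU[h _ _] ->.
  rewrite -size_filter -(size_map snd); apply/perm_size/uniq_perm; rewrite ?filter_uniq //.
  move=> x; rewrite mem_filter; case h : (x \in _) => //=; symmetry.
  by case/mapP: h => p /mU[_ h _] ->.
rewrite cY; apply: lpv_ge.
  by move=> [[] u]; rewrite /Y /= => /mapP[p /mU[h1 h2 _] ->]; rewrite mem_dbl.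
(* Partners are found by position, both projections of [m] being free of repetitions; [z.2] is only
   a default value. *)
pose f (z : bool * V) := if z.1 then (false, nth z.2 (map snd m) (index z.2 (map fst m)))
   else (true, nth z.2 (map fst m) (index z.2 (map snd m))).
have f1 a b : (a, b) \in m -> f (true, a) = (false, b).
  move=> h; rewrite /f /=; congr (_, _); have i := index_mem (a, b) m; rewrite h in i.
  have -> : a = nth a (map fst m) (index (a, b) m) by rewrite (nth_map (a, b)) ?nth_index ?i.
  rewrite index_uniq ?size_map ?i // -/(nth _ _ _).
  by rewrite (nth_map (a, b)) ?nth_index ?i.
have f2 a b : (a, b) \in m -> f (false, b) = (true, a).
  move=> h; rewrite /f /=; congr (_, _); have i := index_mem (a, b) m; rewrite h in i.
  have -> : b = nth b (map snd m) (index (a, b) m) by rewrite (nth_map (a, b)) ?nth_index ?i.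
  rewrite index_uniq ?size_map ?i //.
  by rewrite (nth_map (a, b)) ?nth_index ?i.
exists f => -[[] u]; rewrite {1}/Y /= => /mapP[[a b] h /= ->]; have [/= aU bU ab] := mU _ h.
  rewrite (f1 _ _ h) (f2 _ _ h) dblEP ab aU bU; split => //.
  by apply/mapP; exists (a, b).
rewrite (f2 _ _ h) (f1 _ _ h) dblEP esym ab aU bU; split => //.
by apply/mapP; exists (a, b).
Qed.

(* Both copies of a matched vertex are matched to the opposite copies of its partner. *)
Lemma lpv_matching : 2 * size (maxmatch U E) <= lpv E U.
Proof.
have [mM _] := maxmatch_spec esym eirr uU.
rewrite (size_matching uU (uniq_maxmatch _ uU) mM).
set M := maxmatch U E in mM *.
pose Y (z : bool * V) := cv U M z.2.
have -> : 2 * count (cv U M) U = count Y (dbl U) by rewrite count_dbl mul2n -addnn.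
have cU u : cv U M u -> u \in U by move=> /(cvP _ mM)[y /(mok_adj mM)[]].
apply: lpv_ge; first by move=> [b u] /cU; rewrite mem_dbl.
have [f fY] := pm_cov mM.
exists (fun z => (~~ z.1, f z.2)) => -[b u] /= Yu; have [a ea ffu] := fY u Yu.
rewrite dblEP ea (cU _ Yu) (cU _ a) ffu negbK; split => //.
by case: (b).
Qed.

(** Nemhauser-Trotter persistency. [C'] is the majority of [P], [Q] and [C], so it follows the
    fractional optimum wherever that is 0 or 1. The union and the intersection of the three form
    another cover of the double cover, not smaller than the optimal one; as union, majority and
    intersection add up to [P], [Q] and [C], the majority is no larger than [C]. *)
Lemma persist P Q C : ubicover U P Q -> 2 * (count P U + count Q U) <= lpv E U ->
  (forall u v, u \in U -> v \in U -> adj u v -> C u || C v) ->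
  let C' := fun u => (C u && (P u || Q u)) || (P u && Q u) in
  (forall u v, u \in U -> v \in U -> adj u v -> C' u || C' v) /\ count C' U <= count C U.
Proof.
move=> c le cC C'; split.
  move=> u v uUU vU a; rewrite /C'.
  have := c u v uUU vU a; have := c v u vU uUU; rewrite esym a => /(_ isT).
  have := cC u v uUU vU a.
  by case: (P u); case: (P v); case: (Q u); case: (Q v); case: (C u); case: (C v).
have := @lpv_weak (fun u => [|| P u, Q u | C u]) (fun u => [&& P u, Q u & C u]).
have w : ubicover U (fun u => [|| P u, Q u | C u]) (fun u => [&& P u, Q u & C u]).
  move=> u v uUU vU a.
  have := c u v uUU vU a; have := c v u vU uUU; rewrite esym a => /(_ isT).
  have := cC u v uUU vU a.
  by case: (P u); case: (P v); case: (Q u); case: (Q v); case: (C u); case: (C v).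
move=> /(_ w) {}w; move: (leq_trans le w); rewrite leq_mul2l /=.
have : count (fun u => [|| P u, Q u | C u]) U + count (fun u => [&& P u, Q u & C u]) U +
    count C' U = count P U + count Q U + count C U.
  rewrite /C'; elim: (U) => //= u s; case: (P u); case: (Q u); case: (C u) => /=; lia.
lia.
Qed.

End FixedU.
End Duality.

(** * Branching above the fractional optimum *)

Section VertexCoverSearch.
Variables (V : eqType) (E : seq (V * V)) (W : seq V).
Notation adj := (edge_rel E).
Hypotheses (esym : symmetric adj) (eirr : irreflexive adj) (uW : uniq W).

Definition covers (U : seq V) (C : pred V) : Prop :=
  forall u v, u \in U -> v \in U -> adj u v -> C u || C v.

Definition rest0 (U : seq V) (v : V) := [seq u <- U | (u != v) && ((v, u) \notin E)].
Definition rest1 (U : seq V) (v : V) := [seq u <- U | u != v].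
Definition add0 (U S : seq V) (v : V) := [seq u <- W | (u \in S) || (u \in nbrs E U v)].
Definition add1 (S : seq V) (v : V) := [seq u <- W | (u \in S) || (u == v)].

Lemma vc_stepE U S b v : vc_step W E (U, (S, b)) v =
  if v \in U then
    if lpv E U == lpv E (rest0 U v) + 4 * size (nbrs E U v) then (rest0 U v, (add0 U S v, b))
    else if lpv E U == lpv E (rest1 U v) + 4 then (rest1 U v, (add1 S v, b))
    else if nilp b then (U, (S, b))
    else if head false b then (rest1 U v, (add1 S v, behead b))
    else (rest0 U v, (add0 U S v, behead b))
  else (U, (S, b)).
Proof.
have -> : 4 * size (nbrs E U v) = let k := size (nbrs E U v) in k + k + (k + k) by move=> /=; lia.
by [].
Qed.

Lemma size_add (S X : seq V) : size [seq u <- W | (u \in S) || (u \in X)] <= size S + size X.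
Proof.
rewrite size_filter; apply: (@leq_trans (count (mem S) W + count (mem X) W)).
  by rewrite -(count_predUI (mem S) (mem X)); apply: leq_addr.
by apply: leq_add; rewrite -size_filter; apply: uniq_leq_size; rewrite ?filter_uniq //;
  move=> z; rewrite mem_filter => /andP[].
Qed.

Section Step.
Variables (U : seq V) (v : V).
Hypotheses (uU : uniq U) (vU : v \in U).

Lemma mem_rest0 u : (u \in rest0 U v) = [&& u \in U, u != v & ~~ adj v u].
Proof. by rewrite mem_filter andbC. Qed.

Lemma mem_rest1 u : (u \in rest1 U v) = (u \in U) && (u != v).
Proof. by rewrite mem_filter andbC. Qed.

Lemma mem_nbrs u : (u \in nbrs E U v) = (u \in U) && adj v u.
Proof. by rewrite mem_filter andbC. Qed.

Lemma count_rest0 (C : pred V) :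
  count C (rest0 U v) + count (fun u => C u && adj v u) U + C v = count C U.
Proof.
have -> : (C v : nat) = count (fun u => C u && (u == v)) U.
  case Cv : (C v); last first.
    by rewrite (@eq_count _ _ pred0) ?count_pred0 // => u /=; case: eqP => [->|]; rewrite ?Cv ?andbF.
  rewrite (@eq_count _ _ (pred1 v)) ?count_uniq_mem ?vU // => u /=.
  by case: eqP => [->|]; rewrite ?Cv ?andbF.
rewrite count_filter; move: eirr; rewrite /edge_rel.
elim: (U) => //= u s IH irr; have := IH irr.
case: eqP => [->|_] /=; first by have /= := irr v; rewrite /edge_rel => ->; case: (C v) => /=; lia.
by case: (C u); case: (_ \in E) => /=; lia.
Qed.

Lemma count_rest1 (C : pred V) : count C (rest1 U v) + C v = count C U.
Proof.
case Cv : (C v).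
  rewrite (count_D1 uU vU Cv) addn1; congr (_.+1); rewrite count_filter.
  by apply: eq_count.
rewrite addn0 count_filter; apply: eq_count => u /=.
by case: eqP => [->|]; rewrite ?Cv ?andbT.
Qed.

Lemma size_nbrs : size (nbrs E U v) = count (adj v) U.
Proof. by rewrite size_filter. Qed.

Lemma extend0 P Q : ubicover E (rest0 U v) P Q ->
  let P' := fun u => if u \in rest0 U v then P u else adj v u in
  let Q' := fun u => if u \in rest0 U v then Q u else adj v u in
  [/\ ubicover E U P' Q', ~~ P' v, ~~ Q' v &
    count P' U + count Q' U =
    count P (rest0 U v) + count Q (rest0 U v) + 2 * size (nbrs E U v)].
Proof.
move=> c P' Q'.
have vr : (v \in rest0 U v) = false by rewrite mem_rest0 eqxx andbF.
have ct R : count (fun u => if u \in rest0 U v then R u else adj v u) U =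
    count R (rest0 U v) + count (adj v) U.
  rewrite -(count_rest0 (fun u => if u \in rest0 U v then R u else adj v u)) vr eirr addn0.
  congr (_ + _); first by apply: eq_in_count => u ->.
  by apply: eq_count => u /=; rewrite mem_rest0; case a : (adj v u); rewrite ?andbF.
split; rewrite /P' /Q' ?vr ?eirr //; last by rewrite !ct size_nbrs; lia.
move=> a b aU bU ab; rewrite !mem_rest0 aU bU /=.
have [av|av] /= := eqVneq a v; first by rewrite av in ab; rewrite ab andbF orbT.
have [bv|bv] /= := eqVneq b v; first by rewrite bv esym in ab; rewrite ab.
case h1 : (adj v a) => //=; case h2 : (adj v b) => //=; first by rewrite orbT.
by apply: c => //; rewrite mem_rest0 ?aU ?bU ?av ?bv ?h1 ?h2.
Qed.

Lemma extend1 P Q : ubicover E (rest1 U v) P Q ->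
  let P' := fun u => (u == v) || P u in
  let Q' := fun u => (u == v) || Q u in
  ubicover E U P' Q' /\
    count P' U + count Q' U = count P (rest1 U v) + count Q (rest1 U v) + 2.
Proof.
move=> c P' Q'.
have ct R : count (fun u => (u == v) || R u) U = count R (rest1 U v) + 1.
  rewrite -(count_rest1 (fun u => (u == v) || R u)) eqxx /=; congr (_ + _).
  by apply: eq_in_count => u; rewrite mem_rest1 => /andP[_ /negbTE ->].
split; last by rewrite /P' /Q' !ct; lia.
move=> a b aU bU ab; rewrite /P' /Q'.
have [av|av] /= := eqVneq a v => //.
have [bv|bv] /= := eqVneq b v; first by rewrite orbT.
by apply: c => //; rewrite mem_rest1 ?aU ?bU ?av ?bv.
Qed.

Lemma uniq_rest0 : uniq (rest0 U v). Proof. exact: filter_uniq. Qed.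
Lemma uniq_rest1 : uniq (rest1 U v). Proof. exact: filter_uniq. Qed.

Lemma lpv_rest0 : lpv E U <= lpv E (rest0 U v) + 4 * size (nbrs E U v).
Proof.
have [P [Q [c eq]]] := lpv_strong esym uniq_rest0.
have [c' _ _ ct] := extend0 c; have := lpv_weak esym uU c'; rewrite ct; lia.
Qed.

Lemma lpv_rest1 : lpv E U <= lpv E (rest1 U v) + 4.
Proof.
have [P [Q [c eq]]] := lpv_strong esym uniq_rest1.
have [c' ct] := extend1 c; have := lpv_weak esym uU c'; rewrite ct; lia.
Qed.

(** The equality makes the extension of an optimum of [rest0 U v] optimal on [U]. It has the value 0
    at [v], and [persist] carries this over to an integral cover. *)
Lemma persist0 C : lpv E U = lpv E (rest0 U v) + 4 * size (nbrs E U v) -> covers U C ->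
  exists C', [/\ covers U C', ~~ C' v & count C' U <= count C U].
Proof.
move=> eqL cC; have [P [Q [c eq]]] := lpv_strong esym uniq_rest0.
have [c' nP nQ ct] := extend0 c.
have [|h1 h2] := persist esym uU c' _ cC; first by rewrite ct eqL; lia.
by eexists; split; [exact: h1 | cbv beta; rewrite (negbTE nP) (negbTE nQ) /= andbF | exact: h2].
Qed.

Lemma persist1 C : lpv E U = lpv E (rest1 U v) + 4 -> covers U C ->
  exists C', [/\ covers U C', C' v & count C' U <= count C U].
Proof.
move=> eqL cC; have [P [Q [c eq]]] := lpv_strong esym uniq_rest1.
have [c' ct] := extend1 c.
have [|h1 h2] := persist esym uU c' _ cC; first by rewrite ct eqL; lia.
by eexists; split; [exact: h1 | cbv beta; rewrite eqxx orbT | exact: h2].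
Qed.

Lemma covers0 C : covers U C -> ~~ C v -> forall u, u \in U -> adj v u -> C u.
Proof. by move=> cC nv u uUU a; have := cC v u vU uUU a; rewrite (negbTE nv). Qed.

Lemma count_cover0 C : covers U C -> ~~ C v ->
  count C (rest0 U v) + size (nbrs E U v) = count C U.
Proof.
move=> cC nv; rewrite -(count_rest0 C) (negbTE nv) addn0 size_nbrs; congr (_ + _).
apply: eq_in_count => u uUU /=; case a : (adj v u); rewrite ?andbF ?andbT //.
by rewrite (covers0 cC nv uUU a).
Qed.

Lemma count_cover1 (C : pred V) : C v -> count C (rest1 U v) + 1 = count C U.
Proof. by move=> Cv; rewrite -(count_rest1 C) Cv. Qed.

Lemma lpv_even : ~~ odd (lpv E U).
Proof. by have [P [Q [_ <-]]] := lpv_strong esym uU; rewrite mul2n odd_double. Qed.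

End Step.

(** Both sides are even, by half-integrality, so a strict inequality leaves a gap of 2, which is
    half a unit of the fractional optimum. *)
Lemma lpv_rest_odd U v : uniq U -> v \in U -> lpv E U <> lpv E (rest1 U v) + 4 ->
  lpv E U + 2 <= lpv E (rest1 U v) + 4.
Proof.
move=> uU vU ne; have := lpv_rest1 uU vU.
by have := lpv_even uU; have := lpv_even (uniq_rest1 v uU); lia.
Qed.

Lemma lpv_rest_odd0 U v : uniq U -> v \in U ->
  lpv E U <> lpv E (rest0 U v) + 4 * size (nbrs E U v) ->
  lpv E U + 2 <= lpv E (rest0 U v) + 4 * size (nbrs E U v).
Proof.
move=> uU vU ne; have := lpv_rest0 uU vU.
by have := lpv_even uU; have := lpv_even (uniq_rest0 v uU); lia.
Qed.

(** The excess [4 * count C U - lpv E U] pays for the bits, two units each: a free step does not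
    raise it and a branching step lowers it by at least 2. The suffix [ex] stands for bits left
    unread and will serve as padding. *)
Lemma vc_complete vs U S C : {subset U <= vs} -> uniq U -> {subset U <= W} ->
  {subset S <= W} -> covers U C ->
  exists b, 2 * size b + lpv E U <= 4 * count C U /\ forall ex,
    let S' := (foldl (vc_step W E) (U, (S, b ++ ex)) vs).2.1 in
    [/\ {subset S <= S'}, covers U (mem S') & size S' <= size S + count C U].
Proof.
elim: vs U S C => [|v vs IH] U S C Uvs uU UW SW cC.
  have U0 : U = [::] by case: (U) Uvs => // u s /(_ u (mem_head _ _)).
  exists [::]; split; last by move=> ex /=; split => //; [rewrite U0 | lia].
  have := @lpv_weak _ E esym U uU pred0 pred0; rewrite U0 /= => h.
  by have := h (fun u v h => False_ind _ (notF h)); lia.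
have [vU|vU] := boolP (v \in U); last first.
  have [|b [h1 h2]] := IH U S C _ uU UW SW cC.
    by move=> u uUU; have := Uvs u uUU; rewrite inE => /predU1P[e|//]; rewrite -e uUU in vU.
  by exists b; split => // ex; rewrite /= vc_stepE (negbTE vU); apply: h2.
have S0 : {subset S <= add0 U S v} by move=> u uS; rewrite mem_filter uS SW.
have S1 : {subset S <= add1 S v} by move=> u uS; rewrite mem_filter uS SW.
have IH0 C' : covers U C' -> ~~ C' v -> exists b,
    2 * size b + lpv E (rest0 U v) <= 4 * count C' (rest0 U v) /\ forall ex,
    let S' := (foldl (vc_step W E) (rest0 U v, (add0 U S v, b ++ ex)) vs).2.1 in
    [/\ {subset S <= S'}, covers U (mem S') & size S' <= size S + count C' U].
  move=> cC' nv; have [||||b [h1 h2]] := IH (rest0 U v) (add0 U S v) C' _ (uniq_rest0 v uU).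
  - move=> u; rewrite mem_rest0 => /and3P[/Uvs]; rewrite inE => /predU1P[->|//].
    by rewrite eqxx.
  - by move=> u; rewrite mem_rest0 => /and3P[/UW].
  - by move=> u; rewrite mem_filter => /andP[].
  - by move=> a b; rewrite !mem_rest0 => /and3P[aU _ _] /and3P[bU _ _]; apply: cC'.
  exists b; split => // ex; have [k1 k2 k3] := h2 ex; split.
  - by move=> u /S0 /k1.
  - have nS u : u \in U -> adj v u -> u \in (foldl (vc_step W E) (rest0 U v, (add0 U S v, b ++ ex)) vs).2.1.
      by move=> uUU a; apply: k1; rewrite mem_filter mem_nbrs uUU a orbT UW.
    move=> a c aU cU ac /=.
    have [av|av] := eqVneq a v; first by rewrite av in ac; rewrite (nS c) ?orbT.
    have [cv|cv] := eqVneq c v; first by rewrite cv esym in ac; rewrite (nS a).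
    have [ha|ha] := boolP (adj v a); first by rewrite (nS a).
    have [hc|hc] := boolP (adj v c); first by rewrite (nS c) ?orbT.
    by apply: k2 => //; rewrite mem_rest0 ?aU ?cU ?av ?cv ?ha ?hc.
  - apply: leq_trans k3 _; rewrite -(count_cover0 uU vU cC' nv).
    by have := size_add S (nbrs E U v); rewrite -/(add0 U S v); lia.
have IH1 C' : covers U C' -> C' v -> exists b,
    2 * size b + lpv E (rest1 U v) <= 4 * count C' (rest1 U v) /\ forall ex,
    let S' := (foldl (vc_step W E) (rest1 U v, (add1 S v, b ++ ex)) vs).2.1 in
    [/\ {subset S <= S'}, covers U (mem S') & size S' <= size S + count C' U].
  move=> cC' Cv; have [||||b [h1 h2]] := IH (rest1 U v) (add1 S v) C' _ (uniq_rest1 v uU).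
  - move=> u; rewrite mem_rest1 => /andP[/Uvs]; rewrite inE => /predU1P[->|//].
    by rewrite eqxx.
  - by move=> u; rewrite mem_rest1 => /andP[/UW].
  - by move=> u; rewrite mem_filter => /andP[].
  - by move=> a b; rewrite !mem_rest1 => /andP[aU _] /andP[bU _]; apply: cC'.
  exists b; split => // ex; have [k1 k2 k3] := h2 ex; split.
  - by move=> u /S1 /k1.
  - have nS : v \in (foldl (vc_step W E) (rest1 U v, (add1 S v, b ++ ex)) vs).2.1.
      by apply: k1; rewrite mem_filter eqxx orbT UW.
    move=> a c aU cU ac /=.
    have [->|av] := eqVneq a v; first by rewrite nS.
    have [->|cv] := eqVneq c v; first by rewrite nS orbT.
    by apply: k2 => //; rewrite mem_rest1 ?aU ?cU ?av ?cv.
  - apply: leq_trans k3 _; rewrite -(count_cover1 uU vU Cv).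
    have := size_add S [:: v]; rewrite /= (@eq_filter _ _ (fun u => (u \in S) || (u == v))).
      by rewrite -/(add1 S v); lia.
    by move=> u; rewrite inE.
(* In a free step [C] may disagree with the choice made; persistency replaces it by a cover that
   agrees and is no larger. *)
have [e0|/eqP ne0] := eqVneq (lpv E U) (lpv E (rest0 U v) + 4 * size (nbrs E U v)).
  have [C' [cC' nv le]] := persist0 uU vU e0 cC.
  have [b [h1 h2]] := IH0 C' cC' nv; exists b; split.
    by have := count_cover0 uU vU cC' nv; lia.
  move=> ex; rewrite /= vc_stepE vU e0 eqxx; have [k1 k2 k3] := h2 ex; split => //.
  by apply: leq_trans k3 _; lia.
have [e1|/eqP ne1] := eqVneq (lpv E U) (lpv E (rest1 U v) + 4).
  have [C' [cC' Cv le]] := persist1 uU vU e1 cC.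
  have [b [h1 h2]] := IH1 C' cC' Cv; exists b; split.
    by have := count_cover1 uU vU Cv; lia.
  move=> ex; rewrite /= vc_stepE vU; case: eqP => // _; rewrite e1 eqxx.
  have [k1 k2 k3] := h2 ex; split => //; by apply: leq_trans k3 _; lia.
(* In a branching step the bit is dictated by whether [C] contains [v], and either choice gains 2
   units. *)
have l0 := lpv_rest_odd0 uU vU ne0; have l1 := lpv_rest_odd uU vU ne1.
have [Cv|nv] := boolP (C v).
  have [b [h1 h2]] := IH1 C cC Cv; exists (true :: b); split.
    by have := count_cover1 uU vU Cv => /=; lia.
  by move=> ex; rewrite /= vc_stepE vU; case: eqP => // _; case: eqP => // _ /=; apply: h2.
have [b [h1 h2]] := IH0 C cC nv; exists (false :: b); split.
  by have := count_cover0 uU vU cC nv => /=; lia.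
by move=> ex; rewrite /= vc_stepE vU; case: eqP => // _; case: eqP => // _ /=; apply: h2.
Qed.

Hypothesis EW : {in E, forall p, (p.1 \in W) && (p.2 \in W)}.

(** From [2 * size b + lpv <= 4 * count C W] and [2 * size (maxmatch W E) <= lpv] it follows that
    [size b <= 2k]; zeros fill the string up to the exact length. *)
Lemma vc_accept_complete C k : covers W C -> 2 * count C W <= size (maxmatch W E) + k + k ->
  exists2 b, size b = k + k & vc_accept W E b.
Proof.
move=> cC le; have [|||||b [h1 h2]] := @vc_complete W W [::] C => //.
have h3 := lpv_matching esym eirr uW.
have sb : size b <= k + k by lia.
exists (b ++ nseq (k + k - size b) false); first by rewrite size_cat size_nseq subnKC.
have [_ k2 k3] := h2 (nseq (k + k - size b) false).
rewrite /vc_accept -/(vc_run W E _) size_cat size_nseq subnKC //.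
have {}k3 : size (vc_run W E (b ++ nseq (k + k - size b) false)) <= count C W by exact: k3.
apply/andP; split; last by rewrite -addnA in le; lia.
by apply/allP => -[u v] uv; have /andP[/= uWW vWW] := EW uv; apply: k2.
Qed.

End VertexCoverSearch.

(** * Graphs on ordinals *)

Section Link.
Variables (n : nat) (e : rel 'I_n) (E : seq (nat * nat)).
Hypotheses (esym : symmetric e) (eirr : irreflexive e).
Hypothesis EP : forall i j : nat,
  reflect (exists u v : 'I_n, [/\ i = val u, j = val v & e u v]) ((i, j) \in E).
Notation W := (iota 0 n).
Notation adj := (edge_rel E).

Lemma adjE (u v : 'I_n) : adj (val u) (val v) = e u v.
Proof.
apply/(EP (val u) (val v))/idP => [[u' [v' [/val_inj -> /val_inj ->]]] //|uv].
by exists u, v.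
Qed.

Lemma adj_ord i j : adj i j -> exists u v : 'I_n, [/\ i = val u, j = val v & e u v].
Proof. by move/EP. Qed.

Lemma adj_sym : symmetric adj.
Proof.
have H i j : adj i j -> adj j i.
  by move=> /adj_ord[u [v [-> -> uv]]]; rewrite adjE esym.
by move=> i j; apply/idP/idP; apply: H.
Qed.

Lemma adj_irr : irreflexive adj.
Proof. by move=> i; apply/negP => /adj_ord[u [v [-> /val_inj ->]]]; rewrite eirr. Qed.

Lemma EW : {in E, forall p, (p.1 \in W) && (p.2 \in W)}.
Proof.
move=> [i j] /EP[u [v [-> -> _]]] /=; by rewrite !mem_iota /= !add0n !ltn_ord.
Qed.

Lemma count_ord (P : pred nat) : count P W = #|[set u : 'I_n | P u]|.
Proof. by rewrite -val_enum_ord count_map cardsE cardE -size_filter enumT. Qed.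

Lemma is_edgeP f : reflect (exists u v, e u v /\ f = [set u; v]) (is_edge e f).
Proof.
apply: (iffP existsP) => [[u /existsP[v /andP[uv /eqP ->]]]|[u [v [uv ->]]]].
  by exists u, v.
by exists u; apply/existsP; exists v; rewrite uv eqxx.
Qed.

Lemma matching_cover M : is_matching e M -> #|cover M| = 2 * #|M|.
Proof.
move=> /andP[/forall_inP edges /forall_inP disj].
have tM : trivIset M.
  apply/trivIsetP => f f' fM f'M ne.
  by have /forall_inP /(_ f' f'M) := disj f fM; rewrite ne.
rewrite -(eqP tM) (eq_bigr (fun _ => 2)) ?sum_nat_const 1?mulnC // => f /edges /is_edgeP[u [v [uv ->]]].
by rewrite cards2; case: eqP uv => // ->; rewrite eirr.
Qed.

(** Both sides count covered vertices: the list of pairs turns into a set of disjoint edges, and a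
    maximum set of disjoint edges into a perfect matching of the vertices that it covers. *)
Lemma size_maxmatch : size (maxmatch W E) = 2 * mu e.
Proof.
have [mM mx] := maxmatch_spec adj_sym adj_irr (iota_uniq 0 n).
set M := maxmatch W E in mM mx *.
rewrite (size_matching (iota_uniq 0 n) (uniq_maxmatch _ (iota_uniq 0 n)) mM) -/M.
apply/eqP; rewrite eqn_leq; apply/andP; split.
  pose Ms := [set f : {set 'I_n} | [exists u, exists v, ((val u, val v) \in M) && (f == [set u; v])]].
  have MsP f : reflect (exists u v : 'I_n, (val u, val v) \in M /\ f = [set u; v]) (f \in Ms).
    rewrite inE; apply: (iffP existsP) => [[u /existsP[v /andP[uv /eqP ->]]]|[u [v [uv ->]]]].
      by exists u, v.
    by exists u; apply/existsP; exists v; rewrite uv eqxx.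
  have mMs : is_matching e Ms.
    apply/andP; split.
      apply/forall_inP => f /MsP[u [v [uv ->]]]; apply/is_edgeP; exists u, v; split => //.
      by have [_ _] := mok_adj mM uv; rewrite adjE.
    apply/forall_inP => f /MsP[u [v [uv ->]]]; apply/forall_inP => f' /MsP[u' [v' [uv' ->]]].
    apply/implyP; apply: contraNT => /pred0Pn[x /andP[]].
    have vu := mok_sym mM uv; have vu' := mok_sym mM uv'.
    have F (a b c : 'I_n) : (val a, val b) \in M -> (val a, val c) \in M -> b = c.
      by move=> h1 h2; apply: val_inj; exact: (mok_fun mM h1 h2).
    rewrite !inE => /orP[]/eqP -> /orP[]/eqP h; subst.
    - by rewrite (F _ _ _ uv uv').
    - by rewrite (F _ _ _ uv vu') setUC.
    - by rewrite (F _ _ _ vu uv') setUC.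
    - by rewrite (F _ _ _ vu vu').
  have <- : #|cover Ms| = count (cv W M) W.
    rewrite count_ord; apply: eq_card => u; rewrite inE; apply/bigcupP/(cvP _ mM).
      move=> [f /MsP[a [b [ab ->]]]]; rewrite !inE => /orP[]/eqP->; first by exists (val b).
      by exists (val a); apply: (mok_sym mM ab).
    move=> [j uj]; have [_ jW _] := mok_adj mM uj.
    have jn : j < n by rewrite mem_iota in jW.
    exists [set u; Ordinal jn]; last by rewrite !inE eqxx.
    by apply/MsP; exists u, (Ordinal jn).
  by rewrite (matching_cover mMs) leq_mul2l /= /mu; apply: leq_bigmax_cond.
have [Ms mMs ->] : {Ms | is_matching e Ms & mu e = #|Ms|}.
  rewrite /mu; have [|Ms h1 h2] := @eq_bigmax_cond _ (is_matching e) (fun M => #|M|).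
    apply/card_gt0P; exists set0; rewrite unfold_in; apply/andP; split; apply/forall_inP => f;
      by rewrite inE.
  by exists Ms.
rewrite -(matching_cover mMs).
pose Y (i : nat) := [exists u : 'I_n, (val u == i) && (u \in cover Ms)].
have YE (u : 'I_n) : Y u = (u \in cover Ms).
  apply/existsP/idP => [[u' /andP[/eqP/val_inj -> ]] //|uc]; by exists u; rewrite eqxx.
have -> : #|cover Ms| = count Y W by rewrite count_ord; apply: eq_card => u; rewrite inE YE.
apply: mx.
  by move=> i /existsP[u /andP[/eqP <- _]]; rewrite /= mem_iota /= add0n ltn_ord.
have /andP[/forall_inP edges /forall_inP disj] := mMs.
pose R (u v : 'I_n) := e u v && ([set u; v] \in Ms).
have Rex u : u \in cover Ms -> exists v, R u v.
  move=> /bigcupP[f fM uf]; have [a [b [ab fE]]] := is_edgeP _ (edges f fM).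
  move: uf; rewrite fE !inE => /orP[]/eqP ->; [exists b | exists a]; rewrite /R.
    by rewrite ab -fE.
  by rewrite esym ab setUC -fE.
have Rsym u v : R u v -> R v u by rewrite /R esym setUC.
have Rfun u v w : R u v -> R u w -> v = w.
  move=> /andP[uv uvM] /andP[uw uwM]; have /forall_inP /(_ _ uwM) := disj _ uvM.
  have [eq _|_ /=] := eqVneq [set u; v] [set u; w].
    have : v \in [set u; w] by rewrite -eq !inE eqxx orbT.
    rewrite !inE => /orP[/eqP vu|/eqP //]; by rewrite vu eirr in uv.
  by move=> /pred0P /(_ u); rewrite /= !inE eqxx.
pose g (u : 'I_n) := odflt u [pick v | R u v].
have gP u : u \in cover Ms -> R u (g u).
  by move=> /Rex[v uv]; rewrite /g; case: pickP => //= /(_ v); rewrite uv.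
pose f i := if insub i is Some u then val (g u) else i.
exists f => i /existsP[u /andP[/eqP <- uc]]; have Ru := gP u uc.
have fE (w : 'I_n) : f w = val (g w) by rewrite /f valK.
have cg : g u \in cover Ms.
  by case/andP: Ru => _ h; apply/bigcupP; exists [set u; g u] => //; rewrite !inE eqxx orbT.
rewrite !fE YE adjE cg; split => //; first by case/andP: Ru.
by congr val; apply: (Rfun (g u)); [exact: gP | exact: Rsym].
Qed.

Lemma vc_link k : vc_above_mm e k <-> exists2 b, size b = k + k & vc_accept W E b.
Proof.
split.
  move=> /existsP[S /andP[/forallP cS le]].
  pose C (i : nat) := [exists u : 'I_n, (val u == i) && (u \in S)].
  have CE (u : 'I_n) : C u = (u \in S).
    apply/existsP/idP => [[u' /andP[/eqP/val_inj -> ]] //|uc]; by exists u; rewrite eqxx.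
  apply: (vc_accept_complete adj_sym adj_irr (iota_uniq 0 n) EW (C := C)).
    move=> i j _ _ /adj_ord[u [v [-> -> uv]]]; rewrite !CE.
    by have /forallP /(_ v) := cS u; rewrite uv.
  have -> : count C W = #|S| by rewrite count_ord; apply: eq_card => u; rewrite inE CE.
  by rewrite size_maxmatch; lia.
move=> [b sb /andP[/allP cov le]].
set S := vc_run W E b in cov le.
apply/existsP; exists [set u : 'I_n | val u \in S]; apply/andP; split.
  apply/forallP => u; apply/forallP => v; apply/implyP => uv; rewrite !inE.
  by apply: (cov (val u, val v)); apply/EP; exists u, v.
have : #|[set u : 'I_n | val u \in S]| <= size S.
  rewrite -count_ord -size_filter; apply: uniq_leq_size; first by rewrite filter_uniq ?iota_uniq.
  by move=> z; rewrite mem_filter => /andP[].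
by rewrite size_maxmatch sb in le => h; apply: leq_trans h _; lia.
Qed.

End Link.

(** * Decoding the input *)

Notation symbol := (bool * bool)%type.
Definition sep : symbol := (true, true).

Definition upto (x : seq symbol) : seq symbol :=
  foldr (fun s z => if s == sep then [::] else s :: z) [::] x.

Definition iota_of (T : Type) (s : seq T) : seq nat := rev (foldl (fun z _ => size z :: z) [::] s).

(** An integer square root: out of the [n * n] matrix entries, [i < n] is recovered as
    [(i + 1)^2 <= n * n], the square being the length of a list of pairs. *)
Definition vertices (pre : seq symbol) : seq nat :=
  [seq i <- iota_of pre | size (pairs [seq j <- iota_of pre | j <= i]) <= size pre].

Definition edge_step (st : seq (nat * nat) * seq (nat * nat)) (s : symbol) :=
  if nilp st.1 then st
  else (behead st.1, if s == (true, false) then head (0, 0) st.1 :: st.2 else st.2).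

Definition edges (pre : seq symbol) : seq (nat * nat) :=
  (foldl edge_step (pairs (vertices pre), [::]) pre).2.

Definition check (p : seq symbol * seq bool) : bool :=
  vc_accept (vertices (upto p.1)) (edges (upto p.1)) p.2.

(** Read backwards, the input starts with [k] in unary; taken twice it gives the first of the
    strings of length [2k]. *)
Definition zeros (x : seq symbol) : seq bool :=
  [seq false | _ <- upto (rev x) ++ upto (rev x)].

Section DecodeFP.
Context {X : Type} {eX : Enc X}.

Lemma sz_foldr_upto x : sz (upto x) <= sz x.
Proof.
elim: x => //= s x IH; rewrite sz_cons; case: ifP => _; last by rewrite sz_cons; lia.
by rewrite sz_nil; lia.
Qed.

Lemma FP_upto (x : X -> seq symbol) : FP x -> FP (fun y => upto (x y)).
Proof.
move=> Fx; have [b Hb] := FP_size Fx.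
apply: (@FP_foldr _ _ _ _ _ _ (fun _ s z => if s == sep then [::] else s :: z) x (fun=> [::]) (pb b)) => //.
- by fp.
- by fp.
- exact: pbd_pb.
- move=> y n; apply: leq_trans (Hb y); apply: leq_trans (sz_drop n _); exact: sz_foldr_upto.
Qed.

Lemma iota_ofE T (s : seq T) : iota_of s = iota 0 (size s).
Proof.
rewrite /iota_of -[RHS]revK; congr rev; elim/last_ind: s => // s x IH.
by rewrite -cats1 foldl_cat /= IH size_cat addn1 size_rev size_iota -addn1 iotaD rev_cat.
Qed.

Lemma sz_iota m i k : i + k <= m -> sz (iota i k) <= (2 * m + 2) * k + 1.
Proof.
elim: k i => [|k IH] i le; first by rewrite muln0.
rewrite [iota _ _]/= sz_cons sz_nat mulnS.
by have := IH i.+1; rewrite addSnnS => /(_ le); lia.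
Qed.

Lemma FP_iota_of T {eT : Enc T} (s : X -> seq T) : FP s -> FP (fun y => iota_of (s y)).
Proof.
move=> Fs; have [b Hb] := FP_size Fs; apply: FP_rev.
apply: (@FP_foldl _ _ _ _ _ _ (fun _ z _ => size z :: z) s (fun=> [::])
  (fun n => (2 * pb b n + 2) * pb b n + 1)).
- by fp.
- by [].
- by fp.
- by pbd_tac.
- move=> y n; set t := take n _.
  have -> : foldl (fun z _ => size z :: z) [::] t = rev (iota_of t) by rewrite /iota_of revK.
  rewrite sz_rev iota_ofE; apply: leq_trans (sz_iota (leqnn _)) _.
  have h : size t <= pb b (sz y).
    by apply: leq_trans (size_le_sz t) (leq_trans (sz_take _ _) (Hb y)).
  by rewrite leq_add2r leq_mul // leq_add2r leq_mul2l.
Qed.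

End DecodeFP.

Ltac fp_hook ::= first [ fp_ctx |
  match goal with
  | |- FP (fun x => pairs (@?W x)) => apply: (FP_pairs (W := W))
  | |- FP (fun x => iota_of (@?s x)) => apply: (FP_iota_of (s := s))
  end ].

Section DecodeFP2.
Context {X : Type} {eX : Enc X}.

Lemma FP_vertices (x : X -> seq symbol) : FP x -> FP (fun y => vertices (x y)).
Proof. by move=> Fx; have FI := FP_iota_of Fx; rewrite /vertices; fp. Qed.

Lemma FP_edges (x : X -> seq symbol) : FP x -> FP (fun y => edges (x y)).
Proof.
move=> Fx; rewrite /edges; apply: FP_prod2.
have FV := FP_vertices Fx; have FW : FP (fun y => pairs (vertices (x y))) by fp.
have [b Hb] := FP_size FW.
apply: (@FP_foldl_inv _ _ _ _ _ _ (fun _ => edge_step) x (fun y => (pairs (vertices (x y)), [::]))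
  (fun y st => sz st.1 + sz st.2 <= sz (pairs (vertices (x y))) + 1) (fun n => pb b n + 2)).
- by rewrite /edge_step; fp.
- by [].
- by fp.
- by pbd_tac.
- by move=> y /=; rewrite sz_nil.
- move=> y [s t] c /= I; rewrite /edge_step; case: s I => [|p s] //= I.
  by move: I; rewrite sz_cons; case: ifP => _; rewrite ?sz_cons; lia.
- by move=> y [s t] I; rewrite sz_pair addn2 ltnS; apply: leq_trans I _; rewrite addn1 ltnS; apply: Hb.
Qed.

Lemma FP_zeros (x : X -> seq symbol) : FP x -> FP (fun y => zeros (x y)).
Proof.
move=> Fx; have FR : FP (fun y => rev (x y)) by fp.
by have FU := FP_upto FR; rewrite /zeros; fp.
Qed.

End DecodeFP2.

Lemma FP_check : FP check.
Proof.
have F1 : FP (fun p : seq symbol * seq bool => p.1) by exact: FP_fst.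
have FU := FP_upto F1.
apply: FP_vc_accept; [exact: FP_vertices | exact: FP_edges | exact: FP_snd].
Qed.

Definition decode_word (w : seq nat) : seq symbol := [seq (1 < a, odd a) | a <- w].

Section Decode.
Variables (n : nat) (e : rel 'I_n) (k : nat).

Let sy (b : bool) : symbol := if b then (true, false) else (false, true).
Let pre := [seq sy (e i j) | i <- enum 'I_n, j <- enum 'I_n].

Lemma decode_encode : decode_word (encode e k) = pre ++ sep :: nseq k (true, false).
Proof.
rewrite /decode_word /encode map_cat /= map_nseq; congr (_ ++ _).
rewrite map_allpairs; apply: eq_allpairs => i j.
by rewrite /sy; case: (e i j).
Qed.

Lemma upto_cat (p q : seq symbol) : sep \notin p -> upto (p ++ sep :: q) = p.
Proof.
elim: p => [|s p IH] //=.
by rewrite inE negb_or eq_sym => /andP[/negbTE -> /IH ->].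
Qed.

Lemma upto_pre : upto (decode_word (encode e k)) = pre.
Proof.
rewrite decode_encode upto_cat //; apply/allpairsPdep => -[i [j [_ _]]].
by rewrite /sy; case: (e i j).
Qed.

Lemma zeros_encode : zeros (decode_word (encode e k)) = nseq (k + k) false.
Proof.
rewrite /zeros decode_encode rev_cat rev_cons cat_rcons rev_nseq.
rewrite upto_cat; last by rewrite mem_nseq andbF.
by rewrite -nseqD map_nseq.
Qed.

Lemma size_pairs (T : eqType) (s : seq T) : size (pairs s) = size s * size s.
Proof. exact: size_allpairs. Qed.

Lemma size_pre : size pre = n * n.
Proof. by rewrite size_allpairs -cardE card_ord. Qed.

Lemma vertices_pre : vertices pre = iota 0 n.
Proof.
rewrite /vertices iota_ofE size_pre.
have fl m N : m <= N -> [seq j <- iota 0 N | j < m] = iota 0 m.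
  move=> le; rewrite -{1}(subnKC le) iotaD filter_cat add0n.
  rewrite (@eq_in_filter _ _ predT) ?filter_predT; last by move=> j; rewrite mem_iota.
  rewrite (@eq_in_filter _ _ pred0) ?filter_pred0 ?cats0 // => j.
  by rewrite mem_iota => /andP[le' _]; apply/negbTE; rewrite -leqNgt.
rewrite (@eq_in_filter _ _ (fun i => i < n)); first by apply: fl; case: (n) => // m; nia.
move=> i; rewrite mem_iota add0n /= => iN.
have -> : [seq j <- iota 0 (n * n) | j <= i] = iota 0 i.+1.
  by rewrite -(fl i.+1 (n * n)) //.
rewrite size_pairs size_iota; apply/idP/idP => h; last by apply: leq_mul.
by rewrite ltnNge; apply/negP => le; have := leq_mul le le; nia.
Qed.

Lemma edges_fold (h : pred (nat * nat)) (s out : seq (nat * nat)) :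
  foldl edge_step (s, out) [seq sy (h p) | p <- s] = ([::], rev [seq p <- s | h p] ++ out).
Proof.
elim: s out => //= p s IH out; rewrite /edge_step /= -/edge_step IH.
by rewrite /sy; case: (h p) => /=; rewrite ?rev_cons ?cat_rcons.
Qed.

Lemma edges_pre i j :
  reflect (exists u v : 'I_n, [/\ i = val u, j = val v & e u v]) ((i, j) \in edges pre).
Proof.
pose h (p : nat * nat) := [exists u : 'I_n, exists v : 'I_n, (p == (val u, val v)) && e u v].
have hE (u v : 'I_n) : h (val u, val v) = e u v.
  apply/existsP/idP => [[u' /existsP[v' /andP[/eqP[/val_inj -> /val_inj ->]]]] //|uv].
  by exists u; apply/existsP; exists v; rewrite eqxx.
have preE : pre = [seq sy (h p) | p <- pairs (iota 0 n)].
  rewrite -val_enum_ord /pairs map_flatten -map_comp -map_comp /pre; apply: (congr1 flatten).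
  by apply: eq_map => u /=; rewrite -!map_comp; apply: eq_map => v /=; rewrite hE.
rewrite /edges vertices_pre preE edges_fold /= cats0 mem_rev mem_filter mem_pairs /=.
apply: (iffP idP) => [/andP[/existsP[u /existsP[v /andP[/eqP[-> ->] uv]]] _]|[u [v [-> -> uv]]]].
  by exists u, v.
by rewrite hE uv !mem_iota /= !add0n !ltn_ord.
Qed.

Lemma check_encode b : symmetric e -> irreflexive e ->
  check (decode_word (encode e k), b) = vc_accept (iota 0 n) (edges pre) b.
Proof. by rewrite /check /= upto_pre vertices_pre. Qed.

Lemma vc_check : symmetric e -> irreflexive e ->
  vc_above_mm e k <-> exists2 b, size b = k + k & check (decode_word (encode e k), b).
Proof.
move=> esym eirr; rewrite (vc_link esym eirr edges_pre k).
by split=> -[b sb]; [rewrite -check_encode // | rewrite check_encode //]; exists b.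
Qed.

Lemma sz_decode : sz (decode_word (encode e k)) <= 8 * (n * n + k + 1) + 1.
Proof.
have H (x : seq symbol) : sz x <= 8 * size x + 1.
  elim: x => //= -[a b] x IH; rewrite sz_cons sz_pair; have := sz_bool a; have := sz_bool b; lia.
apply: leq_trans (H _) _; rewrite decode_encode size_cat /= size_pre size_nseq; lia.
Qed.

End Decode.

(** * The search over all branching choices *)

Definition incr_step (c : bool) (st : bool * seq bool) : bool * seq bool :=
  if st.1 then (if c then (true, false :: st.2) else (false, true :: st.2))
  else (false, c :: st.2).

(* Most significant bit first. *)
Definition incr (b : seq bool) : seq bool := (foldr incr_step (true, [::]) b).2.

Fixpoint bval (b : seq bool) : nat := if b is c :: r then c * 2 ^ size r + bval r else 0.

Lemma bval_lt b : bval b < 2 ^ size b.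
Proof. by elim: b => //= c r IH; rewrite expnS; case: c; lia. Qed.

(** The first component is the carry. It survives exactly when all bits are 1, and the value then
    wraps round to 0. *)
Lemma incr_foldr b : let st := foldr incr_step (true, [::]) b in
  [/\ size st.2 = size b, st.1 = all id b & ~~ all id b -> bval st.2 = (bval b).+1] /\
  (all id b -> bval st.2 = 0).
Proof.
elim: b => //= c r [[s1 s2 s3] s4].
case: (foldr _ _ r) s1 s2 s3 s4 => [cr t] /= s1 -> s3 s4; rewrite /incr_step /=.
case h : (all id r); rewrite ?andbT ?andbF /=; last first.
  by split => //; split; rewrite /= ?s1 // => _; rewrite s3 ?h // addnS.
case: c => /=; split => //; try split; rewrite /= ?s1 ?s4 ?h // => _.
have : bval r = (2 ^ size r).-1; last by have := expn_gt0 2 (size r); lia.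
elim: r h {s1 s3 s4} => //= c r IH /andP[-> /IH ->].
by have := expn_gt0 2 (size r); rewrite expnS; lia.
Qed.

Lemma size_incr b : size (incr b) = size b.
Proof. by case: (incr_foldr b) => -[]. Qed.

Lemma bval_incr b : ~~ all id b -> bval (incr b) = (bval b).+1.
Proof. by case: (incr_foldr b) => -[_ _ h _]. Qed.

Lemma bval_all b : all id b -> (bval b).+1 = 2 ^ size b.
Proof. by elim: b => //= c r IH /andP[-> /IH h]; rewrite expnS; lia. Qed.

Lemma bval_inj b b' : size b = size b' -> bval b = bval b' -> b = b'.
Proof.
elim: b b' => [|c r IH] [|c' r'] //= [s] e.
have := bval_lt r; have := bval_lt r'; rewrite s in e *.
case: c e; case: c' => e h1 h2; try lia; rewrite (IH r') //; lia.
Qed.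

Lemma bval_zeros L : bval (nseq L false) = 0.
Proof. by elim: L. Qed.

Lemma sz_bits (b : seq bool) : sz b <= 4 * size b + 1.
Proof. by elim: b => //= c b IH; rewrite sz_cons; have := sz_bool c; lia. Qed.

Lemma FP_incr X {eX : Enc X} (b : X -> seq bool) : FP b -> FP (fun x => incr (b x)).
Proof.
move=> Fb; have [c Hc] := FP_size Fb; apply: FP_prod2.
apply: (@FP_foldr _ _ _ _ _ _ (fun _ => incr_step) b (fun=> (true, [::]))
  (fun n => 4 * pb c n + 5)) => //.
- by rewrite /incr_step; fp.
- by fp.
- by pbd_tac.
move=> x n; set r := drop n _.
have [[h _ _] _] := incr_foldr r; rewrite [foldr _ _ _]surjective_pairing sz_pair.
have := sz_bits (foldr incr_step (true, [::]) r).2; rewrite h.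
have := sz_bool (foldr incr_step (true, [::]) r).1.
have := leq_trans (size_le_sz r) (leq_trans (sz_drop n _) (Hc x)); lia.
Qed.

Definition state := (seq symbol * seq bool)%type.
Definition enc_state : Enc state := ltac:(unfold state; exact _).

(* One round of the exhaustive search over the branching choices; the two leading
   booleans say whether to stop and with which answer. *)
Definition search_round (s : state) : bool * (bool * state) :=
  if check s then (true, (true, s))
  else if all id s.2 then (true, (false, s))
  else (false, (false, (s.1, incr s.2))).

Lemma FP_search_round : FP search_round.
Proof.
have FI : FP (fun s : state => incr s.2) by apply: FP_incr; exact: FP_snd.
have FC := FP_check; rewrite /search_round; fp.
Qed.

Lemma FP_init : FP (fun x : seq symbol => (x, zeros x)).
Proof. by apply: FP_pair; [exact: FP_id | apply: FP_zeros; exact: FP_id]. Qed.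

Definition pop (j : nat) : cmd := Case j Skip Skip Skip.

Lemma ev_pop j s b l : s j = b :: l -> evT (pop j) s 2 (upd s j l).
Proof.
by rewrite /pop; case: b => e; [apply: (@evT_case _ _ _ _ _ true l 1) |
  apply: (@evT_case _ _ _ _ _ false l 1)] => //; apply: ev_skip.
Qed.

Section MainLoop.
Variables (cG : cmd) (m a : nat).
Hypotheses (m0 : 0 < m) (uG : uses cG m) (HG : computes cG m a search_round).

(* Register [m] is the loop flag, register [m.+1] receives the answer. *)
Definition body : cmd :=
  Seq cG (Seq (pop 0) (Case 0 Skip
    (Seq (pop 0) (Seq (pop 0) (Push m true)))
    (Seq (pop 0) (Seq (pop 0) (Seq (pop 0)
       (Case 0 Skip (Push m.+1 false) (Push m.+1 true))))))).

Lemma uses_body : uses body m.+2.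
Proof. by rewrite /= (@uses_mono _ m m.+2) //; lia. Qed.

Definition main_loop : cmd := Loop m Skip body.

Lemma body_continue (st : state) s : s 0 = ser (enc st) -> (forall j, 0 < j <= m -> s j = [::]) ->
  (search_round st).1 = false ->
  exists2 t, t <= pb a (sz st) + 9 &
    evT body s t (upd (upd s 0 (ser (enc (search_round st).2.2))) m [:: true]).
Proof.
move=> s0 sj; have [|t tle E] := HG s0; first by move=> j jm; apply: sj; lia.
have : ~~ (search_round st).1 -> (search_round st).2.1 = false.
  by rewrite /search_round; case: ifP => //; case: ifP.
case: (search_round st) E => [c [d st']] /= E cd c0; rewrite c0 /= in E cd.
rewrite {}cd // in E; exists (t + (2 + (2 + (2 + 1)).+1)); first by lia.
apply: ev_seq E _; set s1 := upd s 0 _.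
have e1 : s1 0 = true :: (ser (enc false) ++ ser (enc (false, st'))) by [].
apply: ev_seq (ev_pop e1) _; apply: (@evT_case _ _ _ _ _ false (ser (enc (false, st')))).
  by rewrite updE.
set s2 := upd _ 0 _.
have e2 : s2 0 = true :: (ser (enc false) ++ ser (enc st')) by [].
apply: ev_seq (ev_pop e2) _; apply: ev_seq.
  by apply: (@ev_pop _ _ false (ser (enc st'))); rewrite updE.
set s3 := upd _ 0 _; apply: ev_to (@ev_push predT m true s3 isT) _.
by rewrite /s3 /s2 /s1; store_eq; rewrite sj //; lia.
Qed.

Lemma body_stop (st : state) s : s 0 = ser (enc st) -> (forall j, 0 < j <= m -> s j = [::]) ->
  (search_round st).1 = true ->
  exists s' t, [/\ t <= pb a (sz st) + 12, evT body s t s', s' m = [::] &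
     s' m.+1 = (search_round st).2.1 :: s m.+1].
Proof.
move=> s0 sj; have [|t tle E] := HG s0; first by move=> j jm; apply: sj; lia.
case: (search_round st) E => [c [d st']] /= E c0; rewrite c0 in E.
set s1 := upd s 0 _ in E.
pose l := behead (ser (@enc bool enc_bool d)) ++ ser (@enc state enc_state st').
pose s2 := upd s1 0 l.
exists (upd s2 m.+1 (d :: s m.+1)), (t + (2 + (2 + (2 + (2 + 2))).+1)); split; first by lia.
- apply: ev_seq E _.
  have e1 : s1 0 = true :: ([:: true; false; false] ++ ser (enc (d, st'))) by [].
  apply: ev_seq (ev_pop e1) _; apply: evT_case; first by rewrite updE.
  apply: ev_seq; first by apply: ev_pop; rewrite updE.
  apply: ev_seq; first by apply: ev_pop; rewrite updE.
  apply: ev_seq; first by apply: ev_pop; rewrite updE.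
  apply: (@evT_case _ _ _ _ _ d l); first by rewrite updE /= /l; case: (d).
  set s3 := upd _ 0 l.
  apply: (@ev_to _ _ _ _ (upd s3 m.+1 (d :: s3 m.+1))).
    by case: (d); apply: ev_push.
  by rewrite /s3 /s2 /s1; store_eq.
- rewrite /s2 /s1 !updE; case: eqP => [|_]; first by lia.
  by case: eqP => [|_]; [lia | apply: sj; lia].
- by rewrite updE eqxx.
Qed.

Section Run.
Variables (x : seq symbol) (L : nat).
Let N := sz x + 4 * L + 2.
Let T := pb a N + 12.
Let B := N + T + 2.
Let ok := fun h => h <= B.

Lemma sz_state (b : seq bool) : size b = L -> sz (x, b) <= N.
Proof. by move=> sb; rewrite sz_pair; have := sz_bits b; rewrite sb /N; lia. Qed.

(** Induction on the number [i] of strings not yet tried. The height bound [B] does not depend on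
    [i]: each round starts from a state of size at most [N] and runs for at most [T] steps. This
    keeps the cost of a stack operation polynomial although the loop is exponentially long. *)
Lemma main_loop_run i (b : seq bool) s : 2 ^ L = bval b + i -> size b = L ->
  s 0 = ser (enc (x, b)) -> (forall j, 0 < j < m -> s j = [::]) -> s m = [:: true] ->
  s m.+1 = [::] ->
  exists s' t ans, [/\ t <= i * T.+1 + 1, ev ok main_loop s t s', s' m.+1 = [:: ans] &
    ans <-> exists b', [/\ size b' = L, bval b <= bval b' & check (x, b')]].
Proof.
elim: i b s => [|i IH] b s vi sb s0 sj sm sm1.
  by have := bval_lt b; rewrite sb; lia.
pose s1 := upd s m [::].
have s10 : s1 0 = ser (enc (x, b)) by rewrite /s1 updE; case: eqP => //; lia.
have s1j j : 0 < j <= m -> s1 j = [::].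
  by move=> jm; rewrite /s1 updE; case: eqP => // ne; apply: sj; lia.
have szN := sz_state sb; have pbN := pb_mono a szN.
have Hbound t' s' : evT body s1 t' s' -> t' <= T -> ev ok body s1 t' s'.
  move=> E tT; apply: (ev_bound E uses_body) => j jm; rewrite /B.
  have : size (s1 j) <= N; last by lia.
  case: j jm => [|j] jm; first by rewrite s10 -/(sz (x, b)).
  have [jm'|jm'] := leqP j.+1 m; first by rewrite s1j.
  have -> : j.+1 = m.+1 by lia.
  by rewrite /s1 updE sm1; case: eqP => // _; lia.
have okm : ok (size (s m)) by rewrite sm /ok /B /N /=; lia.
have ok0 : ok 0 by [].
have [r|r] := boolP (search_round (x, b)).1.
  have [s' [t [tle E s'm s'a]]] := body_stop s10 s1j r.
  have tT : t <= T by apply: leq_trans tle _; rewrite leq_add2r.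
  exists s', (t + 1).+1, (search_round (x, b)).2.1; split.
  - by rewrite mulSn; move: (i * T.+1) => w; lia.
  - apply: (ev_loop sm okm) (ev_loop0 _ _ s'm ok0).
    exact: Hbound E tT.
  - by rewrite s'a /s1 updE sm1; case: eqP => // _.
  move: r; rewrite /search_round; case: ifP => [h _|nh] /=.
    by split => // _; exists b.
  (* The string of ones has the largest value, so it was the last candidate. *)
  case: ifP => // al _ /=; split => // -[b' [sb' le cb']].
  have bb : b' = b.
    apply: bval_inj; first by rewrite sb' sb.
    by have := bval_all al; have := bval_lt b'; rewrite sb sb'; lia.
  by rewrite bb nh in cb'.
have [t tle E] := body_continue s10 s1j (negbTE r).
have tT : t <= T by apply: leq_trans tle _; apply: leq_add.
set s2 := upd _ m _ in E.
have [nc na rE] : [/\ check (x, b) = false, ~~ all id b & (search_round (x, b)).2.2 = (x, incr b)].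
  by move: r; rewrite /search_round; case: ifP => //; case: ifP => // ->.
have [||||||s' [t' [ans [t'le E' s'a ansP]]]] := IH (incr b) s2.
- by rewrite bval_incr //; lia.
- by rewrite size_incr.
- by rewrite /s2 updE; case: eqP => [|_]; [lia | rewrite updE rE].
- move=> j jm; rewrite /s2 !updE; case: eqP => [|_]; first by lia.
  by case: eqP => [|_]; [lia | apply: s1j; lia].
- by rewrite /s2 updE eqxx.
- by rewrite /s2 /s1 !updE; repeat (case: eqP => //; try lia).
exists s', (t + t').+1, ans; split => //.
- by rewrite mulSn; move: (i * T.+1) t'le => w t'le; lia.
- by apply: (ev_loop sm okm) E'; apply: Hbound E tT.
rewrite ansP; split=> -[b' [sb' le cb']]; exists b'; split => //.
  by move: le; rewrite bval_incr //; lia.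
rewrite bval_incr //; have [e|//] : bval b = bval b' \/ bval b < bval b' by lia.
by have bb : b = b'; [apply: bval_inj; rewrite ?sb' ?sb | rewrite -bb nc in cb'].
Qed.

End Run.
End MainLoop.

(** * Reading the input, the complete program, and its running time *)

Definition symbol_code (p : symbol) : seq bool := true :: ser (enc p).

(* Registers 0 and 1 hold the two bits of every input symbol, the last symbol on top. *)
Definition parse : cmd :=
  Seq (Push 2 false) (Seq
    (Loop 0 (Case 1 Skip (pushes 2 (symbol_code (false, false)))
                         (pushes 2 (symbol_code (false, true))))
            (Case 1 Skip (pushes 2 (symbol_code (true, false)))
                         (pushes 2 (symbol_code (true, true)))))
    (move 2 0 1)).

Lemma ev_parse (x : seq symbol) s : s 0 = rev (map fst x) -> s 1 = rev (map snd x) ->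
  s 2 = [::] ->
  exists2 t, t <= 11 * size x + 4 * sz x + 4 &
    evT parse s t (upd (upd s 0 (ser (enc x))) 1 [::]).
Proof.
move=> s0 s1 s2.
have main (y z : seq symbol) s' : s' 0 = rev (map fst y) -> s' 1 = rev (map snd y) ->
    s' 2 = ser (enc z) -> exists2 t, t <= 11 * size y + 1 &
    evT (Loop 0 (Case 1 Skip (pushes 2 (symbol_code (false, false)))
                         (pushes 2 (symbol_code (false, true))))
            (Case 1 Skip (pushes 2 (symbol_code (true, false)))
                         (pushes 2 (symbol_code (true, true))))) s' t
      (upd (upd (upd s' 0 [::]) 1 [::]) 2 (ser (enc (y ++ z)))).
  elim/last_ind: y z s' => [|y [h l] IH] z s' e0 e1 e2.
    by exists 1 => //; apply: ev_to (ev_loop0 _ _ e0 isT) _; store_eq.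
  rewrite !map_rcons !rev_rcons /= in e0 e1.
  pose s3 := upd (upd (upd s' 0 (rev (map fst y))) 1 (rev (map snd y))) 2 (symbol_code (h, l) ++ s' 2).
  have [|||t tle E] := IH ((h, l) :: z) s3; rewrite /s3 ?updE ?e2 //.
  pose w := (size (symbol_code (h, l))).+2.
  exists (w + t).+1.
    have : w <= 10 by rewrite /w; case: (h); case: (l).
    by rewrite size_rcons; lia.
  rewrite -cats1 -catA /=.
  apply: (evT_loop e0) (ev_to E _); last by rewrite /s3; store_eq.
  have P : evT (pushes 2 (symbol_code (h, l)))
      (upd (upd s' 0 (rev (map fst y))) 1 (rev (map snd y))) w.-1 s3.
    by apply: ev_to (ev_pushes _ _ _) _; rewrite /s3; store_eq.
  rewrite (_ : w = w.-1.+1) //; move: (w.-1) P => u P.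
  case: (h) e0 P e1 => e0 P e1.
    apply: (@evT_case _ _ _ _ _ l (rev (map snd y))); first by rewrite updE.
    by case: (l) P => P; exact: P.
  apply: (@evT_case _ _ _ _ _ l (rev (map snd y))); first by rewrite updE.
  by case: (l) P => P; exact: P.
have [|||t tle E] := main x [::] (upd s 2 [:: false]) => //.
rewrite cats0 in E.
exists (1 + (t + (4 * sz x + 2))); first by lia.
apply: (@ev_seq _ _ _ _ (upd s 2 [:: false])).
  by rewrite -s2; apply: ev_push.
apply: ev_seq E _; set s4 := upd _ 2 _.
have Z : s4 2 = ser (enc x) by [].
rewrite -[sz x]/(size (ser (enc x))) -Z.
apply: ev_to (ev_move _ _ _ _) _ => //.
by rewrite Z /s4; store_eq; rewrite cats0.
Qed.

Lemma encode_range n (e : rel 'I_n) k : {in encode e k, forall a, 0 < a < 4}.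
Proof.
move=> a; rewrite mem_cat inE => /orP[/allpairsPdep[i [j [_ _ ->]]]|/orP[/eqP->|]] //.
  by case: (e i j).
by rewrite mem_nseq => /andP[_ /eqP ->].
Qed.

Lemma computes_mono A B {eA : Enc A} {eB : Enc B} c m m' a (f : A -> B) :
  m <= m' -> computes c m a f -> computes c m' a f.
Proof. by move=> le H x s s0 sj; apply: H => // j jm; apply: sj; lia. Qed.

Section Program.
Variables (cI cG : cmd) (m aI aG : nat).
Hypotheses (m3 : 2 < m) (uI : uses cI m) (uG : uses cG m).
Hypothesis HI : computes cI m aI (fun x : seq symbol => (x, zeros x)).
Hypothesis HG : computes cG m aG search_round.

Definition program : cmd := Seq parse (Seq cI (Seq (Push m true) (main_loop cG m))).

Lemma uses_program : uses program m.+2.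
Proof.
have le : m <= m.+2 by lia.
by rewrite /program /= !(@uses_mono _ m m.+2) //; lia.
Qed.

(** Parsing and initialisation run in polynomial time, so their own running time bounds their
    heights; the loop contributes its bound per round. Only the number of rounds brings in
    [2 ^ L]. *)
Lemma program_run (w : seq nat) L : let x := decode_word w in zeros x = nseq L false ->
  let N := sz x + 4 * L + 2 in let T := pb aG N + 12 in
  exists s' t ans, [/\ t <= 15 * sz x + 4 + (pb aI (sz x) + (1 + (2 ^ L * T.+1 + 1))),
    ev (fun h => h <= N + T + 2 + (16 * sz x + 4 + pb aI (sz x))) program (input_store w) t s',
    s' m.+1 = [:: ans] &
    ans <-> exists b', size b' = L /\ check (x, b')].
Proof.
move=> x zx N T; set B := _ + (_ + pb aI _).
have szx : size x <= sz x by exact: size_le_sz.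
have i0 : input_store w 0 = rev (map fst x).
  by rewrite /input_store /= /x /decode_word -map_comp.
have i1 : input_store w 1 = rev (map snd x).
  by rewrite /input_store /= /x /decode_word -map_comp.
have iE j : 1 < j -> input_store w j = [::] by case: j => [|[|j]].
have [t1 t1le E1] := ev_parse i0 i1 (iE 2 isT).
set s1 := upd _ 1 _ in E1.
have s10 : s1 0 = ser (enc x) by [].
have s1j j : 0 < j -> s1 j = [::].
  by move=> j0; rewrite /s1 !updE; case: eqP => // ne; case: eqP => [|_]; [lia | apply: iE; lia].
have [|t2 t2le E2] := HI s10; first by move=> j jm; apply: s1j; lia.
rewrite zx in E2; set s2 := upd _ 0 _ in E2.
pose s3 := upd s2 m (true :: s2 m).
have s2m : s2 m = [::] by rewrite /s2 updE; case: eqP => [|_]; [lia | apply: s1j; lia].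
have [||||||| s' [tl [ans [tlle E3 s'a ansP]]]] :=
    @main_loop_run cG m aG _ uG HG x L (2 ^ L) (nseq L false) s3.
- by lia.
- by rewrite bval_zeros.
- by rewrite size_nseq.
- by rewrite /s3 updE; case: eqP => [|_]; [lia | ].
- move=> j jm; rewrite /s3 updE; case: eqP => [|_]; first by lia.
  by rewrite /s2 updE; case: eqP => [|_]; [lia | apply: s1j; lia].
- by rewrite /s3 updE eqxx s2m.
- rewrite /s3 updE; case: eqP => [|_]; first by lia.
  by rewrite /s2 updE; case: eqP => [|_]; [lia | apply: s1j; lia].
exists s', (t1 + (t2 + (1 + tl))), ans; split => //.
- by apply: leq_add; [lia | apply: leq_add => //; rewrite leq_add2l].
- apply: (ev_seq (s2 := s1)).
    apply: (ev_bound (m := m.+2) E1); first by have /and3P[] := uses_program.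
    move=> j _; have : size (input_store w j) <= sz x; last by rewrite /B; lia.
    by case: j => [|[|j]]; rewrite ?i0 ?i1 ?iE // size_rev size_map.
  apply: (ev_seq (s2 := s2)).
    apply: (ev_bound E2 uI) => j jm.
    have : size (s1 j) <= sz x; last by rewrite /B; lia.
    by case: j jm => [|j] jm; [rewrite s10 | rewrite s1j].
  apply: (ev_seq (s2 := s3)); first by apply: ev_push; rewrite s2m.
  by apply: ev_ok E3 => h; rewrite !unfold_in /B => hB; apply: leq_trans hB (leq_addr _ _).
- rewrite ansP; split=> [[b' [h1 _ h2]]|[b' [h1 h2]]]; exists b'; split => //.
  by rewrite bval_zeros.
Qed.

End Program.

Lemma pbd_exp f : pbd f -> exists c d, forall y, f y <= c * (y + 1) ^ d.
Proof.
move=> [a Ha]; exists (2 ^ a), a => y; apply: leq_trans (Ha y) _.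
by rewrite -expnMn /pb; case: a {Ha} => // a; rewrite leq_exp2r //; lia.
Qed.

Theorem mainTheorem9 :
  exists (M : TM) (c d : nat),
    forall (n : nat) (e : rel 'I_n),
      symmetric e -> irreflexive e ->
      forall k : nat,
        decides_within M (encode e k) (c * 4 ^ k * (n + k + 1) ^ d)
          (vc_above_mm e k).
Proof.
have [cI [mI [aI [_ uI HI]]]] := FP_init.
have [cG [mG [aG [_ uG HG]]]] := FP_search_round.
pose m := maxn (maxn mI mG) 3.
have [leI leG m3] : [/\ mI <= m, mG <= m & 2 < m] by rewrite /m; split; lia.
clearbody m.
have {}uI := uses_mono leI uI; have {}uG := uses_mono leG uG.
have {}HI := computes_mono leI HI; have {}HG := computes_mono leG HG.
have [M HM] := program_machine (uses_program m3 uI uG) (leqnn m.+1).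
(* Bounds in terms of [y = n + k]: [Y] for the decoded input, [T] for one round, [G] for the total
   time divided by [4 ^ k], and [B] for the stack heights. The term [8 * y] comes from the [2k] bits
   of a candidate, at four symbols each. *)
pose Y y := 8 * (y * y + y + 1) + 1.
pose T y := pb aG (Y y + 8 * y + 2) + 12.
pose G y := 15 * Y y + 4 + (pb aI (Y y) + (1 + ((T y + 1) + 1))) + 1.
pose B y := Y y + 8 * y + 2 + T y + 2 + (16 * Y y + 4 + pb aI (Y y)).
have [c [d Hcd]] : exists c d, forall y, G y * (2 * B y + 2) + 3 <= c * (y + 1) ^ d.
  apply: pbd_exp; rewrite /G /B /T /Y; pbd_tac.
exists M, c, d => n e esym eirr k.
set w := encode e k; pose y := n + k.
have [s' [t [ans [tle E s'a ansP]]]] :=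
  program_run m3 uI uG HI HG (zeros_encode e k).
have -> : vc_above_mm e k = ans.
  apply/idP/idP.
    by move=> /(vc_check k esym eirr)[b sb cb]; apply/ansP; exists b.
  by move=> /ansP[b [sb cb]]; apply/(vc_check k esym eirr); exists b.
have s'le : size (s' m.+1) <= 1 by rewrite s'a.
have szY : sz (decode_word w) <= Y y.
  by apply: leq_trans (sz_decode e k) _; rewrite /Y /y; nia.
have e4 : 2 ^ (k + k) = 4 ^ k by rewrite addnn -mul2n expnM.
have p4 : 0 < 4 ^ k by rewrite expn_gt0.
rewrite e4 -/w in tle.
apply: (HM w _ t s' ans [::] (@encode_range n e k) E s'a).
  by rewrite s'a /=; lia.
set N := sz _ + 4 * (k + k) + 2 in tle *.
have NY : N <= Y y + 8 * y + 2.
  by rewrite leq_add2r; apply: leq_add; [exact: szY | rewrite /y; lia].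
have TY : pb aG N + 12 <= T y by rewrite leq_add2r; apply: pb_mono.
have IY : pb aI (sz (decode_word w)) <= pb aI (Y y) by apply: pb_mono.
have BY : N + (pb aG N + 12) + 2 + (16 * sz (decode_word w) + 4 + pb aI (sz (decode_word w))) <= B y.
  by rewrite /B; lia.
(* The polynomial overhead of parsing and initialisation is charged once per round, which is
   harmless as [4 ^ k] is positive. *)
have tG : t.+1 <= 4 ^ k * G y.
  apply: (@leq_trans (15 * Y y + 4 + (pb aI (Y y) + (1 + (4 ^ k * (T y).+1 + 1))) + 1)).
    have := leq_mul (leqnn (4 ^ k)) (TY : (pb aG N + 12).+1 <= (T y).+1).
    move: (4 ^ k * (pb aG N + 12).+1) (4 ^ k * (T y).+1) tle => u v tle uv; lia.
  have -> : G y = (15 * Y y + pb aI (Y y) + 7) + (T y).+1 by rewrite /G; lia.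
  rewrite mulnDr; have := leq_pmull (15 * Y y + pb aI (Y y) + 7) p4.
  move: (4 ^ k * (15 * Y y + pb aI (Y y) + 7)) (4 ^ k * (T y).+1) => u v; lia.
have := Hcd y; rewrite /y => H.
apply: (@leq_trans (4 ^ k * (G y * (2 * B y + 2) + 3))); last first.
  by rewrite [c * _]mulnC -mulnA leq_mul2l H orbT.
rewrite [leqRHS]mulnDr; apply: leq_add; last by lia.
rewrite mulnA; apply: leq_mul => //. rewrite leq_add2r leq_mul2l. exact: BY.
Qed.
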